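(* Let $A, B \in \Omega_n$ with $A$ cyclic. If $B$ has only one eigenvalue, or $n\le 3$, then the function $l_{\Omega_n}(\cdot,B):\Omega_n\to[0,1)$ is continuous at $A$.
   Context: $\mathbb D$ is the open unit disk in $\mathbb C$. $\mathcal M_n$ is the set of all $n\times n$ complex matrices; $r(A)$ is the spectral radius of $A$. The spectral ball is $\Omega_n=\{A\in\mathcal M_n: r(A)<1\}$. A matrix $A\in\mathcal M_n$ is cyclic (non-derogatory) if it admits a cyclic vector, i.e. there is $v\in\mathbb C^n$ such that $v, Av,\dots,A^{n-1}v$ span $\mathbb C^n$. For a domain $D\subset\mathbb C^m$ and $z,w\in D$, the Lempert function is $$l_D(z,w):=\inf\{|\alpha|:\alpha\in\mathbb D \text{ and } \exists\,\varphi\in\mathcal O(\mathbb D,D):\varphi(0)=z,\ \varphi(\alpha)=w\},$$ where $\mathcal O(\mathbb D,D)$ is the set of holomorphic maps from $\mathbb D$ to $D$. *)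

(* Defs.v *)
From mathcomp Require Export all_boot all_order all_algebra.
From mathcomp Require Export all_classical all_reals topology normedtype derive.
From mathcomp.real_closed Require Export complex.
Export Order.TTheory GRing.Theory Num.Theory numFieldNormedType.Exports.

Set Implicit Arguments.
Unset Strict Implicit.
Unset Printing Implicit Defensive.

Local Open Scope classical_set_scope.
Local Open Scope ring_scope.

(* The complex numbers R[i] over R, packed as a [numClosedFieldType] so that
   the topology and normed-module structures provided by MathComp-Analysis for
   such fields (and for matrices over them) are inferred; [R[i]] itself has no
   canonical topology. *)
Definition Cx (R : realType) : numClosedFieldType := R[i].

(* The modulus as an element of R ([`|z|] lives in [Cx R]). *)
Definition modc (R : realType) (z : Cx R) : R := Normc.normc z.

Definition unit_disk (R : realType) : set (Cx R) := [set z | modc z < 1].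

(* Complex differentiability at every point of the open set [D]; values of [f]
   outside [D] are irrelevant. *)
Definition holomorphic_on (R : realType) (V : normedModType (Cx R))
    (D : set (Cx R)) (f : Cx R -> V) : Prop :=
  forall z, D z -> derivable f z 1.

(* When no disk joins [z] to [w] this is [inf set0 = 0]; that does not happen
   for [z], [w] in a domain [D]. *)
Definition lempert (R : realType) (V : normedModType (Cx R)) (D : set V)
    (z w : V) : R :=
  inf [set modc a | a in [set a : Cx R | unit_disk a /\
    exists f : Cx R -> V,
      [/\ holomorphic_on (@unit_disk R) f,
          (forall x, unit_disk x -> D (f x)),
          f 0 = z & f a = w]]].

Definition spectral_radius (R : realType) (n : nat) (A : 'M[Cx R]_n) : R :=
  sup [set modc a | a in [set a : Cx R | eigenvalue A a]].

Definition spectral_ball (R : realType) (n : nat) : set 'M[Cx R]_n :=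
  [set A | spectral_radius A < 1].

Definition cyclic_mx (R : realType) (n : nat) (A : 'M[Cx R]_n) : Prop :=
  exists v : 'cV[Cx R]_n,
    (<<[seq A ^+ k *m v | k <- iota 0 n]>> = fullv)%VS.

Lemma lempert_itv (R : realType) (V : normedModType (Cx R)) (D : set V)
    (z w : V) : 0 <= lempert D z w < 1.
Proof.
rewrite /lempert; set S := [set modc a | a in _].
have S0 x : S x -> 0 <= x.
  by move=> [[a b] _ <-]; exact: sqrtr_ge0.
have [->|/set0P[x Sx]] := eqVneq S set0; first by rewrite inf0 lexx ltr01.
apply/andP; split; first by apply: lb_le_inf; [exists x | exact: S0].
apply: (@le_lt_trans _ _ x); first by apply: ge_inf => //; exists 0; exact: S0.
by case: Sx => a [a1 _] <-.
Qed.

(* Main.v *)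
(* Conjugate [B] to a block bidiagonal matrix whose blocks have characteristic
   polynomials forming a chain for divisibility, let [lam] be its diagonal and
   [bet i] the number of the block of row [i]. If a holomorphic disc [f] in the
   spectral ball has [f alpha = B], then the [i]-th coefficient of [char_poly (f z)] in the
   Newton basis of [lam] is divisible by [(z - alpha) ^+ (bet i).+1]. Conversely, for
   cyclic [A], every holomorphic family of monic polynomials with these divisibilities,
   with roots in the open unit disc and with value [char_poly A] at [0] comes from a disc
   through [A] and [B]: it is the family of characteristic polynomials of a Hessenberg
   matrix, corrected at [0] and [alpha] by conjugation with an invertible holomorphic
   matrix. This criterion passes to the limit along an ultrafilter of matrices [Z]
   tending to [A]: bounded coefficients have limits by expansion in power series, and
   Harnack's inequality for the logarithmic derivative keeps the roots away from the unit
   circle. Hence lower semicontinuity at [A]. Upper semicontinuity follows by deforming a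
   disc [f] from [A] to [B] into [f (r z) + (1 - z r / alpha) (Z - A)]. *)
From HB Require Import structures.
Require Import Defs.
From mathcomp Require Import sequences realfun trigo.
From mathcomp Require Import fingroup perm zify ring lra.

Set Implicit Arguments.
Unset Strict Implicit.
Unset Printing Implicit Defensive.

Local Open Scope classical_set_scope.
Local Open Scope ring_scope.


(** * Modulus and complex differentiability *)

Section Modulus.
Context {R : realType}.
Implicit Types (x y z : Cx R) (r : R).

(** Only the characteristic polynomials of a disc are kept, because they have limits: discs through
    nearby matrices may be unbounded, while monic polynomials with roots in the unit disc have
    bounded coefficients. The order [(bet i).+1] comes from expanding a determinant by rows: with at
    most [bet i] rows perturbed, the untouched blocks still contain the factor [newton lam i.+1], so
    the coefficient is zero. Cyclicity of [A] recovers the matrix from its polynomial, two cyclic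
    matrices with the same characteristic polynomial being similar. At [alpha] the matrix need not
    be cyclic, and the Hessenberg family is built to degenerate there exactly to the bidiagonal
    form. Holomorphic functions are handled by means over roots of unity instead of integrals, with
    explicit constants, since the estimates must be uniform over the discs. Ultrafilters give limits
    of bounded families without subsequences. Interpolation requires [alpha != 0]; if the points
    [alpha] tend to [0], the divisibility makes the characteristic polynomials of [A] and [B] equal,
    and a constant family serves. *)

Definition cplx r : Cx R := (r%:C)%C.

Lemma normCxE z : `|z| = cplx (modc z). Proof. by []. Qed.

Lemma modc0 : modc (0 : Cx R) = 0. Proof. exact: Normc.normc0. Qed.
Lemma modc1 : modc (1 : Cx R) = 1. Proof. exact: Normc.normc1. Qed.
Lemma modcM x y : modc (x * y) = modc x * modc y.
Proof. exact: Normc.normcM. Qed.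
Lemma modcV x : modc x^-1 = (modc x)^-1. Proof. exact: Normc.normcV. Qed.
Lemma modcf x y : modc (x / y) = modc x / modc y.
Proof. by rewrite modcM modcV. Qed.
Lemma modcN x : modc (- x) = modc x. Proof. exact: normcN. Qed.
Lemma modcB x y : modc (x - y) = modc (y - x).
Proof. by rewrite -modcN opprB. Qed.
Lemma modcX x n : modc (x ^+ n) = modc x ^+ n.
Proof. by elim: n => [|n IH]; rewrite ?expr0 ?modc1// !exprS modcM IH. Qed.
Lemma modcD x y : modc (x + y) <= modc x + modc y.
Proof. exact: le_normcD. Qed.
Lemma modc_ge0 x : 0 <= modc x. Proof. by case: x => a b; exact: sqrtr_ge0. Qed.
Lemma modc_eq0 x : (modc x == 0) = (x == 0).
Proof.
by apply/eqP/eqP => [/Normc.eq0_normc//|->]; exact: modc0.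
Qed.
Lemma modc_gt0 x : (0 < modc x) = (x != 0).
Proof. by rewrite lt_neqAle modc_ge0 andbT eq_sym modc_eq0. Qed.
Lemma modcDB x y : modc x - modc y <= modc (x - y).
Proof. by have := modcD (x - y) y; rewrite subrK; lra. Qed.
Lemma modcD_ge x y : modc x - modc y <= modc (x + y).
Proof. by have := modcDB x (- y); rewrite opprK modcN. Qed.
Lemma modcBD x y : modc (x - y) <= modc x + modc y.
Proof. by rewrite -(modcN y) modcD. Qed.

Lemma cplx_modc r : modc (cplx r) = `|r|.
Proof. by rewrite /modc /cplx /= expr0n addr0 sqrtr_sqr. Qed.
Lemma cplx_is_zmod_morphism : zmod_morphism cplx.
Proof. exact: (rmorphB (real_complex R)). Qed.
Lemma cplx_is_monoid_morphism : GRing.monoid_morphism cplx.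
Proof. by split; [exact: (rmorph1 (real_complex R))|exact: (rmorphM (real_complex R))]. Qed.
HB.instance Definition _ := GRing.isZmodMorphism.Build R (Cx R) cplx cplx_is_zmod_morphism.
HB.instance Definition _ := GRing.isMonoidMorphism.Build R (Cx R) cplx cplx_is_monoid_morphism.

Lemma modc_nat n : modc (n%:R : Cx R) = n%:R.
Proof. by rewrite -(rmorph_nat cplx) cplx_modc ger0_norm. Qed.

Lemma modc_sum I (s : seq I) (P : pred I) (F : I -> Cx R) :
  modc (\sum_(i <- s | P i) F i) <= \sum_(i <- s | P i) modc (F i).
Proof.
elim/big_ind2: _ => [|x a y b xa yb|//]; first by rewrite modc0.
by rewrite (le_trans (modcD _ _))// lerD.
Qed.

Lemma Re_le_modc z : `|complex.Re z| <= modc z.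
Proof.
case: z => a b; rewrite /modc /= -sqrtr_sqr ler_wsqrtr//.
by rewrite lerDl sqr_ge0.
Qed.
Lemma Im_le_modc z : `|complex.Im z| <= modc z.
Proof.
case: z => a b; rewrite /modc /= -sqrtr_sqr ler_wsqrtr//.
by rewrite lerDr sqr_ge0.
Qed.
Lemma modc_le_ReIm z : modc z <= `|complex.Re z| + `|complex.Im z|.
Proof.
case: z => a b /=.
have /le_trans := modcD (cplx a) ((0 : R) +i* b)%C.
rewrite /modc /= !expr0n addr0 !add0r !sqrtr_sqr addr0; exact.
Qed.
Lemma modc_sqr z : modc z ^+ 2 = complex.Re z ^+ 2 + complex.Im z ^+ 2.
Proof. by case: z => a b; rewrite sqr_sqrtr// addr_ge0 ?sqr_ge0. Qed.

(** The order of [Cx R] compares only numbers with equal imaginary parts, so a positive epsilon is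
    real. This turns limits in [Cx R] into estimates in [R]. *)
Lemma ltCx_gt0 (e : Cx R) : 0 < e -> e = cplx (complex.Re e) /\ 0 < complex.Re e.
Proof. by case: e => a b; rewrite ltcE /= => /andP[/eqP -> ?]; split. Qed.

Lemma cvgCxP (T : Type) (F : set_system T) (FF : Filter F) (u : T -> Cx R) (l : Cx R) :
  u @ F --> l <-> forall e : R, 0 < e -> \forall t \near F, modc (u t - l) < e.
Proof.
split=> [/cvgrPdist_lt H e e0|H].
  have /H : 0 < cplx e by rewrite /cplx ltcE /= eqxx.
  by apply: filterS => t; rewrite normCxE ltcE /= eqxx modcB.
apply/cvgrPdist_lt => e /ltCx_gt0[-> /H].
by apply: filterS => t; rewrite normCxE ltcE /= eqxx modcB.
Qed.

Lemma nbhsCxP z (P : set (Cx R)) :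
  nbhs z P <-> exists2 d : R, 0 < d & forall x, modc (x - z) < d -> P x.
Proof.
split=> [/nbhs_ballP[e /= /ltCx_gt0[-> d0] H]|[d d0 H]].
  by exists (complex.Re e) => // x xz; apply: H; rewrite /ball /= normCxE ltcE /= eqxx modcB.
apply/nbhs_ballP; exists (cplx d) => [|x]; first by rewrite /= ltcE /= eqxx.
by rewrite /ball /= normCxE ltcE /= eqxx modcB; exact: H.
Qed.

Lemma derivableCxP (F : Cx R -> Cx R) z :
  derivable F z 1 <-> exists D : Cx R, forall e : R, 0 < e ->
    exists2 d : R, 0 < d & forall x, modc (x - z) < d ->
      modc (F x - F z - D * (x - z)) <= e * modc (x - z).
Proof.
split=> [/cvg_ex[/= D /cvgCxP H]|[D H]].
  exists D => e e0; have [d d0 {}H] := (nbhsCxP _ _).1 (H _ e0).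
  exists d => // x xz; have [->|x0] := eqVneq x z.
    by rewrite !subrr mulr0 subr0 modc0 mulr0.
  have := H (x - z); rewrite subr0 subr_eq0 => /(_ xz x0) /ltW.
  rewrite /= [_%:A]mulr1 subrK -(ler_pM2r (_ : 0 < modc (x - z))) ?modc_gt0 ?subr_eq0//.
  by rewrite -modcM mulrBl [_ *: _]mulrC mulfVK// subr_eq0.
apply/cvg_ex; exists D; apply/cvgCxP => e e0.
have [|d d0 {}H] := H (e / 2); first lra.
apply/nbhsCxP; exists d => // x; rewrite subr0 => xd x0 /=.
have := H (x + z); rewrite addrK => /(_ xd) /=.
rewrite /= [_%:A]mulr1 => h.
have mx : 0 < modc x by rewrite modc_gt0.
rewrite -(ltr_pM2r mx) -modcM mulrBl [_ *: _]mulrC mulfVK//.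
by apply: (le_lt_trans h); rewrite ltr_pM2r//; lra.
Qed.

Implicit Types F G : Cx R -> Cx R.

Lemma derivable_add F G z : derivable F z 1 -> derivable G z 1 ->
  derivable (fun x => F x + G x) z 1.
Proof. move=> Fd Gd; exact (derivableD Fd Gd). Qed.

Lemma derivable_sub F G z : derivable F z 1 -> derivable G z 1 ->
  derivable (fun x => F x - G x) z 1.
Proof. move=> Fd Gd; exact (derivableB Fd Gd). Qed.

Lemma derivable_mul F G z : derivable F z 1 -> derivable G z 1 ->
  derivable (fun x => F x * G x) z 1.
Proof. move=> Fd Gd; exact (derivableM Fd Gd). Qed.

Lemma derivable_inv F z : F z != 0 -> derivable F z 1 ->
  derivable (fun x => (F x)^-1) z 1.
Proof. move=> F0 Fd; exact (derivableV F0 Fd). Qed.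

Lemma derivable_exp F z n : derivable F z 1 -> derivable (fun x => F x ^+ n) z 1.
Proof.
move=> Fd; elim: n => [|n IH]; first exact: derivable_cst.
under eq_fun do rewrite exprS; exact: derivable_mul.
Qed.

Lemma derivable_bigsum I (s : seq I) (P : pred I) (F : I -> Cx R -> Cx R) z :
  (forall i, P i -> derivable (F i) z 1) ->
  derivable (fun x => \sum_(i <- s | P i) F i x) z 1.
Proof.
move=> Fd; elim: s => [|i s IH].
  by under eq_fun do rewrite big_nil; exact: derivable_cst.
case Pi: (P i); last by under eq_fun do rewrite big_cons Pi.
under eq_fun do rewrite big_cons Pi.
by apply: derivable_add IH; exact: Fd.
Qed.

Lemma derivable_bigprod I (s : seq I) (P : pred I) (F : I -> Cx R -> Cx R) z :
  (forall i, P i -> derivable (F i) z 1) ->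
  derivable (fun x => \prod_(i <- s | P i) F i x) z 1.
Proof.
move=> Fd; elim: s => [|i s IH].
  by under eq_fun do rewrite big_nil; exact: derivable_cst.
case Pi: (P i); last by under eq_fun do rewrite big_cons Pi.
under eq_fun do rewrite big_cons Pi.
by apply: derivable_mul IH; exact: Fd.
Qed.

End Modulus.

(** * Goursat's theorem and Cauchy's formula for discrete means *)

Section Goursat.
Context {R : realType}.
Implicit Types (p q : R * R) (gam : R * R -> Cx R) (g : Cx R -> Cx R).

Definition midp p q : R * R := ((p.1 + q.1) / 2, (p.2 + q.2) / 2).

(** Trapezoid rule for the integral of [g] along the image under [gam] of the segment from [p] to
    [q], cut into [2 ^ k] pieces. Defining it by halving makes additivity at midpoints hold by
    computation. *)
Fixpoint trapezoid g gam k p q : Cx R :=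
  if k is k'.+1 then
    trapezoid g gam k' p (midp p q) + trapezoid g gam k' (midp p q) q
  else (g (gam p) + g (gam q)) / 2 * (gam q - gam p).

Lemma midpC p q : midp p q = midp q p.
Proof. by rewrite /midp addrC [p.2 + _]addrC. Qed.

Lemma trapezoidC g gam k p q : trapezoid g gam k q p = - trapezoid g gam k p q.
Proof.
elim: k p q => [|k IH] p q /=; first by ring.
by rewrite midpC IH [trapezoid _ _ _ (midp p q) p]IH; ring.
Qed.

Lemma trapezoid_translate g gam k (v : R * R) p q :
  (forall p, gam (p.1 + v.1, p.2 + v.2) = gam p) ->
  trapezoid g gam k (p.1 + v.1, p.2 + v.2) (q.1 + v.1, q.2 + v.2) =
  trapezoid g gam k p q.
Proof.
move=> E; elim: k p q => [|k IH] p q /=; first by rewrite !E.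
have -> : midp (p.1 + v.1, p.2 + v.2) (q.1 + v.1, q.2 + v.2) =
    ((midp p q).1 + v.1, (midp p q).2 + v.2).
  by rewrite /midp /=; congr pair; lra.
by rewrite !IH.
Qed.

(** The last term is the increment of a primitive of [c + D * (x - z)]. It cancels around a closed
    contour and leaves only the remainder of [g] at [z]. *)
Lemma trapezoid_sub_affine g gam k (c D z : Cx R) p q :
  trapezoid g gam k p q =
  trapezoid (fun x => g x - c - D * (x - z)) gam k p q
  + ((c - D * z) * (gam q - gam p) + D / 2 * (gam q ^+ 2 - gam p ^+ 2)).
Proof.
elim: k p q => [|k IH] p q /=; first by field.
by rewrite IH [trapezoid g gam k (midp p q) q]IH; ring.
Qed.

(** Supremum times length. Closure of [K] under midpoints is enough, so the estimate serves for a
    square as well as for a single line. *)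
Lemma modc_trapezoid g gam k (K : set (R * R)) (L M : R) p q :
  (forall p q, K p -> K q -> K (midp p q)) ->
  (forall p q, K p -> K q ->
    modc (gam p - gam q) <= L * (`|p.1 - q.1| + `|p.2 - q.2|)) ->
  (forall p, K p -> modc (g (gam p)) <= M) -> K p -> K q ->
  modc (trapezoid g gam k p q) <= M * (L * (`|q.1 - p.1| + `|q.2 - p.2|)).
Proof.
move=> Km KL KM; elim: k p q => [|k IH] p q Kp Kq.
  rewrite /= modcM ler_pM ?modc_ge0//; last exact: KL.
  rewrite modcM modcV modc_nat ler_pdivrMr//.
  by apply: le_trans (modcD _ _) _; have := KM _ Kp; have := KM _ Kq; lra.
apply: le_trans (modcD _ _) _.
have := IH p (midp p q) Kp (Km _ _ Kp Kq).
have := IH (midp p q) q (Km _ _ Kp Kq) Kq.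
rewrite /midp /=.
have -> : (p.1 + q.1) / 2 - p.1 = (q.1 - p.1) / 2 by lra.
have -> : (p.2 + q.2) / 2 - p.2 = (q.2 - p.2) / 2 by lra.
have -> : q.1 - (p.1 + q.1) / 2 = (q.1 - p.1) / 2 by lra.
have -> : q.2 - (p.2 + q.2) / 2 = (q.2 - p.2) / 2 by lra.
rewrite !normrM normfV (ger0_norm (_ : 0 <= 2))// => h1 h2.
by have := lerD h1 h2; set x := `| _ |; set y := `| _ |; lra.
Qed.

Definition square_sum g gam k (p : R * R) (h : R) : Cx R :=
  trapezoid g gam k p (p.1 + h, p.2)
  + trapezoid g gam k (p.1 + h, p.2) (p.1 + h, p.2 + h)
  + trapezoid g gam k (p.1 + h, p.2 + h) (p.1, p.2 + h)
  + trapezoid g gam k (p.1, p.2 + h) p.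

(** The inner edges are run twice in opposite directions and cancel. One level of refinement is
    spent on halving the square. *)
Lemma square_sumS g gam k p h :
  square_sum g gam k.+1 p h =
  square_sum g gam k p (h / 2) + square_sum g gam k (p.1 + h / 2, p.2) (h / 2)
  + square_sum g gam k (p.1, p.2 + h / 2) (h / 2)
  + square_sum g gam k (p.1 + h / 2, p.2 + h / 2) (h / 2).
Proof.
case: p => a c; rewrite /square_sum /= /midp /=.
have E1 (x : R) : (x + x) / 2 = x by lra.
have E2 (x : R) : (x + (x + h)) / 2 = x + h / 2 by lra.
have E3 (x : R) : (x + h + (x + h)) / 2 = x + h by lra.
have E4 (x : R) : (x + h + x) / 2 = x + h / 2 by lra.
have E5 (x : R) : x + h / 2 + h / 2 = x + h by lra.
rewrite !(E1, E2, E3, E4, E5).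
set m := (a + h / 2, c + h / 2).
by rewrite !(trapezoidC _ _ _ _ m); ring.
Qed.

Definition in_square p (h : R) : set (R * R) :=
  [set q | p.1 <= q.1 <= p.1 + h /\ p.2 <= q.2 <= p.2 + h].

Lemma in_square_midp p h q1 q2 :
  in_square p h q1 -> in_square p h q2 -> in_square p h (midp q1 q2).
Proof.
by move=> [/andP[? ?] /andP[? ?]] [/andP[? ?] /andP[? ?]]; split => /=; lra.
Qed.

(** Since each bisection lowers [k] by one, smallness is asked only eventually in [k]. *)
Let bad g gam (e : R) p h :=
  ~ (\forall k \near \oo, modc (square_sum g gam k p h) < e).

Lemma bad_subsquare g gam e p h : 0 <= h -> bad g gam e p h ->
  exists q, bad g gam (e / 4) q (h / 2) /\ in_square p (h / 2) q.
Proof.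
move=> h0 B; apply: contrapT => NE; apply: B.
have G q : in_square p (h / 2) q ->
    \forall k \near \oo, modc (square_sum g gam k q (h / 2)) < e / 4.
  by move=> iq; apply: contrapT => bq; apply: NE; exists q.
have [G1 G2] : in_square p (h / 2) p /\ in_square p (h / 2) (p.1 + h / 2, p.2).
  by split; split => /=; lra.
have [G3 G4] : in_square p (h / 2) (p.1, p.2 + h / 2) /\
    in_square p (h / 2) (p.1 + h / 2, p.2 + h / 2).
  by split; split => /=; lra.
have [N _ HN] : \forall k \near \oo, modc (square_sum g gam k.+1 p h) < e.
  have [N1 _ H1] := G _ G1; have [N2 _ H2] := G _ G2.
  have [N3 _ H3] := G _ G3; have [N4 _ H4] := G _ G4.
  exists (maxn (maxn N1 N2) (maxn N3 N4)) => // k /=.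
  rewrite !geq_max => /andP[/andP[/H1 /= a1 /H2 /= a2] /andP[/H3 /= a3 /H4 /= a4]].
  rewrite square_sumS.
  apply: le_lt_trans (modcD _ _) _.
  have := modcD (square_sum g gam k p (h / 2) + square_sum g gam k (p.1 + h / 2, p.2) (h / 2))
    (square_sum g gam k (p.1, p.2 + h / 2) (h / 2)).
  have := modcD (square_sum g gam k p (h / 2)) (square_sum g gam k (p.1 + h / 2, p.2) (h / 2)).
  by lra.
by exists N.+1 => // -[//|k] Nk; exact: HN.
Qed.

(* Goursat's bisection argument; additivity of the trapezoid sums replaces
   additivity of the integral, and they are exact on affine functions. *)
Lemma goursat g gam (L : R) :
  (forall p q, in_square (0, 0) 1 p -> in_square (0, 0) 1 q ->
    modc (gam p - gam q) <= L * (`|p.1 - q.1| + `|p.2 - q.2|)) ->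
  (forall p, in_square (0, 0) 1 p -> derivable g (gam p) 1) ->
  square_sum g gam k (0, 0) 1 @[k --> \oo] --> (0 : Cx R).
Proof.
move=> gL gd; apply/cvgCxP => e e0; apply: contrapT => B0.
have {}B0 : bad g gam e (0, 0) 1.
  by move=> H; apply: B0; move: H; apply: filterS => k; rewrite subr0.
(* The successor is chosen for every pair but is meaningful only for bad squares. The index is
   carried along because it determines the side. *)
have /choice[nx nxP] (x : nat * (R * R)) : exists y : nat * (R * R),
    bad g gam (e / 4 ^+ x.1) x.2 (2^-1 ^+ x.1) ->
    [/\ y.1 = x.1.+1, bad g gam (e / 4 ^+ y.1) y.2 (2^-1 ^+ y.1) &
    in_square x.2 (2^-1 ^+ x.1 / 2) y.2].
  have [B|NB] := pselect (bad g gam (e / 4 ^+ x.1) x.2 (2^-1 ^+ x.1)); last first.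
    by exists x.
  have [|q [Bq iq]] := bad_subsquare _ B; first by rewrite exprn_ge0// invr_ge0.
  exists (x.1.+1, q); split => //=.
  by rewrite !exprSr invfM mulrA.
pose u n := iter n nx (0%N, (0, 0)).
have uP n : (u n).1 = n /\ bad g gam (e / 4 ^+ n) (u n).2 (2^-1 ^+ n).
  elim: n => [|n [IH1 IH2]]; first by rewrite /u /= !expr0 divr1.
  have := nxP (u n); rewrite IH1 => /(_ IH2) [E]; rewrite E => B _.
  by split.
have uS n : in_square (u n).2 (2^-1 ^+ n / 2) (u n.+1).2.
  by have [E B] := uP n; have := nxP (u n); rewrite E => /(_ B) [].
have h0 n : 0 < (2^-1 : R) ^+ n by rewrite exprn_gt0// invr_gt0.
have hS n : (2^-1 : R) ^+ n.+1 = 2^-1 ^+ n / 2 by rewrite exprSr.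
have uD m n : in_square (u n).2 (2^-1 ^+ n - 2^-1 ^+ (n + m)) (u (n + m)%N).2.
  elim: m => [|m [IH1 IH2]]; first by rewrite addn0 subrr; split; lra.
  rewrite addnS hS; have [] := uS (n + m)%N.
  by have := h0 (n + m)%N; split; lra.
have uD' n m : in_square (u n).2 (2^-1 ^+ n) (u (maxn n m)).2.
  rewrite -(subnKC (leq_maxl n m)).
  have [] := uD (maxn n m - n)%N n; have := h0 (n + (maxn n m - n))%N.
  by split; lra.
(* Nested intervals: the lower corners increase and each later one stays within one side of the
   earlier, so their supremum lies in every interval. *)
have sU (f : R * R -> R) :
    (forall n, f (u n).2 <= f (u n.+1).2) ->
    (forall n m, f (u (maxn n m)).2 <= f (u n).2 + 2^-1 ^+ n) ->
    exists l, forall n, f (u n).2 <= l <= f (u n).2 + 2^-1 ^+ n.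
  move=> inc ub.
  have inc' n m : (n <= m)%N -> f (u n).2 <= f (u m).2.
    by move=> /subnKC <-; elim: (m - n)%N => [|k /le_trans]; rewrite ?addn0// addnS; apply.
  exists (sup [set f (u n).2 | n in setT]) => n.
  have bd k : ubound [set f (u n).2 | n in setT] (f (u k).2 + 2^-1 ^+ k).
    move=> _ [m _ <-]; apply: le_trans (ub k m); apply: inc'; exact: leq_maxr.
  apply/andP; split.
    by apply: ub_le_sup; [exists (f (u 0%N).2 + 2^-1 ^+ 0) ; exact: bd|exists n].
  by apply: ge_sup; [exists (f (u 0%N).2), 0%N|exact: bd].
have [a aP] : exists a, forall n, (u n).2.1 <= a <= (u n).2.1 + 2^-1 ^+ n.
  apply: (sU fst) => [n|n m]; [by have [/andP[]] := uS n|].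
  by have [/andP[]] := uD' n m.
have [c cP] : exists c, forall n, (u n).2.2 <= c <= (u n).2.2 + 2^-1 ^+ n.
  apply: (sU snd) => [n|n m]; [by have [_ /andP[]] := uS n|].
  by have [_ /andP[]] := uD' n m.
have sub n q : in_square (u n).2 (2^-1 ^+ n) q -> in_square (0, 0) 1 q.
  have := uD n 0%N; rewrite add0n expr0 /= => -[] /=; rewrite !add0r.
  by move=> /andP[? ?] /andP[? ?] [/andP[? ?] /andP[? ?]]; split => /=; lra.
have ac n : in_square (u n).2 (2^-1 ^+ n) (a, c) by split => /=.
have ac0 := sub _ _ (ac 0%N).
have [D HD] := (derivableCxP _ _).1 (gd _ ac0).
set z := gam (a, c) in HD.
have L0 : 0 <= L.
  have i0 : in_square (0, 0) 1 (0, 0) by split => /=; lra.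
  have i1 : in_square (0, 0) 1 (1, 0) by split => /=; lra.
  have := le_trans (modc_ge0 _) (gL _ _ i1 i0).
  by rewrite /= subrr !subr0 normr0 addr0 normr1 mulr1.
(* The four edges of a square of side [h] contribute at most [8 * L ^+ 2 * eta * h ^+ 2], which must
   be less than [e * h ^+ 2]; the [+ 1] covers [L = 0]. *)
pose eta := e / (16 * L ^+ 2 + 1).
have e10 : 0 < 16 * L ^+ 2 + 1 by have := sqr_ge0 L; lra.
have [d d0 {}HD] := HD eta (divr_gt0 e0 e10).
have [n nd] : exists n, L * (2 * (2^-1) ^+ n) < d.
  have [L00|L1] := eqVneq L 0; first by exists 0%N; rewrite L00 mul0r.
  have dL : 0 < d / (2 * L) by rewrite divr_gt0// mulr_gt0// lt0r L1.
  have : (2^-1 : R) ^+ n @[n --> \oo] --> 0.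
    by apply: cvg_expr; rewrite ger0_norm; lra.
  move=> /cvgr0_norm_lt /(_ _ dL) [n _ /(_ n (leqnn n))].
  have L2 : 0 < 2 * L by rewrite mulr_gt0// lt0r L1.
  rewrite ger0_norm ?(ltW (h0 n))// ltr_pdivlMr// => ?.
  by exists n; rewrite mulrCA mulrA mulrC.
have [_ bn] := uP n; apply: bn; apply: nearW => k.
set p := (u n).2; set h := 2^-1 ^+ n; have h0n : 0 < h := h0 n.
have four : (4^-1 : R) ^+ n = h ^+ 2.
  by rewrite /h -exprM mulnC exprM; congr (_ ^+ _); rewrite expr2 -invfM -natrM.
rewrite -exprVn four.
pose g' x := g x - g z - D * (x - z).
have Ku q : in_square p h q -> in_square (0, 0) 1 q by exact: sub.
have near_z q : in_square p h q -> modc (gam q - z) <= L * (2 * h).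
  move=> iq; apply: le_trans (gL _ _ (Ku _ iq) ac0) _.
  rewrite ler_wpM2l//=; have [/andP[a1 a2] /andP[a3 a4]] := iq.
  have [/= /andP[b1 b2] /andP[b3 b4]] := ac n.
  have : `|q.1 - a| <= h by rewrite ler_norml; apply/andP; split; rewrite /h /p in a1 a2 *; lra.
  have : `|q.2 - c| <= h by rewrite ler_norml; apply/andP; split; rewrite /h /p in a3 a4 *; lra.
  by lra.
have gM q : in_square p h q -> modc (g' (gam q)) <= eta * (L * (2 * h)).
  move=> iq; have nq := near_z _ iq.
  apply: le_trans (HD _ (le_lt_trans nq nd)) _.
  by rewrite ler_wpM2l// divr_ge0 ?ltW.
have KL q1 q2 : in_square p h q1 -> in_square p h q2 ->
    modc (gam q1 - gam q2) <= L * (`|q1.1 - q2.1| + `|q1.2 - q2.2|).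
  by move=> /Ku ? /Ku ?; exact: gL.
have [i1 i2] : in_square p h p /\ in_square p h (p.1 + h, p.2).
  by split; split => /=; lra.
have [i3 i4] : in_square p h (p.1 + h, p.2 + h) /\ in_square p h (p.1, p.2 + h).
  by split; split => /=; lra.
have tb q1 q2 := @modc_trapezoid g' gam k (in_square p h) L _ q1 q2
  (@in_square_midp p h) KL gM.
have -> : square_sum g gam k p h = square_sum g' gam k p h.
  rewrite /square_sum !(trapezoid_sub_affine g gam k (g z) D z).
  by rewrite -/g'; ring.
have hN1 x : `|x + h - x| = h :> R.
  by rewrite addrAC subrr add0r gtr0_norm.
have hN2 y : `|y - (y + h)| = h :> R.
  by rewrite opprD addrA subrr sub0r normrN gtr0_norm.
have := tb _ _ i1 i2; have := tb _ _ i2 i3; have := tb _ _ i3 i4; have := tb _ _ i4 i1.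
rewrite /= !hN1 !hN2 !subrr !normr0 ?addr0 ?add0r => t4 t3 t2 t1.
apply: (@le_lt_trans _ _ (4 * (eta * (L * (2 * h)) * (L * h)))).
  rewrite /square_sum; move: t1 t2 t3 t4.
  set T1 := trapezoid _ _ _ _ _; set T2 := trapezoid _ _ _ _ _.
  set T3 := trapezoid _ _ _ _ _; set T4 := trapezoid _ _ _ _ _.
  have := modcD (T1 + T2 + T3) T4; have := modcD (T1 + T2) T3; have := modcD T1 T2.
  by lra.
have -> : 4 * (eta * (L * (2 * h)) * (L * h)) = eta * (8 * L ^+ 2) * h ^+ 2 by ring.
have eL : eta * (8 * L ^+ 2) < e.
  rewrite /eta -mulrA [_^-1 * _]mulrC mulrA ltr_pdivrMr// ltr_pM2l//.
  by have := sqr_ge0 L; lra.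
by rewrite ltr_pM2r// exprn_gt0.
Qed.

End Goursat.

(** * Roots of unity and trapezoid sums on a circle *)

Section Circle.
Context {R : realType}.
Implicit Types (r s t : R) (z w : Cx R).

Lemma lipschitz_derive_le1 (f df : R -> R) :
  (forall x : R, is_derive x 1 f (df x)) -> (forall x, `|df x| <= 1) ->
  forall a b, `|f b - f a| <= `|b - a|.
Proof.
move=> fd df1; suff H a b : a <= b -> `|f b - f a| <= `|b - a|.
  by move=> a b; have [/H//|/ltW/H] := leP a b; rewrite distrC (distrC a).
move=> ab; have [|c _ ->] := MVT_segment ab (fun x _ => fd x).
  apply: continuous_subspaceT => x.
  by apply/differentiable_continuous/derivable1_diffP; have [] := fd x.
by rewrite normrM ler_piMl.
Qed.

Definition expc t : Cx R := (cos (2 * pi * t) +i* sin (2 * pi * t))%C.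

Lemma expcD s t : expc (s + t) = expc s * expc t.
Proof. by rewrite /expc mulrDr cosD sinD; congr (_ +i* _)%C; ring. Qed.

Lemma expc0 : expc 0 = 1. Proof. by rewrite /expc mulr0 cos0 sin0. Qed.

Lemma expc1 : expc 1 = 1.
Proof. by rewrite /expc mulr1 mulr_natl cos2pi sin2pi. Qed.

Lemma expc_half : expc (1 / 2) = -1.
Proof.
rewrite /expc; have -> : 2 * pi * (1 / 2) = pi :> R by field.
by rewrite cospi sinpi; apply/eqP; rewrite eq_complex /= oppr0 !eqxx.
Qed.

Lemma modc_expc t : modc (expc t) = 1.
Proof. by rewrite /modc /= cos2Dsin2 sqrtr1. Qed.

Lemma expc_neq0 t : expc t != 0.
Proof. by rewrite -modc_gt0 modc_expc. Qed.

Lemma expcX t n : expc t ^+ n = expc (t * n%:R).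
Proof.
elim: n => [|n IH]; first by rewrite expr0 mulr0 expc0.
by rewrite exprS IH -expcD -[n.+1]add1n natrD mulrDr mulr1.
Qed.

Lemma expc_neq1 t : 0 < t < 1 -> expc t != 1.
Proof.
move=> /andP[t0 t1]; apply/eqP => -[c1 _].
have p0 : 0 < pi :> R := pi_gt0 R.
have : 0 < sin (pi * t) by apply: sin_gt0_pi; rewrite mulr_gt0//= gtr_pMr.
move: c1; have -> : 2 * pi * t = pi * t + pi * t by lra.
rewrite cosD -!expr2 cos2sin2 => c1.
have /eqP : sin (pi * t) ^+ 2 = 0 by lra.
by rewrite sqrf_eq0 => /eqP ->; rewrite ltxx.
Qed.

Lemma expc_lipschitz s t : modc (expc s - expc t) <= 4 * pi * `|s - t|.
Proof.
apply: le_trans (modc_le_ReIm _) _.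
have -> : complex.Re (expc s - expc t) = cos (2 * pi * s) - cos (2 * pi * t) by [].
have -> : complex.Im (expc s - expc t) = sin (2 * pi * s) - sin (2 * pi * t) by [].
have sin1 (x : R) : `|- sin x| <= 1 by rewrite normrN sin_max.
have := lipschitz_derive_le1 (@is_derive_cos R) sin1 (2 * pi * t) (2 * pi * s).
have := lipschitz_derive_le1 (@is_derive_sin R) (@cos_max R) (2 * pi * t) (2 * pi * s).
by rewrite -mulrBr normrM gtr0_norm ?mulr_gt0 ?pi_gt0//; lra.
Qed.

(** Discrete counterpart of the integral of [F z / z] over the circle of radius [r], divided by
    [2 pi i]. The powers of two match the halvings in [trapezoid]. *)
Definition cmean k r (F : Cx R -> Cx R) : Cx R :=
  (\sum_(i < 2 ^ k) F (cplx r * expc (i%:R / (2 ^ k)%:R))) / (2 ^ k)%:R.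

Lemma trapezoid_vertical (g : Cx R -> Cx R) gam k s (a b : R) :
  trapezoid g gam k (s, a) (s, b) =
  \sum_(i < 2 ^ k)
    (let z := gam (s, a + (b - a) * (i%:R / (2 ^ k)%:R)) in
     let z' := gam (s, a + (b - a) * (i.+1%:R / (2 ^ k)%:R)) in
     (g z + g z') / 2 * (z' - z)).
Proof.
elim: k a b => [|k IH] a b /=.
  rewrite expn0 big_ord1 /= mul0r mulr0 addr0.
  by have -> : a + (b - a) * (1 / 1) = b by field.
rewrite /midp /=; have -> : (s + s) / 2 = s by lra.
rewrite !IH expnS mul2n -addnn big_split_ord /=.
have k0 : (2 ^ k)%:R != 0 :> R by rewrite pnatr_eq0 expn_eq0.
congr (_ + _); apply: eq_bigr => i _ /=.
  have E (x : R) : a + ((a + b) / 2 - a) * (x / (2 ^ k)%:R) =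
     a + (b - a) * (x / (2 ^ k + 2 ^ k)%:R).
    by rewrite natrD; field; rewrite k0 -natrD pnatr_eq0 addnn double_eq0 expn_eq0.
  by rewrite !E.
have E (x : nat) : (a + b) / 2 + (b - (a + b) / 2) * (x%:R / (2 ^ k)%:R) =
     a + (b - a) * ((2 ^ k + x)%:R / (2 ^ k + 2 ^ k)%:R).
  rewrite !natrD; field.
  by rewrite k0 -natrD pnatr_eq0 addnn double_eq0 expn_eq0.
by rewrite !E addnS.
Qed.

Lemma sumr_cycle (V : nmodType) (u : nat -> V) N :
  u N = u 0%N -> \sum_(i < N) u i.+1 = \sum_(i < N) u i.
Proof.
case: N => [|N] uN; first by rewrite !big_ord0.
by rewrite big_ord_recr [RHS]big_ord_recl /= uN addrC.
Qed.

(** Consecutive nodes differ by a constant factor, so each trapezoid splits into two terms that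
    reduce, after a cyclic shift, to the same sum. The factor in front of the mean approximates
    [2 pi i]. *)
Lemma trapezoid_circle (g : Cx R -> Cx R) (gam : R * R -> Cx R) k r :
  (forall t, gam (1, t) = cplx r * expc t) ->
  trapezoid g gam k (1, 0) (1, 1) =
  (2 ^ k)%:R * (expc (2 ^ k)%:R^-1 - (expc (2 ^ k)%:R^-1)^-1) / 2
  * cmean k r (fun z => z * g z).
Proof.
move=> gamE; rewrite trapezoid_vertical /cmean.
set N := (2 ^ k)%N; set om := expc N%:R^-1.
have N0 : N%:R != 0 :> R by rewrite pnatr_eq0 expn_eq0.
have N0' : N%:R != 0 :> Cx R by rewrite pnatr_eq0 expn_eq0.
pose z (i : nat) := cplx r * expc (i%:R / N%:R).
have zS i : z i.+1 = om * z i.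
  rewrite /z mulrCA /om -expcD; congr (_ * expc _).
  by rewrite -natr1; field.
have zN : z N = z 0%N by rewrite /z divff// mul0r expc0 expc1.
transitivity (\sum_(i < N) (g (z i) * (z i.+1 - z i) / 2
    + g (z i.+1) * (z i.+1 - z i) / 2)).
  apply: eq_bigr => i _ /=; rewrite !subr0 !add0r !mul1r !gamE -/(z i) -/(z i.+1).
  by rewrite -mulrDl -mulrDl; field.
rewrite big_split /=.
have -> : \sum_(i < N) g (z i.+1) * (z i.+1 - z i) / 2 =
    (1 - om^-1) / 2 * \sum_(i < N) z i * g (z i).
  have E i : g (z i.+1) * (z i.+1 - z i) / 2 = (1 - om^-1) / 2 * (z i.+1 * g (z i.+1)).
    by rewrite !zS; field; exact: expc_neq0.
  rewrite (eq_bigr _ (fun i _ => E _)) -mulr_sumr; congr (_ * _).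
  by apply: (@sumr_cycle _ (fun i => z i * g (z i))); rewrite zN.
have -> : \sum_(i < N) g (z i) * (z i.+1 - z i) / 2 =
    (om - 1) / 2 * \sum_(i < N) z i * g (z i).
  by rewrite mulr_sumr; apply: eq_bigr => i _; rewrite zS; field.
rewrite -mulrDl -/(z _).
under [in RHS]eq_bigr do rewrite -/(z _).
by field; rewrite N0' expc_neq0.
Qed.

Lemma modc_unitX1 (x : Cx R) n : modc x = 1 -> modc (x ^+ n - 1) <= n%:R * modc (x - 1).
Proof.
move=> x1; rewrite subrX1 modcM mulrC ler_wpM2r ?modc_ge0//.
apply: le_trans (modc_sum _ _ _) _.
rewrite (eq_bigr (fun _ => 1)) => [|i _]; last by rewrite modcX x1 expr1n.
by rewrite sumr_const card_ord.
Qed.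

(** A lower bound is enough. With [om] the root of unity, the [2 ^ k]-th power of [om ^+ 2] is [-1],
    at distance [2] from [1], whence [2 <= 2 ^ k * modc (om ^+ 2 - 1)]. *)
Lemma circle_factor_ge k :
  4 <= modc ((2 ^ k.+2)%:R * (expc (2 ^ k.+2)%:R^-1 - (expc (2 ^ k.+2)%:R^-1)^-1) / 2).
Proof.
set N := (2 ^ k.+2)%N; set om := expc _.
have N0 : N%:R != 0 :> R by rewrite pnatr_eq0 expn_eq0.
have -> : N%:R * (om - om^-1) / 2 = N%:R * (om ^+ 2 - 1) / (2 * om).
  by field; exact: expc_neq0.
rewrite !modcM modcV modcM modc_expc !modc_nat mulr1.
have := @modc_unitX1 (om ^+ 2) (2 ^ k); rewrite modcX modc_expc expr1n => /(_ erefl).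
rewrite -exprM expcX.
have -> : N%:R^-1 * (2 * 2 ^ k)%:R = 1 / 2 :> R.
  by rewrite /N !expnS mulnA natrM [(2 * 2 ^ k)%:R]natrM; field; rewrite pnatr_eq0 expn_eq0.
rewrite expc_half -opprD modcN -(natrD _ 1 1) modc_nat.
rewrite /N !expnS mulnA natrM.
set x := (2 ^ k)%:R; set y := modc _; lra.
Qed.

End Circle.

(** * Cauchy's formula as a limit of means *)

Section CauchyMean.
Context {R : realType}.
Implicit Types (r s t : R) (z w : Cx R) (F g : Cx R -> Cx R).

Lemma cmeanD k r F g : cmean k r (fun z => F z + g z) = cmean k r F + cmean k r g.
Proof. by rewrite /cmean big_split mulrDl. Qed.

Lemma cmeanZ k r c F : cmean k r (fun z => c * F z) = c * cmean k r F.
Proof. by rewrite /cmean -mulr_sumr mulrA. Qed.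

Lemma eq_cmean k r F g : 0 <= r -> (forall z, modc z = r -> F z = g z) ->
  cmean k r F = cmean k r g.
Proof.
move=> r0 E; rewrite /cmean; congr (_ / _); apply: eq_bigr => i _; apply: E.
by rewrite modcM cplx_modc modc_expc mulr1 ger0_norm.
Qed.

Lemma modc_cmean k r F M : 0 <= r -> (forall z, modc z = r -> modc (F z) <= M) ->
  modc (cmean k r F) <= M.
Proof.
move=> r0 HM; rewrite /cmean modcM modcV modc_nat ler_pdivrMr ?ltr0n ?expn_gt0//.
apply: le_trans (modc_sum _ _ _) _.
have -> : M * (2 ^ k)%:R = \sum_(i < 2 ^ k) M by rewrite sumr_const card_ord mulr_natr.
apply: ler_sum => i _; apply: HM.
by rewrite modcM cplx_modc modc_expc mulr1 ger0_norm.
Qed.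

Lemma cvg_modc_expr (x : Cx R) : modc x < 1 -> x ^+ (2 ^ k) @[k --> \oo] --> (0 : Cx R).
Proof.
move=> x1; apply/cvgCxP => e e0.
have : modc x ^+ n @[n --> \oo] --> 0.
  by apply: cvg_expr; rewrite ger0_norm ?modc_ge0.
move=> /cvgr0_norm_lt /(_ _ e0) [n _ Hn]; exists n => // k /= nk.
rewrite subr0 modcX.
apply: le_lt_trans (Hn k nk); rewrite ger0_norm ?exprn_ge0 ?modc_ge0//.
by apply: ler_wiXn2l; rewrite ?modc_ge0 ?(ltW x1)// ltnW// ltn_expl.
Qed.

(** With [x = w / cplx r], multiplying each term by [1 - x ^+ N] gives a geometric sum of powers of
    [x / om i]; averaging over the roots of unity [om i] kills all of them but the constant one. *)
Lemma cmean_kernel k r w : 0 < r -> modc w < r ->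
  cmean k r (fun z => z / (z - w)) = (1 - (w / cplx r) ^+ (2 ^ k))^-1.
Proof.
move=> r0 wr; set N := (2 ^ k)%N.
have N0 : N%:R != 0 :> R by rewrite pnatr_eq0 expn_eq0.
have N0' : N%:R != 0 :> Cx R by rewrite pnatr_eq0 expn_eq0.
have cr0 : cplx r != 0 by rewrite -modc_gt0 cplx_modc normr_gt0 gt_eqF.
set x := w / cplx r.
have x1 : modc x < 1 by rewrite modcf cplx_modc gtr0_norm// ltr_pdivrMr// mul1r.
have xn1 (y : Cx R) : modc y < 1 -> 1 - y != 0.
  by move=> y1; rewrite subr_eq0; apply: contraTneq y1 => <-; rewrite modc1 ltxx.
have xN1 : modc (x ^+ N) < 1 by rewrite modcX exprn_ilt1 ?modc_ge0// expn_eq0.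
pose om i := expc (i%:R / N%:R) : Cx R.
have omN i : om i ^+ N = 1.
  rewrite /om expcX mulfVK//; elim: i => [|i IH]; first exact: expc0.
  by rewrite -natr1 expcD IH expc1 mulr1.
have om0 i : om i != 0 by exact: expc_neq0.
apply: (mulIf N0'); rewrite /cmean mulfVK//.
apply: (mulIf (xn1 _ xN1)); rewrite mulrAC mulVf ?xn1// mul1r.
transitivity (\sum_(i < N) \sum_(m < N) (x / om i) ^+ m).
  rewrite mulr_suml; apply: eq_bigr => i _; rewrite -/(om i).
  have yE : (x / om i) ^+ N = x ^+ N by rewrite expr_div_n omN divr1.
  have y1 : modc (x / om i) < 1 by rewrite modcf modc_expc divr1.
  have zw : cplx r * om i - w = cplx r * om i * (1 - x / om i).
    by rewrite /x; field; rewrite cr0 om0.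
  have zn0 : cplx r * om i != 0 by rewrite mulf_neq0.
  rewrite zw invfM mulrA divff// mul1r.
  apply: (mulfI (xn1 _ y1)); rewrite mulrA divff ?xn1// mul1r.
  by rewrite -yE; apply: oppr_inj; rewrite opprB subrX1 -mulNr opprB.
rewrite exchange_big /=.
have N_gt0 : (0 < N)%N by rewrite expn_gt0.
rewrite (bigD1 (Ordinal N_gt0))//= [X in X + _](_ : _ = N%:R); last first.
  by under eq_bigr do rewrite expr0; rewrite sumr_const card_ord.
rewrite big1 ?addr0// => m m0.
have {}m0 : (0 < m)%N by rewrite lt0n; apply: contraNneq m0 => m0; apply/eqP/val_inj.
transitivity (x ^+ m * \sum_(i < N) ((om m)^-1) ^+ i).
  rewrite mulr_sumr; apply: eq_bigr => i _; rewrite expr_div_n; congr (_ * _).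
  by rewrite /om exprVn !expcX; congr (expc _)^-1; ring.
have omm : (om m)^-1 - 1 != 0.
  rewrite subr_eq0 invr_eq1; apply: expc_neq1.
  rewrite divr_gt0 ?ltr0n//= ltr_pdivrMr ?ltr0n// mul1r ltr_nat; exact: ltn_ord.
rewrite (_ : \sum_(i < N) _ = 0) ?mulr0//; apply: (mulfI omm).
by rewrite -subrX1 exprVn omN invr1 subrr mulr0.
Qed.

Section AtPoint.
Variables (F : Cx R -> Cx R) (r : R) (w : Cx R).
Hypotheses (r0 : 0 < r) (wr : modc w < r).
Hypothesis Fd : forall z, modc z <= r -> derivable F z 1.

Let g z := (F z - F w) / (z - w).

(** Homotopy between the circle of radius [r], at [p.1 = 1], and its contraction towards [w] by the
    ratio [s0], at [p.1 = 0]. It avoids [w], where [g] is a quotient by zero. *)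
Let gam s0 (p : R * R) : Cx R :=
  w + cplx ((1 - p.1) * s0 + p.1) * (cplx r * expc p.2 - w).

Let modc_circle t : modc (cplx r * expc t) = r.
Proof. by rewrite modcM cplx_modc modc_expc mulr1 gtr0_norm. Qed.

Let gam_lipschitz s0 s t s' t' : 0 < s0 < 1 -> 0 <= s <= 1 -> 0 <= s' <= 1 ->
  modc (gam s0 (s, t) - gam s0 (s', t')) <=
  ((1 - s) * s0 + s) * (r * (4 * pi)) * `|t - t'| + `|s - s'| * (2 * r).
Proof.
move=> /andP[s00 s01] /andP[sge sle] /andP[s'ge s'le]; rewrite /gam /=.
set c := (1 - s) * s0 + s; set c' := (1 - s') * s0 + s'.
have -> : w + cplx c * (cplx r * expc t - w) - (w + cplx c' * (cplx r * expc t' - w))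
  = cplx c * cplx r * (expc t - expc t') + cplx (c - c') * (cplx r * expc t' - w).
  by rewrite rmorphB; ring.
apply: le_trans (modcD _ _) _; apply: lerD.
  have c0 : 0 <= c by rewrite /c addr_ge0// mulr_ge0 ?(ltW s00)// subr_ge0.
  rewrite !modcM !cplx_modc (gtr0_norm r0) ger0_norm// -!mulrA; apply: ler_wpM2l => //.
  by rewrite ler_wpM2l ?(ltW r0)// mulrA expc_lipschitz.
rewrite modcM cplx_modc ler_pM ?normr_ge0 ?modc_ge0//.
  have -> : c - c' = (1 - s0) * (s - s') by rewrite /c /c'; ring.
  by rewrite normrM ler_piMl// ger0_norm; lra.
by apply: le_trans (modcBD _ _) _; rewrite modc_circle; have := wr; set x := modc w; lra.
Qed.

Let gam_shift s0 p : 0 < s0 < 1 -> 0 <= p.1 <= 1 ->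
  [/\ modc (gam s0 p) <= r, gam s0 p != w &
    modc (gam s0 p - w) <= ((1 - p.1) * s0 + p.1) * (2 * r)].
Proof.
move=> /andP[s00 s01] /andP[p0 p1].
have c0 : 0 < (1 - p.1) * s0 + p.1.
  have : 0 <= p.1 * (1 - s0) by rewrite mulr_ge0//; lra.
  lra.
have c1 : (1 - p.1) * s0 + p.1 <= 1.
  have : 0 <= (1 - p.1) * (1 - s0) by rewrite mulr_ge0//; lra.
  lra.
rewrite /gam; move: c0 c1; set c := (1 - p.1) * s0 + p.1 => c0 c1; split.
- have -> : w + cplx c * (cplx r * expc p.2 - w) =
     cplx (1 - c) * w + cplx c * (cplx r * expc p.2).
    by rewrite rmorphB rmorph1; ring.
  apply: le_trans (modcD _ _) _; rewrite modcM [X in _ + X]modcM modc_circle !cplx_modc.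
  rewrite !ger0_norm ?subr_ge0 ?(ltW c0)//.
  have := ler_wpM2l (_ : 0 <= 1 - c) (ltW wr); rewrite subr_ge0 => /(_ c1); lra.
- rewrite -subr_eq0 addrAC subrr add0r mulf_neq0//.
    by rewrite -modc_gt0 cplx_modc normr_gt0 gt_eqF.
  rewrite subr_eq0; apply: contraTneq wr => <-.
  by rewrite modc_circle ltxx.
- rewrite addrAC subrr add0r modcM cplx_modc gtr0_norm// ler_wpM2l ?(ltW c0)//.
  apply: le_trans (modcBD _ _) _; rewrite modc_circle.
  by have := wr; set x := modc w; lra.
Qed.

Let g_derivable z : modc z <= r -> z != w -> derivable g z 1.
Proof.
move=> zr zw; apply: derivableM.
  by apply: derivableB; [exact: Fd|exact: derivable_cst].
apply: derivableV; first by rewrite subr_eq0.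
by apply: derivableB; [exact: derivable_id|exact: derivable_cst].
Qed.

(** Goursat between the two circles: the radial edges cancel by periodicity of [expc], and the inner
    circle contributes little because it is short and [g] is bounded near [w]. *)
Let outer_cvg0 : cmean k r (fun z => z * g z) @[k --> \oo] --> (0 : Cx R).
Proof.
have [D HD] := (derivableCxP _ _).1 (Fd (ltW wr)).
have [d d0 {}HD] := HD 1 ltr01.
pose M := modc D + 1.
have M0 : 0 < M by rewrite /M; have := modc_ge0 D; lra.
have gM z : modc (z - w) < d -> z != w -> modc (g z) <= M.
  move=> zd zw; rewrite /g modcM modcV ler_pdivrMr ?modc_gt0 ?subr_eq0//.
  have -> : F z - F w = (F z - F w - D * (z - w)) + D * (z - w) by rewrite subrK.
  by apply: le_trans (modcD _ _) _; have := HD _ zd; rewrite modcM /M; lra.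
apply/cvgCxP => e e0.
have pi0 : 0 < pi :> R by exact: pi_gt0.
(* The three bounds keep [s0] below [1], the inner circle in the disc where [g] is bounded by [M],
   and its contribution at most [e]. *)
pose s0 := Num.min (1 / 2) (Num.min (d / (4 * r)) (e / (M * (r * (4 * pi))))).
have K0 : 0 < M * (r * (4 * pi)) by rewrite !mulr_gt0.
have s00 : 0 < s0 by rewrite !lt_min !divr_gt0 ?mulr_gt0.
have s01 : s0 < 1 by rewrite gt_min; apply/orP; left; lra.
have s0d : s0 * (2 * r) < d.
  have : s0 <= d / (4 * r) by rewrite !ge_min lexx orbT.
  rewrite ler_pdivlMr ?mulr_gt0//; have := mulr_gt0 s00 r0; nra.
have s0e : M * (s0 * (r * (4 * pi))) <= e.
  have : s0 <= e / (M * (r * (4 * pi))) by rewrite !ge_min lexx !orbT.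
  by rewrite ler_pdivlMr//; nra.
have s0b : 0 < s0 < 1 by rewrite s00.
have in01 p : in_square (0, 0) 1 p -> 0 <= p.1 <= 1.
  by move=> [/= + _]; rewrite add0r.
have [||n _ Hn] := (cvgCxP _ _ _).1 (@goursat _ g (gam s0) (r * (4 * pi) + 2 * r) _ _) e e0.
- move=> [s t] [s' t'] /in01 /= i1 /in01 /= i2.
  apply: le_trans (gam_lipschitz _ _ s0b i1 i2) _.
  have : 0 < r * (4 * pi) by rewrite !mulr_gt0.
  set P := r * (4 * pi) => P0.
  have c1 : (1 - s) * s0 + s <= 1.
    have : 0 <= (1 - s) * (1 - s0) by rewrite mulr_ge0//; lra.
    lra.
  have : ((1 - s) * s0 + s) * (P * `|t - t'|) <= P * `|t - t'|.
    by rewrite ler_piMl// mulr_ge0// ltW.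
  have : 0 <= P * `|s - s'| by rewrite mulr_ge0// ltW.
  have : 0 <= r * `|t - t'| by rewrite mulr_ge0// ltW.
  lra.
- by move=> p /in01 /(gam_shift s0b)[? ? _]; exact: g_derivable.
(* Two more halvings, because [circle_factor_ge] starts at the fourth roots of unity. *)
exists n.+2 => // -[//|[//|k]] nk; rewrite subr0.
have nk' : (n <= k.+2)%N by apply: leq_trans nk; rewrite -addn2 leq_addr.
have := circle_factor_ge (R := R) k.
move: nk' {nk}; move: (k.+2) => {}k /Hn + factor4.
rewrite subr0 /square_sum /= !add0r.
have shift1 q : gam s0 (q.1 + 0, q.2 + 1) = gam s0 q.
  by rewrite /gam /= addr0 expcD expc1 mulr1.
have := @trapezoid_translate _ g (gam s0) k (0, 1) (1, 0) (0, 0) shift1.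
rewrite /= !addr0 !add0r => ->; rewrite (trapezoidC _ _ _ (0, 0) (1, 0)).
rewrite (@trapezoid_circle _ _ _ _ r); last first.
  move=> t; rewrite /gam /= subrr mul0r add0r rmorph1; ring.
have := @modc_trapezoid _ g (gam s0) k [set p | p.1 = 0] (s0 * (r * (4 * pi))) M (0, 1) (0, 0).
have /[swap]/[apply] : forall p q : R * R, p.1 = 0 -> q.1 = 0 -> (midp p q).1 = 0.
  by move=> p q /= -> ->; rewrite addr0 mul0r.
have /[swap]/[apply] : forall p q : R * R, p.1 = 0 -> q.1 = 0 ->
    modc (gam s0 p - gam s0 q) <= s0 * (r * (4 * pi)) * (`|p.1 - q.1| + `|p.2 - q.2|).
  move=> [s t] [s' t'] /= -> ->; apply: le_trans (gam_lipschitz _ _ s0b _ _) _; rewrite ?lexx ?ler01//.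
  by rewrite !subrr normr0 mul0r addr0 add0r subr0 mul1r addr0.
have /[swap]/[apply] : forall p : R * R, p.1 = 0 -> modc (g (gam s0 p)) <= M.
  move=> p p0; have [|_ pw pd] := @gam_shift s0 p s0b; first by rewrite p0 lexx ler01.
  apply: gM => //; apply: le_lt_trans pd _.
  by rewrite p0 subr0 mul1r addr0.
move=> /(_ erefl erefl); rewrite /= subrr normr0 sub0r normrN normr1 add0r mulr1.
set T' := trapezoid _ _ _ (0, 1) _; set T := trapezoid _ _ _ (0, 0) _.
set C := cmean _ _ _; set c := _ * _ / 2 in factor4 * => T'e.
have -> : T + c * C - T + T' = c * C + T' by ring.
move=> /(le_lt_trans (modcD_ge _ _)); rewrite modcM => h.
have : 4 * modc C <= modc c * modc C by rewrite ler_wpM2r ?modc_ge0.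
lra.
Qed.

(** Write [F z = F w + (z - w) * g z]: the mean of [z * g z] tends to [0] and that of the kernel to
    [1]. *)
Lemma cauchy_mean : cmean k r (fun z => F z * (z / (z - w))) @[k --> \oo] --> F w.
Proof.
have E k : cmean k r (fun z => F z * (z / (z - w))) =
    cmean k r (fun z => z * g z) + F w * (1 - (w / cplx r) ^+ (2 ^ k))^-1.
  rewrite -cmean_kernel// -cmeanZ -cmeanD; apply: eq_cmean => [|z zr]; first exact: ltW.
  by rewrite /g; ring.
under eq_fun do rewrite E.
suff : (fun k => cmean k r (fun z => z * g z) + F w * (1 - (w / cplx r) ^+ (2 ^ k))^-1)
    @ \oo --> 0 + F w * (1 - 0)^-1.
  by rewrite subr0 invr1 mulr1 add0r.
apply: cvgD; first exact: outer_cvg0.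
apply: cvgMr; apply: cvgV; first by rewrite subr0 oner_neq0.
apply: cvgB; first exact: cvg_cst.
apply: cvg_modc_expr; rewrite modcf cplx_modc gtr0_norm// ltr_pdivrMr// mul1r//.
Qed.

End AtPoint.
End CauchyMean.

(** * Ultrafilter limits and power series *)

Section UltraLimits.
Context {R : realType} {T : Type}.

(** If [P] is not in [F], then [F] restricted to the complement of [P] is proper, and an ultrafilter
    finer than it contains [F] but not [P]. *)
Lemma ultra_filter_le (F : set_system T) (P : set T) : ProperFilter F ->
  (forall U, UltraFilter U -> F `<=` U -> U P) -> F P.
Proof.
move=> FF H; apply: contrapT => NP.
have PF : ProperFilter (within (~` P) F).
  apply: Build_ProperFilter_ex => A FA; apply: contrapT => NA; apply: NP.
  rewrite /within /= in FA; move: FA; apply: filterS => x PA; apply: contrapT => /PA Ax.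
  by apply: NA; exists x.
have [U [UU sU]] := ultraFilterLemma PF.
have UP : U P by apply: H => // A FA; apply: sU; rewrite /within /=; move: FA; apply: filterS.
have UN : U (~` P) by apply: sU; apply: nearW.
by have [x []] := filter_ex (filterI UP UN).
Qed.

Variable U : set_system T.
Hypothesis UU : UltraFilter U.

(** The limit is the supremum of the [x] with [x <= a t] along [U]; for any [x] above it, the
    ultrafilter contains the opposite inequality. *)
Lemma real_ultra_cvg (a : T -> R) K : (\forall t \near U, `|a t| <= K) ->
  exists l, forall e, 0 < e -> \forall t \near U, `|a t - l| < e.
Proof.
move=> aK; pose S := [set x : R | U [set t | x <= a t]].
have Sub : ubound S K.
  move=> x Sx; have [t [/= + xa]] := filter_ex (filterI aK Sx).
  by rewrite ler_norml => /andP[_]; exact: le_trans.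
have S0 : S (- K).
  by move: aK; apply: filterS => t /=; rewrite ler_norml => /andP[].
exists (sup S) => e e0.
have [x Sx xl] := sup_adherent e0 (conj (ex_intro _ _ S0) (ex_intro _ _ Sub)).
have NS : ~ S (sup S + e / 2).
  move=> /(ub_le_sup (ex_intro _ _ Sub)); lra.
have [//|CS] := in_ultra_setVsetC [set t | sup S + e / 2 <= a t] UU.
move: CS Sx; apply: filterS2 => t /= /negP; rewrite -ltNge => h1 h2.
by rewrite ltr_norml; apply/andP; split; lra.
Qed.

Lemma ultra_cvg (u : T -> Cx R) K : (\forall t \near U, modc (u t) <= K) ->
  exists l : Cx R, u @ U --> l.
Proof.
move=> uK.
have [|a aP] := @real_ultra_cvg (fun t => complex.Re (u t)) K.
  by move: uK; apply: filterS => t; apply: le_trans (Re_le_modc _).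
have [|b bP] := @real_ultra_cvg (fun t => complex.Im (u t)) K.
  by move: uK; apply: filterS => t; apply: le_trans (Im_le_modc _).
exists (a +i* b)%C; apply/cvgCxP => e e0.
have e2 : 0 < e / 2 by lra.
move: (aP _ e2) (bP _ e2); apply: filterS2 => t ha hb.
apply: le_lt_trans (modc_le_ReIm _) _.
by case: (u t) ha hb => x y /=; lra.
Qed.

End UltraLimits.

Lemma cvg_bigsumCx (R : realType) T (F : set_system T) (FF : Filter F) I (s : seq I)
    (u : I -> T -> Cx R) (l : I -> Cx R) : (forall i, u i @ F --> l i) ->
  (fun t => \sum_(i <- s) u i t) @ F --> \sum_(i <- s) l i.
Proof.
move=> ul; elim: s => [|i s IH].
  by under eq_fun do rewrite big_nil; rewrite big_nil; exact: cvg_cst.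
under eq_fun do rewrite big_cons; rewrite big_cons; exact: cvgD (ul i) IH.
Qed.

Section LimitBounds.
Context {R : realType} {T : Type} {F : set_system T} {FF : ProperFilter F}.

Lemma cvg_modc_le (u : T -> Cx R) (l : Cx R) (k : T -> R) (K : R) :
  u @ F --> l -> k @ F --> K -> (\forall t \near F, modc (u t) <= k t) -> modc l <= K.
Proof.
move=> /cvgCxP ul /cvgrPdist_lt kK uk; rewrite leNgt; apply/negP => lK.
have e0 : 0 < (modc l - K) / 2 by lra.
have [t [[/= h1 h2] h3]] := filter_ex (filterI (filterI (ul _ e0) (kK _ e0)) uk).
have := modcDB l (u t); rewrite modcB in h1.
by move: h2; rewrite ltr_norml => /andP[? ?]; lra.
Qed.

Lemma cvg_modc_le_cst (u : T -> Cx R) (l : Cx R) (K : R) :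
  u @ F --> l -> (\forall t \near F, modc (u t) <= K) -> modc l <= K.
Proof. by move=> ul; apply: cvg_modc_le ul _; exact: cvg_cst. Qed.

Lemma cvg_Re_ge0 (u : T -> Cx R) (l : Cx R) :
  u @ F --> l -> (forall t, 0 <= complex.Re (u t)) -> 0 <= complex.Re l.
Proof.
move=> /cvgCxP ul u0; rewrite leNgt; apply/negP => l0.
have e0 : 0 < - complex.Re l by lra.
have [t /= ht] := filter_ex (ul _ e0).
have := le_lt_trans (Re_le_modc _) ht; rewrite ltr_norml => /andP[_].
by have := u0 t; case: (u t) => x y; case: (l) => x' y' /=; lra.
Qed.

Lemma cvg_expn (K : numFieldType) (u : T -> K) (l : K) n :
  u @ F --> l -> (fun t => u t ^+ n) @ F --> l ^+ n.
Proof.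
move=> ul; elim: n => [|n IH]; first exact: cvg_cst.
under eq_fun do rewrite exprS; rewrite exprS; exact: cvgM ul IH.
Qed.

End LimitBounds.

Section PowerSeries.
Context {R : realType}.
Implicit Types (a b : nat -> Cx R) (F G : Cx R -> Cx R) (K M : R) (z w : Cx R).

(* Convergence of the power series is encoded by the geometric bound on its
   remainders. *)
Definition power_series a K F :=
  (forall m, modc (a m) <= K) /\
  (forall z n, modc z < 1 ->
    modc (F z - \sum_(m < n) a m * z ^+ m) <= K * modc z ^+ n / (1 - modc z)).

Lemma power_series_weaken a K K' F : K <= K' -> power_series a K F ->
  power_series a K' F.
Proof.
move=> KK [aK aF]; split=> [m|z k z1]; first exact: le_trans (aK m) KK.
apply: le_trans (aF z k z1) _; rewrite ler_wpM2r ?invr_ge0 ?subr_ge0 ?(ltW z1)//.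
by rewrite ler_wpM2r// exprn_ge0// modc_ge0.
Qed.

Lemma power_series_bound a K F z : power_series a K F -> modc z < 1 ->
  modc (F z) <= K / (1 - modc z).
Proof.
by move=> [_ /(_ z 0%N) H] /H; rewrite big_ord0 subr0 expr0 mulr1.
Qed.

Lemma power_series_ge0 a K F : power_series a K F -> 0 <= K.
Proof. by move=> [/(_ 0%N) H _]; apply: le_trans H; exact: modc_ge0. Qed.

Lemma modc_geometric_sum a K z n : (forall m, modc (a m) <= K) -> modc z < 1 ->
  modc (\sum_(m < n) a m * z ^+ m) <= K / (1 - modc z).
Proof.
move=> aK z1; have K0 : 0 <= K by apply: le_trans (aK 0%N); exact: modc_ge0.
have D0 : 0 < 1 - modc z by rewrite subr_gt0.
apply: (@le_trans _ _ (K * \sum_(m < n) modc z ^+ m)).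
  apply: le_trans (modc_sum _ _ _) _; rewrite mulr_sumr; apply: ler_sum => m _.
  by rewrite modcM modcX ler_wpM2r ?exprn_ge0 ?modc_ge0.
rewrite ler_wpM2l// -[leRHS]mul1r ler_pdivlMr//.
have := subrX1 (modc z) n; have := exprn_ge0 n (modc_ge0 z).
set x := modc z ^+ n; set y := \sum_(_ < _) _; lra.
Qed.

Lemma power_series_cvg a K F z : power_series a K F -> modc z < 1 ->
  (fun n => \sum_(m < n) a m * z ^+ m) @ \oo --> F z.
Proof.
move=> aF z1; have [_ H] := aF; apply/cvgCxP => e e0.
have D0 : 0 < 1 - modc z by rewrite subr_gt0.
have K1 : 0 < K + 1 by have := power_series_ge0 aF; lra.
have e1 : 0 < e * (1 - modc z) / (K + 1) by rewrite divr_gt0// mulr_gt0.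
have : modc z ^+ n @[n --> \oo] --> 0.
  by apply: cvg_expr; rewrite ger0_norm ?modc_ge0.
move=> /cvgr0_norm_lt /(_ _ e1) [n _ Hn]; exists n => // m /= /Hn /=.
rewrite ger0_norm ?exprn_ge0 ?modc_ge0// ltr_pdivlMr// => lt1.
rewrite modcB; apply: le_lt_trans (H z m z1) _.
rewrite ltr_pdivrMr//; apply: le_lt_trans lt1.
by rewrite mulrC ler_wpM2l ?exprn_ge0 ?modc_ge0//; lra.
Qed.

Lemma power_series_exists a K : (forall m, modc (a m) <= K) -> exists F, power_series a K F.
Proof.
move=> aK; have [U [UU sU]] := ultraFilterLemma eventually_filter.
have bnd z n N : modc z < 1 ->
    modc (\sum_(m < n + N) a m * z ^+ m - \sum_(m < n) a m * z ^+ m)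
    <= K * modc z ^+ n / (1 - modc z).
  move=> z1; rewrite big_split_ord /= addrAC subrr add0r.
  rewrite (eq_bigr (fun i : 'I_N => z ^+ n * (a (n + i)%N * z ^+ i))); last first.
    by move=> i _; rewrite exprD mulrCA.
  rewrite -mulr_sumr modcM modcX [K * _]mulrC -mulrA ler_wpM2l ?exprn_ge0 ?modc_ge0//.
  exact: (@modc_geometric_sum (fun m => a (n + m)%N)).
have /choice[F HF] : forall z, exists l : Cx R, modc z < 1 ->
    (fun n => \sum_(m < n) a m * z ^+ m) @ U --> l.
  move=> z; have [z1|] := boolP (modc z < 1); last by exists 0.
  have [|l ul] := @ultra_cvg _ _ U UU (fun n => \sum_(m < n) a m * z ^+ m) (K / (1 - modc z)).
    by apply: nearW => n; exact: modc_geometric_sum.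
  by exists l.
exists F; split => // z n z1.
apply: (@cvg_modc_le_cst _ _ U _
  (fun N => \sum_(m < N) a m * z ^+ m - \sum_(m < n) a m * z ^+ m)).
  by apply: cvgB; [exact: HF|exact: cvg_cst].
apply: sU; exists n => // N /= nN.
by rewrite -(subnKC nN); exact: bnd.
Qed.

Lemma power_series_limit T (U : set_system T) (a : T -> nat -> Cx R) (K : R)
    (F : T -> Cx R -> Cx R) :
  UltraFilter U -> (\forall t \near U, power_series (a t) K (F t)) ->
  exists b G, power_series b K G /\
    forall z, modc z < 1 -> (fun t => F t z) @ U --> G z.
Proof.
move=> UU HF.
have /choice[b bP] : forall m, exists l : Cx R, (fun t => a t m) @ U --> l.
  by move=> m; apply: (@ultra_cvg _ _ U UU _ K); move: HF; apply: filterS => t [].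
have /choice[G GP] : forall z, exists l : Cx R, modc z < 1 -> (fun t => F t z) @ U --> l.
  move=> z; have [z1|] := boolP (modc z < 1); last by exists 0.
  have [|l ul] := @ultra_cvg _ _ U UU (F ^~ z) (K / (1 - modc z)); last by exists l.
  by move: HF; apply: filterS => t /power_series_bound; exact.
exists b, G; split => //; split => [m|z n z1].
  by apply: (@cvg_modc_le_cst _ _ U _ _ _ _ (bP m)); move: HF; apply: filterS => t [].
apply: (@cvg_modc_le_cst _ _ U _ (fun t => F t z - \sum_(m < n) a t m * z ^+ m)).
  apply: cvgB; first exact: GP.
  apply: (@cvg_bigsumCx _ _ _ _ _ _ (fun (m : 'I_n) t => a t m * z ^+ m)
    (fun m => b m * z ^+ m)) => m.
  by apply: cvgM; [exact: bP|exact: cvg_cst].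
by move: HF; apply: filterS => t [_]; exact.
Qed.

(** Synthetic division: the [k]-th coefficient of the quotient is the shifted series
    [a k.+1 + a k.+2 * w + ...], hence the bound. The explicit constant keeps repeated divisions
    uniform over families. *)
Lemma power_series_divide a K F w : power_series a K F -> modc w < 1 ->
  exists b G, power_series b (K / (1 - modc w)) G /\
    forall z, modc z < 1 -> F z = F w + (z - w) * G z.
Proof.
move=> aF w1; have [aK _] := aF.
have D0 : 0 < 1 - modc w by rewrite subr_gt0.
have /choice[S SP] : forall k, exists S, power_series (fun m => a (k + m)%N) K S.
  by move=> k; exact: power_series_exists.
pose b k := S k.+1 w.
have bK m : modc (b m) <= K / (1 - modc w) by exact: power_series_bound (SP _) w1.
have [G GP] := power_series_exists bK.
have uniq (u : nat -> Cx R) (l l' : Cx R) : u @ \oo --> l -> u @ \oo --> l' -> l = l'.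
  move=> ul ul'; apply/eqP; rewrite -subr_eq0 -modc_eq0 eq_le modc_ge0 andbT.
  apply: (@cvg_modc_le_cst R nat \oo _ (fun n => u n - u n) (l - l') 0).
    exact: cvgB ul ul'.
  by apply: nearW => n; rewrite subrr modc0.
have Srec k : S k w = a k + w * S k.+1 w.
  apply: uniq (power_series_cvg (SP k) w1) _; rewrite -cvg_shiftS /=.
  have -> : (fun n => \sum_(i < n.+1) a (k + i)%N * w ^+ i) =
      (fun n => a k + w * \sum_(i < n) a (k.+1 + i)%N * w ^+ i).
    apply/funext => n; rewrite big_ord_recl expr0 mulr1 addn0 mulr_sumr; congr (_ + _).
    by apply: eq_bigr => i _; rewrite /= /bump /= add1n exprS addnS addSn mulrCA.
  exact: (cvgD (cvg_cst (a k)) (cvgM (cvg_cst w) (power_series_cvg (SP k.+1) w1))).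
have S0 : S 0%N w = F w.
  apply: uniq (power_series_cvg (SP 0%N) w1) _.
  exact: power_series_cvg aF w1.
exists b, G; split => // z z1.
(* The recurrence [Srec] makes the product telescope; the boundary term tends to [0] because the
   [S n w] are uniformly bounded. *)
have bS n : (z - w) * \sum_(m < n) b m * z ^+ m =
    \sum_(m < n) a m * z ^+ m - F w + S n w * z ^+ n.
  elim: n => [|n IH].
    by rewrite !big_ord0 mulr0 expr0 mulr1 S0 sub0r addNr.
  by rewrite !big_ord_recr /= mulrDr IH (Srec n) /b exprS; ring.
have Sz : (fun n => S n w * z ^+ n) @ \oo --> (0 : Cx R).
  apply/cvgCxP => e e0.
  have C0 : 0 < K / (1 - modc w) + 1.
    by apply: ltr_wpDl => //; rewrite divr_ge0 ?(ltW D0)// (power_series_ge0 aF).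
  have : modc z ^+ n @[n --> \oo] --> 0.
    by apply: cvg_expr; rewrite ger0_norm ?modc_ge0.
  move=> /cvgr0_norm_lt /(_ _ (divr_gt0 e0 C0)) [n _ Hn]; exists n => // m /= /Hn /=.
  rewrite ger0_norm ?exprn_ge0 ?modc_ge0// ltr_pdivlMr// => lt1.
  rewrite subr0 modcM modcX; apply: le_lt_trans lt1.
  rewrite mulrC ler_wpM2l ?exprn_ge0 ?modc_ge0//.
  by apply: le_trans (power_series_bound (SP m) w1) _; lra.
suff -> : (z - w) * G z = F z - F w by rewrite addrC subrK.
apply: (uniq (fun n => (z - w) * \sum_(m < n) b m * z ^+ m)).
  by apply: cvgM; [exact: cvg_cst|exact: power_series_cvg GP z1].
under eq_fun do rewrite bS.
have h := cvgD (cvgB (power_series_cvg aF z1) (cvg_cst (F w))) Sz.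
by rewrite addr0 in h; exact: h.
Qed.

(** Dividing twice by [x - z] gives [F x = F z + (x - z) * (G z + (x - z) * H x)] with [H] bounded
    near [z]. *)
Lemma power_series_derivable a K F z : power_series a K F -> modc z < 1 -> derivable F z 1.
Proof.
move=> aF z1; have [b [G [bG FG]]] := power_series_divide aF z1.
have [c [H [cH GH]]] := power_series_divide bG z1.
apply/derivableCxP; exists (G z) => e e0.
set K' := K / (1 - modc z) / (1 - modc z) in cH.
have K'0 : 0 <= K' by exact: power_series_ge0 cH.
have D0 : 0 < 1 - modc z by lra.
pose C := K' / ((1 - modc z) / 2).
have C0 : 0 <= C by rewrite divr_ge0//; lra.
exists (Num.min ((1 - modc z) / 2) (e / (C + 1))).
  by rewrite lt_min !divr_gt0//; lra.
move=> x; rewrite lt_min => /andP[xz1 xz2].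
have x1 : modc x < (1 + modc z) / 2 by have := modcDB x z; lra.
have x1' : modc x < 1 by lra.
rewrite (FG x x1') (GH x x1').
have -> : F z + (x - z) * (G z + (x - z) * H x) - F z - G z * (x - z) =
  (x - z) * H x * (x - z) by ring.
rewrite !modcM ler_wpM2r ?modc_ge0//.
apply: (@le_trans _ _ (e / (C + 1) * C)).
  apply: ler_pM; rewrite ?modc_ge0// ?(ltW xz2)//.
  apply: le_trans (power_series_bound cH x1') _.
  by rewrite ler_wpM2l// lef_pV2 ?posrE; lra.
by rewrite mulrAC ler_pdivrMr ?ler_pM2l//; lra.
Qed.

Lemma power_series_continuous a K F z : power_series a K F -> modc z < 1 ->
  F x @[x --> z] --> F z.
Proof.
move=> aF z1; apply/differentiable_continuous/derivable1_diffP.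
exact: power_series_derivable aF z1.
Qed.

End PowerSeries.

(** * Power series expansion and Harnack's inequality *)

Section Expansion.
Context {R : realType}.
Implicit Types (F G g : Cx R -> Cx R) (M r : R) (z w : Cx R).

Lemma cmean_sum k r n (u : nat -> Cx R -> Cx R) :
  cmean k r (fun z => \sum_(m < n) u m z) = \sum_(m < n) cmean k r (u m).
Proof. by rewrite /cmean exchange_big mulr_suml. Qed.

(** The kernel [z / (z - w)] of Cauchy's formula is a finite geometric sum plus
    [(w / z) ^+ n * (z / (z - w))]. The coefficients are ultrafilter limits of means of
    [F z / z ^+ m]. *)
Lemma power_series_expand_lt F M r : (forall z, modc z < 1 -> derivable F z 1) ->
  (forall z, modc z < 1 -> modc (F z) <= M) -> 0 < r < 1 ->
  exists a : nat -> Cx R, (forall m, modc (a m) <= M / r ^+ m) /\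
    (forall w n, modc w < r ->
      modc (F w - \sum_(m < n) a m * w ^+ m) <= M * (modc w / r) ^+ n / (1 - modc w / r)).
Proof.
move=> Fd FM /andP[r0 r1].
have [U [UU sU]] := ultraFilterLemma eventually_filter.
pose a' m k := cmean k r (fun z => F z / z ^+ m).
have aM m k : modc (a' m k) <= M / r ^+ m.
  apply: modc_cmean => [|z zr]; first exact: ltW.
  by rewrite modcf modcX zr ler_wpM2r ?invr_ge0 ?exprn_ge0 ?(ltW r0)// FM// zr.
have /choice[a aP] : forall m, exists l : Cx R, a' m @ U --> l.
  by move=> m; apply: (@ultra_cvg _ _ U UU _ (M / r ^+ m)); apply: nearW.
exists a; split => [m|w n wr].
  by apply: (@cvg_modc_le_cst _ _ U _ _ _ _ (aP m)); apply: nearW.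
have Fw : cmean k r (fun z => F z * (z / (z - w))) @[k --> U] --> F w.
  apply: cvg_trans (@cauchy_mean _ F r w r0 wr _); first by apply: cvg_app.
  by move=> z zr; apply: Fd; exact: le_lt_trans zr r1.
have Sw : (fun k => \sum_(m < n) a' m k * w ^+ m) @ U --> \sum_(m < n) a m * w ^+ m.
  apply: (@cvg_bigsumCx _ _ U _ _ _ (fun (m : 'I_n) k => a' m k * w ^+ m)
    (fun m => a m * w ^+ m)) => m.
  exact: cvgM (aP m) (cvg_cst _).
apply: (@cvg_modc_le_cst _ _ U _ (fun k => cmean k r (fun z => F z * (z / (z - w)))
  - \sum_(m < n) a' m k * w ^+ m) _ _ (cvgB Fw Sw)); apply: nearW => k.
rewrite (eq_bigr (fun m : 'I_n => cmean k r (fun z => w ^+ m * (F z / z ^+ m)))); last first.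
  by move=> m _; rewrite cmeanZ mulrC.
rewrite -(cmean_sum _ _ _ (fun m z => w ^+ m * (F z / z ^+ m)))
  -[X in _ - X]mul1r -mulNr -cmeanZ -cmeanD.
apply: modc_cmean => [|z zr]; first exact: ltW.
have zw : z - w != 0.
  by rewrite subr_eq0; apply: contraTneq wr => <-; rewrite zr ltxx.
have z0 : z != 0 by rewrite -modc_gt0 zr.
have -> : F z * (z / (z - w)) + -1 * \sum_(m < n) w ^+ m * (F z / z ^+ m) =
    F z * (w / z) ^+ n * (z / (z - w)).
  have -> : \sum_(m < n) w ^+ m * (F z / z ^+ m) = F z * \sum_(m < n) (w / z) ^+ m.
    by rewrite mulr_sumr; apply: eq_bigr => m _; rewrite expr_div_n mulrCA.
  have w1z : w / z - 1 != 0.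
    by rewrite -[X in _ - X](divff z0) -mulrBl mulf_neq0 ?invr_eq0// -opprB oppr_eq0.
  have -> : \sum_(m < n) (w / z) ^+ m = ((w / z) ^+ n - 1) / (w / z - 1).
    by rewrite subrX1 mulrAC divff// mul1r.
  have -> : w / z - 1 = - (z - w) / z by field.
  by field; rewrite zw z0.
rewrite !modcM modcX modcV modcM modcV zr.
have zwr : r - modc w <= modc (z - w) by rewrite -zr; exact: modcDB.
have rw0 : 0 < r - modc w by rewrite subr_gt0.
have -> : M * (modc w / r) ^+ n / (1 - modc w / r) =
    M * (modc w / r) ^+ n * (r / (r - modc w)) by field; rewrite !gt_eqF.
have q0 : 0 <= (modc w / r) ^+ n by rewrite exprn_ge0// divr_ge0 ?modc_ge0// ltW.
apply: ler_pM.
- by rewrite mulr_ge0 ?modc_ge0.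
- by rewrite mulr_ge0 ?invr_ge0 ?modc_ge0// ltW.
- by rewrite ler_wpM2r// FM// zr.
- rewrite ler_wpM2l ?(ltW r0)// lef_pV2 ?posrE//; exact: lt_le_trans zwr.
Qed.

(** The radius tends to [1] in the preceding bounds. A second ultrafilter limit, over the radii,
    avoids showing that the coefficients do not depend on the radius. *)
Lemma power_series_expand F M : (forall z, modc z < 1 -> derivable F z 1) ->
  (forall z, modc z < 1 -> modc (F z) <= M) -> exists a, power_series a M F.
Proof.
move=> Fd FM.
(* Radii at least [1 / 2] bound the [m]-th coefficients by [M * 2 ^+ m] for all [j]. *)
pose r j : R := 1 - 2^-1 ^+ j.+1.
have h0 j : 0 < (2^-1 : R) ^+ j by rewrite exprn_gt0// invr_gt0.
have h1 j : (2^-1 : R) ^+ j <= 1 by rewrite exprn_ile1// ?invr_ge0//; lra.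
have rj j : 0 < r j < 1.
  by rewrite /r exprS; have := h0 j; have := h1 j; lra.
have rj2 j : 2^-1 <= r j by rewrite /r exprS; have := h1 j; lra.
have /choice[a aP] j := power_series_expand_lt Fd FM (rj j).
have M0 : 0 <= M by apply: le_trans (FM 0 _); rewrite ?modc_ge0// modc0.
have [U [UU sU]] := ultraFilterLemma eventually_filter.
have rU : r j @[j --> U] --> (1 : R).
  apply: (@cvg_trans _ (r j @[j --> \oo])); first exact: cvg_app.
  have h : (2^-1 : R) ^+ j.+1 @[j --> \oo] --> 0.
    by rewrite (cvg_shiftS (fun j => (2^-1 : R) ^+ j)); apply: cvg_expr; rewrite ger0_norm; lra.
  have : (fun j => 1 - 2^-1 ^+ j.+1) @ \oo --> (1 - 0 : R).
    by apply: cvgB h; exact: cvg_cst.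
  by rewrite subr0.
have /choice[b bP] : forall m, exists l : Cx R, a j m @[j --> U] --> l.
  move=> m; apply: (@ultra_cvg _ _ U UU _ (M * 2 ^+ m)); apply: nearW => j.
  apply: le_trans ((aP j).1 m) _; rewrite ler_wpM2l// -exprVn.
  have /andP[r0 _] := rj j.
  rewrite lerXn2r ?nnegrE ?invr_ge0 ?(ltW r0)//.
  by rewrite -[leRHS]invrK lef_pV2 ?posrE// invr_gt0.
have rX m : r j ^+ m @[j --> U] --> (1 : R).
  have : (fun j => r j ^+ m) @ U --> (1 ^+ m : R).
    exact: cvg_expn rU.
  by rewrite expr1n.
exists b; split => [m|z n z1].
  apply: (@cvg_modc_le _ _ U _ _ _ (fun j => M / r j ^+ m) _ (bP m)).
    have : (fun j => M / r j ^+ m) @ U --> M / 1.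
      by apply: cvgM; [exact: cvg_cst|apply: cvgV (rX m); exact: oner_neq0].
    by rewrite divr1.
  by apply: nearW => j; exact: (aP j).1.
apply: (@cvg_modc_le _ _ U _ (fun j => F z - \sum_(m < n) a j m * z ^+ m) _
   (fun j => M * (modc z / r j) ^+ n / (1 - modc z / r j))).
- apply: cvgB; first exact: cvg_cst.
  apply: (@cvg_bigsumCx _ _ U _ _ _ (fun (m : 'I_n) j => a j m * z ^+ m)
    (fun m => b m * z ^+ m)) => m.
  exact: cvgM (bP m) (cvg_cst _).
- have zr : modc z / r j @[j --> U] --> modc z / 1.
    by apply: cvgM; [exact: cvg_cst|apply: cvgV rU; exact: oner_neq0].
  rewrite divr1 in zr; apply: cvgM.
    apply: cvgM; first exact: cvg_cst.
    exact: cvg_expn zr.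
  apply: cvgV; first by rewrite subr_eq0 gt_eqF.
  by apply: cvgB zr; exact: cvg_cst.
- have : \forall j \near U, modc z < r j by exact: (cvgr_gt 1 rU).
  by apply: filterS => j; exact: (aP j).2.
Qed.

Lemma cmean_Re_ge0 k r F : 0 <= r -> (forall z, modc z = r -> 0 <= complex.Re (F z)) ->
  0 <= complex.Re (cmean k r F).
Proof.
move=> r0 F0; rewrite /cmean -(rmorph_nat (@cplx R)) -fmorphV mulrC.
set s := \sum_(_ < _) _.
have -> (c : R) : complex.Re (cplx c * s) = c * complex.Re s.
  by case: s => a b /=; rewrite mul0r subr0.
rewrite mulr_ge0 ?invr_ge0 ?ler0n// /s.
elim/big_ind: _ => // [[a b] [c d]|i _]; first exact: addr_ge0.
by apply: F0; rewrite modcM cplx_modc modc_expc mulr1 ger0_norm.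
Qed.

Lemma mul_conjc z : z * (z^*)%C = cplx (modc z ^+ 2).
Proof.
rewrite modc_sqr; case: z => a b; apply/eqP; rewrite eq_complex /=.
by apply/andP; split; apply/eqP; ring.
Qed.

(** On a circle of radius greater than [modc w], the second summand extends holomorphically to the
    disc and vanishes at [0]: added to Cauchy's kernel, it leaves the limit of the means unchanged
    and makes the kernel real. *)
Lemma poisson_kernel z w : z != 0 -> z != w ->
  z / (z - w) + (w^*)%C * z / (cplx (modc z ^+ 2) - (w^*)%C * z) =
  cplx ((modc z ^+ 2 - modc w ^+ 2) / modc (z - w) ^+ 2).
Proof.
move=> z0 zw; rewrite [cplx (_ / _)]rmorphM fmorphV rmorphB /= -!mul_conjc rmorphB.
have zw0 : z - w != 0 by rewrite subr_eq0.
have zcw0 : ((z^*)%C : Cx R) - (w^*)%C != 0.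
  by rewrite -rmorphB -modc_eq0; move: zw0; rewrite -modc_eq0;
    case: (z - w) => a b; rewrite /modc /= sqrrN.
field; apply/and3P; split=> //.
by rewrite [X in _ - X]mulrC -mulrBr mulf_neq0.
Qed.

(** The constant [C = (r + modc w) / (r - modc w)] dominates the Poisson kernel on the circle. The
    means of [g] against the difference have nonnegative real part and tend to [C * g 0 - g w]. *)
Lemma harnack g r w : (forall z, modc z < 1 -> derivable g z 1) ->
  (forall z, modc z < 1 -> 0 <= complex.Re (g z)) -> r < 1 -> modc w < r ->
  complex.Re (g w) <= (r + modc w) / (r - modc w) * complex.Re (g 0).
Proof.
move=> gd g0 r1 wr; have r0 : 0 < r by exact: le_lt_trans (modc_ge0 _) wr.
have gr z : modc z <= r -> derivable g z 1 by move=> zr; apply: gd; exact: le_lt_trans zr r1.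
have m0r : modc (0 : Cx R) < r by rewrite modc0.
pose wc : Cx R := (w^*)%C.
have modwc : modc wc = modc w by rewrite /wc; case: (w) => x y; rewrite /modc /= sqrrN.
pose F z := g z * (wc * z / (cplx (r ^+ 2) - wc * z)).
have den0 z : modc z <= r -> cplx (r ^+ 2) - wc * z != 0.
  move=> zr; rewrite subr_eq0; apply: contraTneq wr => E.
  have : modc (wc * z) = r ^+ 2 by rewrite -E cplx_modc ger0_norm// exprn_ge0// ltW.
  rewrite modcM modwc => {}E; rewrite -leNgt -(ler_pM2r r0) -expr2 -E.
  by rewrite ler_wpM2l ?modc_ge0.
have Fd z : modc z <= r -> derivable F z 1.
  move=> zr; have wd : derivable (fun z => wc * z) z 1.
    by apply: derivable_mul; [exact: derivable_cst|exact: derivable_id].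
  apply: derivable_mul; first exact: gr.
  apply: (derivable_mul wd); apply: derivable_inv; first exact: den0.
  by apply: (derivable_sub _ wd); exact: derivable_cst.
have c1 := cauchy_mean r0 wr gr.
have c2 := cauchy_mean r0 m0r Fd.
have c3 := cauchy_mean r0 m0r gr.
pose C : R := (r + modc w) / (r - modc w).
have F0 : F 0 = 0 by rewrite /F mulr0 mul0r mulr0.
have cC : (fun k => cplx C * cmean k r (fun z => g z * (z / (z - 0)))
     - (cmean k r (fun z => g z * (z / (z - w))) + cmean k r (fun z => F z * (z / (z - 0)))))
     @ \oo --> cplx C * g 0 - (g w + F 0).
  by apply: cvgB; [apply: cvgM c3; exact: cvg_cst|exact: cvgD c1 c2].
rewrite F0 addr0 in cC.
have : 0 <= complex.Re (cplx C * g 0 - g w).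
  apply: cvg_Re_ge0 cC _.
  move=> k; rewrite -cmeanZ -cmeanD
  -[X in _ - X]mul1r -mulNr -cmeanZ -cmeanD.
  apply: cmean_Re_ge0 => [|z zr]; first exact: ltW.
  have z0 : z != 0 by rewrite -modc_gt0 zr.
  have zw : z != w by apply: contraTneq wr => <-; rewrite zr ltxx.
  have -> : cplx C * (g z * (z / (z - 0)))
      + -1 * (g z * (z / (z - w)) + F z * (z / (z - 0))) =
      g z * cplx (C - (modc z ^+ 2 - modc w ^+ 2) / modc (z - w) ^+ 2).
    rewrite [cplx (C - _)]rmorphB /= -poisson_kernel// /F -/wc zr subr0 divff// !mulr1.
    by rewrite !mulrA; ring.
  have -> (c : R) (x : Cx R) : complex.Re (x * cplx c) = complex.Re x * c.
    by case: x => a b /=; rewrite mulr0 subr0.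
  rewrite mulr_ge0 ?g0 ?zr// subr_ge0.
  have zwr : r - modc w <= modc (z - w) by rewrite -zr; exact: modcDB.
  have rw0 : 0 < r - modc w by rewrite subr_gt0.
  rewrite /C ler_pdivrMr ?exprn_gt0 ?modc_gt0 ?subr_eq0//.
  have -> : r ^+ 2 - modc w ^+ 2 = (r + modc w) / (r - modc w) * (r - modc w) ^+ 2.
    by field; rewrite gt_eqF.
  rewrite ler_wpM2l//.
    by rewrite divr_ge0 ?(ltW rw0)// addr_ge0 ?modc_ge0// ltW.
  by rewrite lerXn2r ?nnegrE ?modc_ge0 ?(ltW rw0).
rewrite /C; case: (g 0) => a b; case: (g w) => c d /=.
by rewrite mul0r subr0 subr_ge0.
Qed.

End Expansion.

(** * Bidiagonal form with chained blocks *)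

Section BidiagonalForm.
Context {F : closedFieldType} {n' : nat}.
Let n := n'.+1.
Variable B : 'M[F]_n.
Implicit Types (p q : {poly F}) (W U : 'M[F]_n).

Lemma horner_mxM_mx p q : horner_mx B (p * q) = horner_mx B p *m horner_mx B q.
Proof. by rewrite rmorphM. Qed.

Lemma stablemx_horner m (W : 'M[F]_(m, n)) p : stablemx W B -> stablemx W (horner_mx B p).
Proof.
move=> WB; elim/poly_ind: p => [|p c IH]; first by rewrite rmorph0 mulmx0 sub0mx.
rewrite rmorphD /= horner_mxM_mx horner_mx_X horner_mx_C mulmxDr addmx_sub//.
  by rewrite mulmxA (submx_trans (submxMr _ IH)).
by rewrite mul_mx_scalar scalemx_sub.
Qed.

Lemma horner_mx_dvd m (V : 'M[F]_(m, n)) p q :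
  V *m horner_mx B p = 0 -> p %| q -> V *m horner_mx B q = 0.
Proof.
by move=> Vp /dvdpP[r ->]; rewrite mulrC horner_mxM_mx mulmxA Vp mul0mx.
Qed.

Lemma minimal_annihilator W : exists2 l : seq F,
  W *m horner_mx B (\prod_(z <- l) ('X - z%:P)) = 0 &
  forall p, W *m horner_mx B p = 0 -> \prod_(z <- l) ('X - z%:P) %| p.
Proof.
have [s [p [p0 Wp ps]] smin] : exists2 s,
    (exists p, [/\ p != 0, W *m horner_mx B p = 0 & size p = s]) &
    forall p, p != 0 -> W *m horner_mx B p = 0 -> (s <= size p)%N.
  pose P s := `[<exists p, [/\ p != 0, W *m horner_mx B p = 0 & size p = s]>].
  have exP : exists s, P s.
    exists (size (char_poly B)); apply/asboolP; exists (char_poly B); split => //.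
      by rewrite monic_neq0// char_poly_monic.
    by rewrite Cayley_Hamilton mulmx0.
  have [s /asboolP Ps smin] := ex_minnP exP; exists s => // q q0 Wq.
  by apply: smin; apply/asboolP; exists q.
have [l pl] := closed_field_poly_normal p; exists l.
  move: Wp; rewrite pl linearZ /= -scalemxAr => /eqP.
  by rewrite scaler_eq0 lead_coef_eq0 (negPf p0) => /eqP.
have l0 : lead_coef p != 0 by rewrite lead_coef_eq0.
move=> q Wq; rewrite -(dvdpZl _ _ l0) -pl /dvdp; apply: contraT => r0.
have := smin _ r0; rewrite -ps leqNgt ltn_modp p0 => /(_ _)/negP; case=> //.
move: Wq; rewrite {1}(divp_eq q p) rmorphD /= mulrC horner_mxM_mx mulmxDr mulmxA Wp.
by rewrite mul0mx add0r.
Qed.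

(** A vector has the full annihilator [mu] once no [mu %/ ('X - z%:P)] kills it, for [z] in [l]. For
    the combination of the rows of [W] with coefficients [1, c, c ^+ 2, ...], it suffices that [c]
    avoids the roots of finitely many nonzero polynomials. *)
Lemma cyclic_vector_exists W l :
  W *m horner_mx B (\prod_(z <- l) ('X - z%:P)) = 0 ->
  (forall p, W *m horner_mx B p = 0 -> \prod_(z <- l) ('X - z%:P) %| p) ->
  exists2 v : 'rV[F]_n, (v <= W)%MS &
    forall p, v *m horner_mx B p = 0 -> \prod_(z <- l) ('X - z%:P) %| p.
Proof.
set mu := \prod_(z <- l) _ => Wmu Wmin.
have mu0 : mu != 0 by rewrite monic_neq0// monic_prod_XsubC.
pose M z := W *m horner_mx B (mu %/ ('X - z%:P)).
have rz z : z \in l -> root mu z by rewrite root_prod_XsubC.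
have muz z : z \in l -> mu = mu %/ ('X - z%:P) * ('X - z%:P).
  by move=> /rz; rewrite root_factor_theorem => /divpK.
have M0 z : z \in l -> M z != 0.
  move=> zl; apply/eqP => /Wmin; rewrite {1}(muz z zl) -[X in _ %| X]mulr1 dvdp_mul2l.
    by rewrite dvdp1 size_XsubC.
  by apply: contraNneq mu0 => q0; rewrite (muz z zl) q0 mul0r.
have ex_ij z : exists ij : 'I_n * 'I_n, z \in l -> M z ij.1 ij.2 != 0.
  have [zl|] := boolP (z \in l); last by exists (ord0, ord0).
  apply: contrapT => NE; move/eqP: (M0 z zl); apply; apply/matrixP => i j.
  rewrite [RHS]mxE; apply: contrapT => /eqP Mij; apply: NE; exists (i, j) => _.
  exact: Mij.
have /choice[ij ijP] := ex_ij.
pose P z : {poly F} := \sum_(i < n) M z i (ij z).2 *: 'X^i.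
have P0 z : z \in l -> P z != 0.
  move=> /ijP; apply: contraNneq => E.
  have /polyP/(_ (ij z).1) := E; rewrite coef0 coef_sum (bigD1 (ij z).1)//=.
  rewrite coefZ coefXn eqxx mulr1 big1 ?addr0 => [->//|k k0].
  by rewrite coefZ coefXn eq_sym val_eqE (negPf k0) mulr0.
have /closed_nonrootP[c] : \prod_(z <- l) P z != 0.
  by rewrite prodf_seq_neq0; apply/allP => z zl; exact: P0.
rewrite /root horner_prod => Pc.
pose y : 'rV[F]_n := \row_i c ^+ i.
exists (y *m W); first exact: submxMl.
move=> p vp.
have [u /andP[ug _]] := Bezoutp p mu; set g := gcdp p mu in ug.
have vg : y *m W *m horner_mx B g = 0.
  apply: horner_mx_dvd ug; rewrite rmorphD /= mulmxDr.
  rewrite (horner_mx_dvd vp) ?dvdp_mull// add0r.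
  by rewrite (@horner_mx_dvd _ _ mu) ?dvdp_mull// -mulmxA Wmu mulmx0.
have muE : mu = mu %/ g * g by rewrite divpK// dvdp_gcdr.
have [/eqP/size_poly1P[c0 c00 cE]|] := eqVneq (size (mu %/ g)) 1%N.
  apply: dvdp_trans (dvdp_gcdl p mu); rewrite -/g muE cE mul_polyC.
  by rewrite dvdpZl.
move=> /closed_rootP[z rz'].
have zl : z \in l by rewrite -root_prod_XsubC -/mu muE rootM rz'.
have : y *m M z = 0.
  rewrite mulmxA; apply: horner_mx_dvd vg _.
  move: rz'; rewrite root_factor_theorem => /dvdpP[h hE].
  have Xz : 'X - z%:P != 0 by rewrite polyXsubC_eq0.
  by rewrite muE hE mulrAC mulpK// dvdp_mull.
move=> /rowP/(_ (ij z).2); rewrite [LHS]mxE [RHS]mxE => E.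
move: Pc; rewrite prodf_seq_neq0 => /allP/(_ z zl) /=; rewrite horner_sum.
rewrite (_ : \sum_(_ < _) _ = 0) ?eqxx// -[RHS]E; apply: eq_bigr => i _.
by rewrite hornerZ hornerXn [y _ _]mxE mulrC.
Qed.

Lemma span_krylov_row m (v : 'rV[F]_n) (y : 'rV[F]_m) :
  y *m (\matrix_(j < m) (v *m horner_mx B 'X^j)) = v *m horner_mx B (rVpoly y).
Proof.
rewrite mulmx_sum_row.
have -> : rVpoly y = \sum_(j < m) y 0 j *: 'X^j.
  apply/polyP => k; rewrite coef_sum coef_rVpoly.
  case: insubP => [j _ <-|].
    rewrite (bigD1 j)//= coefZ coefXn eqxx mulr1 big1 ?addr0// => i ij.
    by rewrite coefZ coefXn eq_sym val_eqE (negPf ij) mulr0.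
  rewrite -leqNgt => mk; rewrite big1// => i _.
  by rewrite coefZ coefXn gtn_eqF ?mulr0// (leq_trans (ltn_ord i)).
rewrite linear_sum /= mulmx_sumr; apply: eq_bigr => j _.
by rewrite linearZ /= -scalemxAr rowK.
Qed.

(* Splits off the largest cyclic summand; [w] is dual to the top power of the
   cyclic vector [v], and [U] is the largest [B]-stable part of the kernel of [w]. *)
Lemma cyclic_summand W : stablemx W B -> W != 0 ->
  exists (l : seq F) (v : 'rV[F]_n) (U : 'M[F]_n),
  [/\ W *m horner_mx B (\prod_(z <- l) ('X - z%:P)) = 0 &
    forall p, W *m horner_mx B p = 0 -> \prod_(z <- l) ('X - z%:P) %| p] /\
  [/\ (0 < size l)%N, (v <= W)%MS, stablemx U B & (U <= W)%MS] /\
  (\rank U + size l = \rank W)%N /\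
    (forall S : 'M[F]_n, (v <= S)%MS -> stablemx S B -> (W <= U + S)%MS).
Proof.
move=> WB W0; have [l Wl lmin] := minimal_annihilator W.
have [v vW vmin] := cyclic_vector_exists Wl lmin.
set mu := \prod_(z <- l) _ in Wl lmin vmin.
have smu : size mu = (size l).+1 by rewrite size_prod_XsubC.
have l0 : (0 < size l)%N.
  rewrite lt0n; apply: contraNneq W0 => /size0nil l0.
  by move: Wl; rewrite /mu l0 big_nil rmorph1 mulmx1 => ->.
have [m lE] : exists m, size l = m.+1 by exists (size l).-1; rewrite prednK.
pose Kr := \matrix_(j < size l) (v *m horner_mx B 'X^j).
have vsmall p : (size p <= size l)%N -> v *m horner_mx B p = 0 -> p = 0.
  move=> ps /vmin; apply: contraTeq => p0; apply/negP => /(dvdp_leq p0).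
  by rewrite smu ltnNge ps.
have Krf : row_free Kr.
  rewrite -kermx_eq0; apply/eqP/row_matrixP => i; rewrite row0.
  have : row i (kermx Kr) *m Kr = 0 by rewrite -row_mul mulmx_ker row0.
  rewrite span_krylov_row => /(vsmall _ (size_poly _ _)) /(congr1 (poly_rV (d := size l))).
  by rewrite rVpolyK linear0.
have [X KX] := row_freeP Krf.
have mlt : (m < size l)%N by rewrite lE.
pose w := col (Ordinal mlt) X.
have vw p : (size p <= size l)%N -> v *m horner_mx B p *m w = (p`_m)%:M.
  move=> ps; rewrite -{1}(poly_rV_K ps) -span_krylov_row /w colE mulmxA -(mulmxA _ Kr) KX.
  by rewrite mulmx1 -colE; apply/matrixP => i k; rewrite !ord1 !mxE eqxx.
pose C : 'M[F]_(n, size l) := \matrix_(i, j) (horner_mx B 'X^j *m w) i 0.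
have colC k (x : 'M[F]_(k, n)) j : col j (x *m C) = x *m horner_mx B 'X^j *m w.
  by rewrite colE -mulmxA -colE -mulmxA; congr (_ *m _); apply/colP => i; rewrite !mxE.
have CP k (x : 'M[F]_(k, n)) p : x *m C = 0 -> x *m horner_mx B mu = 0 ->
    x *m horner_mx B p *m w = 0.
  move=> xC xmu; rewrite (divp_eq p mu) rmorphD /= mulmxDr.
  rewrite (@horner_mx_dvd _ _ mu) ?dvdp_mull// add0r.
  have rs : (size (p %% mu)%R <= size l)%N.
    by rewrite -ltnS -smu ltn_modp -size_poly_eq0 smu.
  rewrite -(coefK (p %% mu)) poly_def linear_sum /= mulmx_sumr mulmx_suml.
  rewrite big1// => j _; rewrite linearZ /= -scalemxAr -scalemxAl.
  by rewrite -(colC _ _ (widen_ord rs j)) xC col0 scaler0.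
pose U := (W :&: kermx C)%MS.
have UW : (U <= W)%MS by exact: capmxSl.
have UC : U *m C = 0 by apply/sub_kermxP; exact: capmxSr.
have Umu : U *m horner_mx B mu = 0.
  by have /submxP[D ->] := UW; rewrite -mulmxA Wl mulmx0.
have KrS (S : 'M[F]_n) : (v <= S)%MS -> stablemx S B -> (Kr <= S)%MS.
  move=> vS SB; apply/row_subP => j; rewrite rowK.
  by rewrite (submx_trans (submxMr _ vS))// stablemx_horner.
have UKr : (U :&: Kr)%MS = 0.
  apply/eqP/rowV0P => x; rewrite sub_capmx => /andP[/submxP[D xU] /submxP[y xE]].
  rewrite xE span_krylov_row in xU *.
  have [->|p0] := eqVneq (rVpoly y) 0; first by rewrite rmorph0 mulmx0.
  set p := rVpoly y in xU p0 *.
  have ps : (size p <= size l)%N by exact: size_poly.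
  have [d dE] : exists d, size p = d.+1 by exists (size p).-1; rewrite prednK// size_poly_gt0.
  have dm : (d <= m)%N by rewrite -ltnS -dE -lE.
  (* Multiplication by ['X^(m - d)] moves the leading coefficient of [p] to degree [m], where [w]
     reads it. *)
  have : v *m horner_mx B (p * 'X^(m - d)) *m w = 0.
    by rewrite horner_mxM_mx mulmxA xU -!mulmxA [X in D *m X]mulmxA CP ?mulmx0.
  rewrite vw; last by rewrite size_mulXn// dE lE addnS subnK.
  move=> /matrixP/(_ 0 0); rewrite !mxE eqxx mulr1n coefMXn ltnNge leq_subr /= subKn//.
  by move=> pd; move: p0; rewrite -lead_coef_eq0 lead_coefE dE /= pd eqxx.
have rUK : (\rank U + size l <= \rank W)%N.
  rewrite -(eqP Krf) -(mxrank_disjoint_sum UKr) mxrankS//.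
  by rewrite addsmx_sub UW KrS.
have rU : (\rank U + size l)%N = \rank W.
  have := mxrank_mul_ker W C; have := rank_leq_col (W *m C).
  by rewrite -/U; move: rUK; set r := \rank (W *m C); lia.
exists l, v, U; do 3!split => //.
  rewrite sub_capmx (submx_trans (submxMr _ UW))//=; apply/sub_kermxP/matrixP => i j.
  have /colP/(_ i) := colC _ (U *m B) j; rewrite [LHS]mxE => ->.
  rewrite -[X in U *m X](horner_mx_X B) -[U *m _ *m _]mulmxA -horner_mxM_mx.
  by rewrite CP// !mxE.
move=> S vS SB.
have KS := KrS S vS SB.
apply: submx_trans (addsmxS (submx_refl U) KS).
rewrite -(geq_leqif (mxrank_leqif_sup _)); last by rewrite addsmx_sub UW KrS.
by rewrite (mxrank_disjoint_sum UKr) (eqP Krf) rU.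
Qed.

(* Block number [b] of the bidiagonal form (counted from the bottom) is a
   single-superdiagonal block with characteristic polynomial [block_poly k lam bet b]. *)
Definition block_poly k (lam : nat -> F) (bet : nat -> nat) b : {poly F} :=
  \prod_(i < k | bet i == b) ('X - (lam i)%:P).

Lemma block_poly0 lam bet b : block_poly 0 lam bet b = 1.
Proof. by rewrite /block_poly big_ord0. Qed.

Lemma block_poly_shift k (lam lam' : nat -> F) (bet bet' : nat -> nat) m b :
  block_poly (k + m) (fun i => if (i < k)%N then lam i else lam' (i - k)%N)
    (fun i => if (i < k)%N then (bet i).+1 else bet' (i - k)%N) b =
  (if b is b'.+1 then block_poly k lam bet b' else 1) * block_poly m lam' bet' b.
Proof.
rewrite /block_poly big_split_ord /=; congr (_ * _).
  case: b => [|b].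
    by rewrite big1// => i /=; rewrite ltn_ord.
  by apply: eq_big => [i|i _]; rewrite /= ltn_ord.
have E (i : nat) : ((k + i < k) = false)%N by lia.
by apply: eq_big => [i|i _]; rewrite /= E addKn.
Qed.

(** Induction on the rank: the largest cyclic summand becomes block [0], placed last, and the blocks
    of the complement [U] are renumbered one higher. In the cyclic block, applying to [v] the
    successive products of linear factors gives the bidiagonal shape. Divisibility holds because the
    minimal polynomial on [W] kills [U], which is why minimality is part of the conclusion. *)
Lemma bidiagonal_basis W : stablemx W B ->
  exists (e : nat -> 'rV[F]_n) (lam : nat -> F) (bet : nat -> nat), let k := \rank W in
  [/\ (W <= \sum_(i < k) <<e i>>)%MS,
    (forall i, (i < k)%N -> e i *m B =
       lam i *: e i + (if (i.+1 < k)%N && (bet i == bet i.+1) then e i.+1 else 0)),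
    (forall i j, (i <= j < k)%N -> (bet j <= bet i)%N) /\
      (forall i, i.+1 = k -> bet i = 0%N),
    (forall b, block_poly k lam bet b.+1 %| block_poly k lam bet b) &
    W *m horner_mx B (block_poly k lam bet 0) = 0 /\
    (forall p, W *m horner_mx B p = 0 -> block_poly k lam bet 0 %| p)].
Proof.
have [k] := ubnP (\rank W); elim: k W => // k IH W /ltnSE rWk WB.
have [->|W0] := eqVneq W 0.
  exists (fun=> 0), (fun=> 0), (fun=> 0%N); rewrite mxrank0 /=; split => //.
  - exact: sub0mx.
  - by move=> b; rewrite !block_poly0 dvd1p.
  - by rewrite mul0mx block_poly0; split => // p _; rewrite dvd1p.
have [l [v [U [[Wl lmin] [[l0 vW UB UW] [rU USW]]]]]] := cyclic_summand WB W0.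
have [|e [lam [bet [Ue eB [bet_le bet0] bdvd [Uq qmin]]]]] := IH U _ UB.
  by rewrite (leq_trans _ rWk)// -rU -[ltnLHS]addn0 ltn_add2l.
set kU := \rank U in rU Ue eB bet_le bet0 bdvd Uq qmin.
set m := size l in rU l0.
pose pi j : {poly F} := \prod_(i < j) ('X - (l`_i)%:P).
pose u j := v *m horner_mx B (pi j).
have piS j : pi j.+1 = pi j * ('X - (l`_j)%:P) by rewrite /pi big_ord_recr.
have pim : pi m = \prod_(z <- l) ('X - z%:P).
  by rewrite /pi (big_nth 0) big_mkord.
have um : u m = 0.
  by rewrite /u pim; have /submxP[D ->] := vW; rewrite -mulmxA Wl mulmx0.
have uB j : u j *m B = l`_j *: u j + u j.+1.
  rewrite /u piS horner_mxM_mx rmorphB /= horner_mx_X horner_mx_C mulmxBr mulmxBr.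
  by rewrite mul_mx_scalar -scalemxAr mulmxA addrCA subrr addr0.
pose e' i := if (i < kU)%N then e i else u (i - kU)%N.
pose lam' i := if (i < kU)%N then lam i else l`_(i - kU).
pose bet' i := if (i < kU)%N then (bet i).+1 else 0%N.
have bpE b : block_poly (kU + m) lam' bet' b =
    (if b is b'.+1 then block_poly kU lam bet b' else 1) * (if b is 0 then pi m else 1).
  rewrite (block_poly_shift kU lam (nth 0 l) bet (fun=> 0%N) m b); congr (_ * _).
  by case: b => [|b]; rewrite /block_poly /=; [apply: eq_bigl|rewrite big_pred0].
have q0 : block_poly (kU + m) lam' bet' 0 = \prod_(z <- l) ('X - z%:P).
  by rewrite bpE mul1r pim.
exists e', lam', bet'; rewrite /= -rU; split.
- pose S := (\sum_(j < m) <<u j>>)%MS.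
  have uS j : (u j <= S)%MS.
    have [jm|mj] := ltnP j m.
      by rewrite (sumsmx_sup (Ordinal jm))// genmxE.
    have -> : u j = 0.
      rewrite /u -(subnKC mj) /pi big_split_ord horner_mxM_mx mulmxA.
      by rewrite [X in X *m _](_ : _ = u m)// um mul0mx.
    exact: sub0mx.
  have : (W <= U + S)%MS.
    apply: USW; first by have := uS 0%N; rewrite /u /pi big_ord0 rmorph1 mulmx1.
    rewrite sumsmxMr; apply/sumsmx_subP => j _.
    rewrite (eqmxMr _ (genmxE _)) uB addmx_sub ?scalemx_sub//; exact: uS.
  move/submx_trans; apply; rewrite addsmx_sub (submx_trans Ue) /=.
    apply/sumsmx_subP => j _; rewrite (sumsmx_sup (rshift kU j))// /e' /= ltnNge leq_addr /=.
    by rewrite addKn.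
  apply/sumsmx_subP => i _; rewrite (sumsmx_sup (lshift m i))// /e' /= ltn_ord.
  exact: submx_refl.
- move=> i ik; rewrite /e' /lam' /bet'.
  have [ikU|kUi] := ltnP i kU.
    rewrite eB//; have [iSkU|iSkU] := ltnP i.+1 kU.
      by rewrite eqSS (leq_trans iSkU) ?leq_addr.
    by rewrite andbF.
  have -> : (i.+1 < kU)%N = false by lia.
  rewrite uB eqxx andbT subSn//.
  case: ltnP => // kui; have -> : (i - kU).+1 = m by lia.
  by rewrite um.
- split=> [i j /andP[ij jk]|i iE]; rewrite /bet'.
    have [jkU|//] := ltnP j kU; rewrite (leq_ltn_trans ij jkU) ltnS.
    by rewrite bet_le// ij jkU.
  by case: ltnP => //; lia.
- move=> b; rewrite !bpE; case: b => [|b]; rewrite ?mulr1 ?mul1r//.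
  by apply: qmin; rewrite pim; have /submxP[D ->] := UW; rewrite -mulmxA Wl mulmx0.
- by rewrite q0.
Qed.

End BidiagonalForm.

(** * Newton coefficients of characteristic polynomials *)

Lemma det_add_rows (R : comNzRingType) n (M0 M1 : 'M[R]_n) :
  \det (M0 + M1) =
  \sum_(T : {set 'I_n}) \det (\matrix_(i, j) if i \in T then M1 i j else M0 i j).
Proof.
rewrite /determinant exchange_big /=; apply: eq_bigr => s _.
rewrite -mulr_sumr; congr (_ * _).
rewrite (eq_bigr (fun i => M1 i (s i) + M0 i (s i))) => [|i _]; last by rewrite mxE addrC.
rewrite bigA_distr; apply: eq_bigr => T _; apply: eq_bigr => i _.
by rewrite mxE.
Qed.

Section NewtonBasis.
Context {F : fieldType}.
Variable lam : nat -> F.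
Implicit Types P Q : {poly F}.

Definition newton i : {poly F} := \prod_(j < i) ('X - (lam j)%:P).
(** The divided difference of [P] at [lam 0, ..., lam i]: in the quotient by [newton i], the basis
    elements of larger index still vanish at [lam i]. *)
Definition ncoef i P : F := (P %/ newton i).[lam i].

Lemma newton_monic i : newton i \is monic. Proof. exact: monic_prod_XsubC. Qed.
Lemma newton_neq0 i : newton i != 0. Proof. exact: monic_neq0 (newton_monic i). Qed.
Lemma size_newton i : size (newton i) = i.+1.
Proof. by rewrite size_prod_XsubC /index_enum -enumT size_enum_ord. Qed.
Lemma newtonS i : newton i.+1 = newton i * ('X - (lam i)%:P).
Proof. by rewrite /newton big_ord_recr. Qed.

Lemma ncoef_is_linear i : linear_for *%R (ncoef i).
Proof. by move=> c P Q; rewrite /ncoef divpD divpZl hornerD hornerZ. Qed.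
HB.instance Definition _ i := GRing.isLinear.Build F {poly F} F *%R (ncoef i) (ncoef_is_linear i).

Lemma ncoef_dvd P i : newton i.+1 %| P -> ncoef i P = 0.
Proof.
move=> /dvdpP[Q ->]; rewrite /ncoef newtonS mulrA mulrAC mulpK ?newton_neq0//.
by rewrite hornerM hornerXsubC subrr mulr0.
Qed.

Lemma newton_expand P n :
  P = (P %/ newton n) * newton n + \sum_(i < n) ncoef i P *: newton i.
Proof.
elim: n => [|n IH]; first by rewrite /newton !big_ord0 divp1 mulr1 addr0.
rewrite big_ord_recr /= {1}IH addrA [RHS]addrAC; congr (_ + _).
set Q := P %/ newton n.
have -> : P %/ newton n.+1 = Q %/ ('X - (lam n)%:P) by rewrite newtonS -divp_divl.
rewrite newtonS [newton n * _]mulrC mulrA /ncoef -/Q -mul_polyC -mulrDl; congr (_ * _).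
by rewrite {1}(divp_eq Q ('X - (lam n)%:P)) modp_XsubC.
Qed.

Lemma newton_expand_monic P n : P \is monic -> size P = n.+1 ->
  P = newton n + \sum_(i < n) ncoef i P *: newton i.
Proof.
move=> Pm sP; rewrite {1}(newton_expand P n); congr (_ + _).
have sq : size (P %/ newton n) = 1%N.
  by rewrite size_divp ?newton_neq0// sP size_newton /= subSnn.
have /eqP/size_poly1P[c c0 cE] := sq.
have : lead_coef P = c.
  rewrite (newton_expand P n) cE mul_polyC lead_coefDl ?lead_coefZ.
    by rewrite (monicP (newton_monic n)) mulr1.
  rewrite size_scale// size_newton ltnS; apply: (leq_trans (size_sum _ _ _)).
  apply/bigmax_leqP => i _; apply: leq_trans (size_scale_leq _ _) _.
  by rewrite size_newton.
by rewrite (monicP Pm) cE => <-; rewrite mul1r.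
Qed.

End NewtonBasis.

(** * Row perturbations of a bidiagonal matrix *)

Section Blocks.
Context {F : fieldType}.

(** In a divisibility chain, deleting a given number of terms is worst when the first and largest
    ones go. *)
Lemma chain_prod_dvd (q : nat -> {poly F}) (A : pred nat) r :
  (forall b, q b.+1 %| q b) ->
  \prod_(count A (iota 0 r) <= b < r) q b %| \prod_(b < r | ~~ A b) q b.
Proof.
move=> qd; elim: r => [|r IH]; first by rewrite big_nil dvd1p.
have cr : (count A (iota 0 r) <= r)%N by rewrite -{2}(size_iota 0 r) count_size.
have -> : count A (iota 0 r.+1) = (count A (iota 0 r) + A r)%N.
  by rewrite -addn1 iotaD count_cat /= addn0 add0n.
rewrite [X in _ %| X]big_mkcond big_ord_recr -big_mkcond /=.
case: (A r) => /=.
  rewrite mulr1 addn1 big_add1 /=; apply: dvdp_trans IH.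
  by elim/big_rec2: _ => // b p1 p2 _ ?; rewrite dvdp_mul.
by rewrite addn0 big_nat_recr//= dvdp_mul.
Qed.

Context {n : nat}.
Variables (lam : nat -> F) (bet : nat -> nat).
Hypothesis bet_le : forall i j, (i <= j < n)%N -> (bet j <= bet i)%N.
Hypothesis block_dvd : forall b,
  \prod_(i < n | bet i == b.+1) ('X - (lam i)%:P) %| \prod_(i < n | bet i == b) ('X - (lam i)%:P).

Definition bidiag_mx : 'M[F]_n :=
  \matrix_(i, j) (lam i *+ (i == j) + ((j == i.+1 :> nat) && (bet i == bet j))%:R).

Lemma bidiag_mx_trig : is_trig_mx (bidiag_mx)^T.
Proof.
apply/is_trig_mxP => i j ij; rewrite !mxE.
by rewrite -val_eqE /= gtn_eqF// ltn_eqF ?mulr0n ?addr0//; lia.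
Qed.

Lemma char_poly_bidiag : char_poly bidiag_mx = newton lam n.
Proof.
rewrite /char_poly -det_tr det_trig; last first.
  apply/is_trig_mxP => i j ij; have /is_trig_mxP/(_ i j ij) := bidiag_mx_trig.
  by rewrite !mxE => ->; rewrite -val_eqE /= gtn_eqF// polyC0 subr0.
by apply: eq_bigr => i _; rewrite !mxE eqxx ltn_eqF// addr0.
Qed.

(** The rows up to [i0] lie in blocks numbered at least [bet i0]. As [T] meets at most [bet i0]
    blocks, the chain shows that the remaining ones are divisible by the product of all blocks from
    number [bet i0] on. *)
Lemma newton_dvd_blocks (T : {set 'I_n}) (i0 : 'I_n) : (#|T| <= bet i0)%N ->
  newton lam i0.+1 %|
  \prod_(i < n | [forall k in T, bet k != bet i]) ('X - (lam i)%:P).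
Proof.
move=> Ti0; pose r := (\sum_(i < n) bet i).+1.
have bet_r (i : 'I_n) : (bet i < r)%N by rewrite /r ltnS (bigD1 i)//= leq_addr.
pose q b := \prod_(i < n | bet i == b) ('X - (lam i)%:P).
pose A b := b \in map (fun k : 'I_n => bet k) (enum T).
have part (P : pred nat) : \prod_(i < n | P (bet i)) ('X - (lam i)%:P) =
    \prod_(b < r | P b) q b.
  rewrite (partition_big (fun i : 'I_n => Ordinal (bet_r i)) (fun b => P b))//=.
  apply: eq_bigr => b Pb; apply: eq_bigl => i; rewrite -val_eqE /=.
  by case: eqP => [->|_]; rewrite ?Pb ?andbT ?andbF.
have -> : \prod_(i < n | [forall k in T, bet k != bet i]) ('X - (lam i)%:P) =
    \prod_(b < r | ~~ A b) q b.
  rewrite -(part (fun b => ~~ A b)); apply: eq_bigl => i.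
  apply/forall_inP/negP => [H /mapP[k]|H k kT].
    by rewrite mem_enum => /H /negP + E; apply; rewrite E.
  by apply/negP => /eqP E; apply: H; apply/mapP; exists k; rewrite ?mem_enum.
apply: dvdp_trans (chain_prod_dvd _ _ _) => //.
have cT : (count A (iota 0 r) <= bet i0)%N.
  apply: leq_trans Ti0; rewrite cardE -(size_map (fun k : 'I_n => bet k)) -size_filter.
  apply: uniq_leq_size; first by rewrite filter_uniq// iota_uniq.
  by move=> b; rewrite mem_filter => /andP[].
rewrite (big_cat_nat _ (n := bet i0)) ?(ltnW (bet_r i0))//= dvdp_mull//.
rewrite big_geq_mkord -(part (fun b => bet i0 <= b)%N).
rewrite /newton (big_ord_widen_cond n xpredT (fun j => 'X - (lam j)%:P))//=.
rewrite [X in _ %| X](bigID (fun i : 'I_n => (i < i0.+1)%N)) /= dvdp_mulr//.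
rewrite [X in _ %| X](eq_bigl (fun i : 'I_n => (i < i0.+1)%N)) // => i.
rewrite andbC; case: ltnP => //= ii0; apply: bet_le.
by rewrite -ltnS ii0 ltn_ord.
Qed.

(** The matrix factors as [E *m G], where the triangular [E] keeps the rows of the blocks not met by
    [T]. This works because a row of such a block is supported in the block. *)
Lemma bidiag_rows_dvd (T : {set 'I_n}) (N : 'M[{poly F}]_n) :
  \prod_(i < n | [forall k in T, bet k != bet i]) ('X - (lam i)%:P) %|
  \det (\matrix_(i, j) if i \in T then N i j else char_poly_mx bidiag_mx i j).
Proof.
pose inS (i : 'I_n) := [forall k in T, bet k != bet i].
pose E : 'M[{poly F}]_n :=
  \matrix_(i, j) if inS i then char_poly_mx bidiag_mx i j else (i == j)%:R.
pose G : 'M[{poly F}]_n :=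
  \matrix_(i, j) if inS i then (i == j)%:R
    else if i \in T then N i j else char_poly_mx bidiag_mx i j.
have -> : \matrix_(i, j) (if i \in T then N i j else char_poly_mx bidiag_mx i j) = E *m G.
  apply/matrixP => i j; rewrite [LHS]mxE [RHS]mxE.
  have [iS|iS] := boolP (inS i); last first.
    rewrite (bigD1 i)//= [E i i]mxE (negPf iS) eqxx mul1r big1 ?addr0; last first.
      by move=> k ki; rewrite [E i k]mxE (negPf iS) eq_sym (negPf ki) mul0r.
    by rewrite [G i j]mxE (negPf iS).
  have iT : i \notin T.
    by apply/negP => iT; move: iS => /forall_inP/(_ i iT)/negP; apply.
  have kS k : char_poly_mx bidiag_mx i k != 0 -> inS k.
    rewrite !mxE; have [<- //|ik] := eqVneq i k.
    rewrite mulr0n add0r mulr0n add0r; case: andP => [[_ /eqP E1] _|_].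
      by rewrite /inS -E1.
    by rewrite polyC0 oppr0 eqxx.
  rewrite (negPf iT) (eq_bigr (fun k => char_poly_mx bidiag_mx i k * (k == j)%:R)); last first.
    move=> k _; rewrite [E i k]mxE iS [G k j]mxE.
    have [->|/kS ->//] := eqVneq (char_poly_mx bidiag_mx i k) 0.
    by rewrite !mul0r.
  rewrite (bigD1 j)//= eqxx mulr1 big1 ?addr0// => k /negPf ->.
  by rewrite mulr0.
rewrite det_mulmx dvdp_mulr// -det_tr det_trig; last first.
  apply/is_trig_mxP => i j ij; rewrite mxE mxE; case: ifP => _; last first.
    by rewrite -val_eqE /= gtn_eqF.
  have /is_trig_mxP/(_ i j ij) := bidiag_mx_trig.
  by rewrite !mxE => ->; rewrite -val_eqE /= gtn_eqF// polyC0 subr0.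
rewrite [X in _ %| X](bigID inS) /= dvdp_mulr//.
have -> : \prod_(i | inS i) E^T i i = \prod_(i < n | inS i) ('X - (lam i)%:P).
  by apply: eq_bigr => i iS; rewrite mxE mxE iS !mxE eqxx ltn_eqF// addr0.
exact: dvdpp.
Qed.

Lemma ncoef_char_poly_bidiag_add (D : 'M[F]_n) (i0 : 'I_n) :
  ncoef lam i0 (char_poly (bidiag_mx + D)) =
  \sum_(T : {set 'I_n} | (bet i0 < #|T|)%N)
    ncoef lam i0 (\det (\matrix_(i, j)
      if i \in T then - (D i j)%:P else char_poly_mx bidiag_mx i j)).
Proof.
rewrite /char_poly.
have -> : char_poly_mx (bidiag_mx + D) = char_poly_mx bidiag_mx + - map_mx polyC D.
  by apply/matrixP => i j; rewrite !mxE polyCD opprD addrA.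
rewrite det_add_rows linear_sum /= (bigID (fun T : {set 'I_n} => (bet i0 < #|T|)%N)) /=.
rewrite [X in _ + X]big1 ?addr0 => [|T].
  apply: eq_bigr => T _; congr (ncoef _ _ (\det _)).
  by apply/matrixP => i j; rewrite !mxE.
rewrite -leqNgt => Ti0; apply: ncoef_dvd.
exact: dvdp_trans (newton_dvd_blocks Ti0) (bidiag_rows_dvd _ _).
Qed.

End Blocks.

Arguments modc : simpl never.

(** * Coefficient norm and size of the Newton coefficients under perturbation *)

Section PolyNorm.
Context {R : realType}.
Implicit Types (P Q : {poly Cx R}) (K e : R).

(** The [l1] norm of the coefficients is submultiplicative, so determinants of polynomial matrices
    are estimated from their entries. *)
Definition pnorm P : R := \sum_(k < size P) modc P`_k.

Lemma pnormE N P : (size P <= N)%N -> pnorm P = \sum_(k < N) modc P`_k.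
Proof.
move=> sN; rewrite /pnorm (big_ord_widen_cond N xpredT (fun k => modc P`_k) sN) big_mkcond.
apply: eq_bigr => k _ /=; case: ltnP => // sk.
by rewrite nth_default// modc0.
Qed.

Lemma pnorm_ge0 P : 0 <= pnorm P.
Proof. by apply: sumr_ge0 => k _; exact: modc_ge0. Qed.

Lemma modc_coef_le P k : modc P`_k <= pnorm P.
Proof.
have [sk|ks] := leqP (size P) k; first by rewrite nth_default// modc0 pnorm_ge0.
rewrite /pnorm (bigD1 (Ordinal ks))//= lerDl.
by apply: sumr_ge0 => j _; exact: modc_ge0.
Qed.

Lemma pnormD P Q : pnorm (P + Q) <= pnorm P + pnorm Q.
Proof.
have sD := size_polyD P Q.
rewrite (pnormE sD) (pnormE (leq_maxl (size P) (size Q))) (pnormE (leq_maxr (size P) (size Q))).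
rewrite -big_split /=; apply: ler_sum => k _.
by rewrite coefD modcD.
Qed.

Lemma pnorm0 : pnorm 0 = 0.
Proof. by rewrite /pnorm size_poly0 big_ord0. Qed.

Lemma pnormZ c P : pnorm (c *: P) = modc c * pnorm P.
Proof.
rewrite (pnormE (size_scale_leq c P)) /pnorm mulr_sumr.
by apply: eq_bigr => k _; rewrite coefZ modcM.
Qed.

Lemma pnormC c : pnorm c%:P = modc c.
Proof.
by rewrite (pnormE (size_polyC_leq1 c)) big_ord1 coefC.
Qed.

Lemma pnormMX P : pnorm (P * 'X) = pnorm P.
Proof.
have s : (size (P * 'X)%R <= (size P).+1)%N.
  by have [->|P0] := eqVneq P 0; rewrite ?mul0r ?size_poly0// size_mulX.
rewrite (pnormE s) big_ord_recl coefMX /= modc0 add0r.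
by apply: eq_bigr => k _; rewrite coefMX.
Qed.

Lemma pnormM P Q : pnorm (P * Q) <= pnorm P * pnorm Q.
Proof.
elim/poly_ind: P => [|P c IH]; first by rewrite mul0r pnorm0 mul0r.
have -> : pnorm (P * 'X + c%:P) = pnorm P + modc c.
  have s : (size (P * 'X + c%:P)%R <= (size P).+1)%N.
    by rewrite size_MXaddC; case: ifP.
  rewrite (pnormE s) big_ord_recl coefD coefMX coefC /= add0r addrC; congr (_ + _).
  by apply: eq_bigr => k _; rewrite coefD coefMX coefC /= addr0.
rewrite !mulrDl mulrAC mul_polyC; apply: le_trans (pnormD _ _) _.
by rewrite pnormMX pnormZ lerD2r.
Qed.

Lemma pnorm_sum I (s : seq I) (p : pred I) (P : I -> {poly Cx R}) :
  pnorm (\sum_(i <- s | p i) P i) <= \sum_(i <- s | p i) pnorm (P i).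
Proof.
elim/big_rec2: _ => [|i x y _ h]; first by rewrite pnorm0.
by apply: le_trans (pnormD _ _) _; rewrite lerD2l.
Qed.

Lemma pnorm_prod I (s : seq I) (P : I -> {poly Cx R}) (M : I -> R) :
  (forall i, pnorm (P i) <= M i) -> pnorm (\prod_(i <- s) P i) <= \prod_(i <- s) M i.
Proof.
move=> PM; elim: s => [|i s IH]; first by rewrite !big_nil pnormC modc1.
rewrite !big_cons; apply: le_trans (pnormM _ _) _.
by rewrite ler_pM ?pnorm_ge0.
Qed.

Lemma pnorm_XsubC_le z : modc z <= 1 -> pnorm ('X - z%:P) <= 2.
Proof.
move=> z1; apply: le_trans (pnormD _ _) _.
rewrite -polyCN pnormC modcN -['X]mul1r pnormMX pnormC modc1; lra.
Qed.

Lemma pnorm_prod_XsubC_le (s : seq (Cx R)) : (forall z, z \in s -> modc z <= 1) ->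
  pnorm (\prod_(z <- s) ('X - z%:P)) <= 2 ^+ size s.
Proof.
elim: s => [|z s IH] s1; first by rewrite big_nil pnormC modc1.
rewrite big_cons exprS; apply: le_trans (pnormM _ _) _.
rewrite ler_pM ?pnorm_ge0 ?pnorm_XsubC_le ?s1 ?mem_head//.
by apply: IH => x xs; rewrite s1// in_cons xs orbT.
Qed.

Lemma ncoef_coef (lam : nat -> Cx R) i N P : (size P <= N)%N ->
  ncoef lam i P = \sum_(k < N) P`_k * ncoef lam i 'X^k.
Proof.
move=> sN; rewrite -{1}(coefK P) poly_def linear_sum /=.
rewrite (big_ord_widen_cond N xpredT (fun k => ncoef lam i (P`_k *: 'X^k)) sN) big_mkcond.
apply: eq_bigr => k _ /=; rewrite linearZ /=; case: ltnP => // sk.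
by rewrite nth_default// mul0r.
Qed.

Lemma ncoef_le_pnorm (lam : nat -> Cx R) i N : exists2 K, 0 <= K &
  forall P, (size P <= N)%N -> modc (ncoef lam i P) <= K * pnorm P.
Proof.
exists (\sum_(k < N) modc (ncoef lam i 'X^k)).
  by apply: sumr_ge0 => k _; exact: modc_ge0.
move=> P sN; rewrite (ncoef_coef _ _ sN); apply: le_trans (modc_sum _ _ _) _.
rewrite mulr_suml; apply: ler_sum => k _.
by rewrite modcM mulrC ler_wpM2l ?modc_ge0// modc_coef_le.
Qed.

Lemma pnorm_det_le n (M : 'M[{poly Cx R}]_n) (b : 'I_n -> R) :
  (forall i j, pnorm (M i j) <= b i) -> pnorm (\det M) <= n`!%:R * \prod_i b i.
Proof.
move=> Mb; apply: le_trans (pnorm_sum _ _ _) _.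
apply: (@le_trans _ _ (\sum_(s : {perm 'I_n}) \prod_i b i)); last first.
  by rewrite sumr_const card_Sn mulr_natl.
apply: ler_sum => s _; apply: le_trans (pnormM _ _) _.
have -> : pnorm ((-1) ^+ s) = 1.
  by rewrite -signr_odd; case: (odd s) => /=; rewrite ?expr0 ?expr1 -?polyCN pnormC ?modcN modc1.
rewrite mul1r; exact: pnorm_prod.
Qed.

Lemma size_det_le n (M : 'M[{poly Cx R}]_n) :
  (forall i j, (size (M i j) <= 2)%N) -> (size (\det M) <= n.+1)%N.
Proof.
move=> M2; apply: (leq_trans (size_sum _ _ _)); apply/bigmax_leqP => s _.
suff H : (size (\prod_i M i (s i))%R <= n.+1)%N.
  by rewrite mulr_sign; case: ifP => _; rewrite ?size_polyN.
apply: leq_trans (size_prod_leq _ _) _.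
rewrite -[X in (_ - X)%N]sum1_card leq_subLR.
apply: (@leq_trans (\sum_(i < n) 2).+1); first by rewrite ltnS leq_sum.
by rewrite !sum_nat_const card_ord; lia.
Qed.

Lemma size_char_poly_mx_entry n (A : 'M[Cx R]_n) i j : (size (char_poly_mx A i j) <= 2)%N.
Proof.
rewrite !mxE; case: (i == j); last by rewrite mulr0n add0r size_polyN (leq_trans (size_polyC_leq1 _)).
by rewrite mulr1n size_XsubC.
Qed.

Section Necessary.
Context {n : nat}.
Variables (lam : nat -> Cx R) (bet : nat -> nat).
Hypothesis bet_le : forall i j, (i <= j < n)%N -> (bet j <= bet i)%N.
Hypothesis block_dvd : forall b,
  \prod_(i < n | bet i == b.+1) ('X - (lam i)%:P) %| \prod_(i < n | bet i == b) ('X - (lam i)%:P).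

Lemma ncoef_char_poly_near (i0 : 'I_n) : exists2 K, 0 <= K &
  forall (D : 'M[Cx R]_n) e, 0 <= e <= 1 -> (forall i j, modc (D i j) <= e) ->
    modc (ncoef lam i0 (char_poly (bidiag_mx lam bet + D))) <= K * e ^+ (bet i0).+1.
Proof.
have [C C0 HC] := ncoef_le_pnorm lam i0 n.+1.
(* At least [1], so that the rows outside [T] contribute at most [b0 ^+ n] whatever their number. *)
pose b0 : R := 1 + \sum_(i < n) \sum_(j < n) pnorm (char_poly_mx (n := n) (bidiag_mx lam bet) i j).
have b1 : 1 <= b0 by rewrite lerDl sumr_ge0// => i _; rewrite sumr_ge0// => j _; exact: pnorm_ge0.
have bM i j : pnorm (char_poly_mx (n := n) (bidiag_mx lam bet) i j) <= b0.
  rewrite /b0 (bigD1 i)//= (bigD1 j)//= addrCA -addrA lerDl !addr_ge0//.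
    by apply: sumr_ge0 => k _; exact: pnorm_ge0.
  by apply: sumr_ge0 => k _; apply: sumr_ge0 => l _; exact: pnorm_ge0.
exists (\sum_(T : {set 'I_n}) C * (n`!%:R * b0 ^+ n)).
  by apply: sumr_ge0 => T _; rewrite !mulr_ge0// exprn_ge0//; lra.
move=> D e /andP[e0 e1] De; rewrite (ncoef_char_poly_bidiag_add bet_le block_dvd).
apply: le_trans (modc_sum _ _ _) _; rewrite mulr_suml big_mkcond /=.
apply: ler_sum => T _; case: ifP => Ti0; last first.
  by rewrite !mulr_ge0 ?exprn_ge0//; lra.
apply: le_trans (HC _ (size_det_le _)) _.
  move=> i j; rewrite mxE; case: ifP => _; last exact: size_char_poly_mx_entry.
  by rewrite -polyCN (leq_trans (size_polyC_leq1 _)).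
rewrite -mulrA ler_wpM2l//.
apply: le_trans (pnorm_det_le (b := fun i => if i \in T then e else b0) _) _.
  move=> i j; rewrite mxE; case: ifP => _; last exact: bM.
  by rewrite -polyCN pnormC modcN.
rewrite -mulrA ler_wpM2l//.
rewrite (bigID (mem T)) /= mulrC; apply: ler_pM.
- by rewrite prodr_ge0// => i _; case: ifP => _ //; lra.
- by rewrite prodr_ge0// => i _; case: ifP => _ //; lra.
- rewrite (eq_bigr (fun=> b0)) => [|i /negPf -> //]; rewrite prodr_const.
  by apply: ler_weXn2l => //; rewrite -[leqRHS]card_ord max_card.
- rewrite (eq_bigr (fun=> e)) => [|i -> //]; rewrite prodr_const.
  exact: ler_wiXn2l.
Qed.

End Necessary.

End PolyNorm.

(** * Cyclic matrices and Hessenberg form *)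

Section RowCyclic.
Context {F : closedFieldType} {n' : nat}.
Let n := n'.+1.
Implicit Types (A S : 'M[F]_n) (v : 'rV[F]_n) (p : {poly F}).

(** Cyclicity for the action on rows, in a form that identifies polynomials: two of degree less than
    [n] that agree on [v] are equal. *)
Definition row_cyclic A v :=
  forall p, (size p <= n)%N -> v *m horner_mx A p = 0 -> p = 0.

(** In the bases of iterates of their cyclic vectors, both matrices become the companion matrix of
    the common characteristic polynomial. *)
Lemma row_cyclic_similar A S v u : row_cyclic A v -> row_cyclic S u ->
  char_poly A = char_poly S -> exists2 X, X \in unitmx & S *m X = X *m A.
Proof.
move=> Av Su AS.
pose K (M : 'M[F]_n) (w : 'rV[F]_n) := \matrix_(j < n) (w *m horner_mx M 'X^j).
have Kunit M w : row_cyclic M w -> K M w \in unitmx.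
  move=> Mw; rewrite -row_free_unit -kermx_eq0; apply/eqP/row_matrixP => i; rewrite row0.
  have : row i (kermx (K M w)) *m K M w = 0 by rewrite -row_mul mulmx_ker row0.
  rewrite span_krylov_row => /(Mw _ (size_poly _ _)) /(congr1 (poly_rV (d := n))).
  by rewrite rVpolyK linear0.
have KA := Kunit _ _ Av; have KS := Kunit _ _ Su.
have mod_char M (w : 'rV[F]_n) p : w *m horner_mx M (p %% char_poly M) = w *m horner_mx M p.
  rewrite [in RHS](divp_eq p (char_poly M)) rmorphD rmorphM /= Cayley_Hamilton.
  by rewrite mulr0 add0r.
have rowKM M w j : row j (K M w *m M) = w *m horner_mx M ('X^(j.+1)).
  by rewrite row_mul rowK -mulmxA -[X in _ *m (_ *m X)](horner_mx_X M) -horner_mxM_mx -exprSr.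
suff E : K S u *m S *m invmx (K S u) *m K A v = K A v *m A.
  exists (invmx (K S u) *m K A v); first by rewrite unitmx_mul unitmx_inv KS KA.
  by rewrite -mulmxA -E !mulmxA mulVmx// mul1mx.
apply/row_matrixP => j; rewrite rowKM row_mul.
set y := row j _; have yS : y *m K S u = u *m horner_mx S ('X^(j.+1)).
  by rewrite -rowKM /y -row_mul mulmxKV.
rewrite span_krylov_row -[RHS]mod_char AS; rewrite span_krylov_row -[RHS]mod_char in yS.
have chn : size (char_poly S) = n.+1 by rewrite size_char_poly.
have ch0 : char_poly S != 0 by rewrite -size_poly_eq0 chn.
congr (_ *m horner_mx _ _).
apply/eqP; rewrite -subr_eq0; apply/eqP; apply: Su.
  apply: leq_trans (size_polyD _ _) _; rewrite size_polyN geq_max size_poly /=.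
  by rewrite -ltnS -chn ltn_modp.
by rewrite rmorphB mulmxBr yS subrr.
Qed.

End RowCyclic.

Section Hessenberg.
Context {F : closedFieldType} {n' : nat}.
Let n := n'.+1.
Variables (lam : nat -> F) (bet : nat -> nat).
Hypothesis bet_le : forall i j, (i <= j < n)%N -> (bet j <= bet i)%N.
Hypothesis bet0 : bet n' = 0%N.

(** Here [t] stands for [z - alpha]. When [bet] decreases, superdiagonal entries are [1] within a
    block and positive powers of [t] between blocks: the blocks decouple at [t = 0], and the matrix
    is cyclic for [t != 0]. The last row [c] carries the free coefficients of the characteristic
    polynomial. *)
Definition hess_mx (t : F) (c : nat -> F) : 'M[F]_n :=
  \matrix_(i, j) (lam i *+ (i == j) + t ^+ (bet i - bet j) *+ (j == i.+1 :> nat)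
    + c j *+ (i == n' :> nat)).

Lemma hess_mx0 : hess_mx 0 (fun=> 0) = bidiag_mx lam bet.
Proof.
apply/matrixP => i j; rewrite !mxE mul0rn addr0; congr (_ + _).
case: eqP => [ji|_]; rewrite ?mulr1n ?mulr0n//=.
have := bet_le (i := i) (j := j); rewrite ji leqnSn -ji ltn_ord => /(_ isT) bij.
by rewrite expr0n subn_eq0 eqn_leq bij andbT.
Qed.

Section Cyclic.
Variables (t : F) (c : nat -> F).
Hypothesis t0 : t != 0.
Let S := hess_mx t c.
Let e (i : nat) : 'rV[F]_n := \row_j (j == i :> nat)%:R.

Let eS i : (i < n')%N -> e i *m S = lam i *: e i + t ^+ (bet i - bet i.+1) *: e i.+1.
Proof.
move=> ii; have iin : (i < n)%N by rewrite ltnS ltnW.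
apply/rowP => j; rewrite mxE (bigD1 (Ordinal iin))//= big1 ?addr0 => [|k]; last first.
  by rewrite -val_eqE /= mxE => /negPf ->; rewrite mul0r.
rewrite !mxE eqxx mul1r /= (ltn_eqF ii) mulr0n addr0.
rewrite -val_eqE /= eq_sym; congr (_ + _).
  by case: eqP => _; rewrite ?mulr1n ?mulr1// mulr0n mulr0.
by case: eqP => [->|_]; rewrite ?mulr1n ?mulr1// mulr0n mulr0.
Qed.

Let eSn : e n' *m S = lam n' *: e n' + \row_j c j.
Proof.
apply/rowP => j; rewrite mxE (bigD1 ord_max)//= big1 ?addr0 => [|k]; last first.
  by rewrite -val_eqE /= mxE => /negPf ->; rewrite mul0r.
rewrite !mxE eqxx mul1r /= mulr1n (ltn_eqF (ltn_ord j)) mulr0n addr0.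
rewrite -val_eqE /= eq_sym; congr (_ + _).
by case: eqP => _; rewrite ?mulr1n ?mulr1// mulr0n mulr0.
Qed.

Lemma hess_newton i : (i <= n')%N ->
  e 0 *m horner_mx S (newton lam i) = t ^+ (bet 0 - bet i) *: e i.
Proof.
elim: i => [|i IH] ii.
  by rewrite /newton big_ord0 rmorph1 mulmx1 subnn expr0 scale1r.
rewrite newtonS horner_mxM_mx mulmxA IH ?(ltnW ii)// rmorphB /= horner_mx_X horner_mx_C.
rewrite mulmxBr -scalemxAl eS// mul_mx_scalar scalerDr !scalerA [lam i * _]mulrC.
rewrite addrAC subrr add0r -exprD; congr (t ^+ _ *: _).
have b1 : (bet i <= bet 0)%N by apply: bet_le; lia.
have b2 : (bet i.+1 <= bet i)%N by apply: bet_le; lia.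
by lia.
Qed.

Lemma hess_row_cyclic : row_cyclic S (e 0).
Proof.
move=> p ps ep; have pE : p = \sum_(i < n) ncoef lam i p *: newton lam i.
  rewrite {1}(newton_expand lam p n) divp_small ?mul0r ?add0r//.
  by rewrite size_newton ltnS.
have : \sum_(i < n) (ncoef lam i p * t ^+ (bet 0 - bet i)) *: e i = 0.
  rewrite -[RHS]ep {2}pE linear_sum /= mulmx_sumr; apply: eq_bigr => i _.
  by rewrite linearZ /= -scalemxAr hess_newton ?scalerA// -ltnS.
move=> E; rewrite pE big1// => i _.
have /rowP/(_ i) := E; rewrite summxE mxE (bigD1 i)//= big1 ?addr0.
  rewrite !mxE eqxx mulr1 => /eqP; rewrite mulf_eq0 expf_eq0 (negPf t0) andbF orbF.
  by move=> /eqP ->; rewrite scale0r.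
by move=> k ki; rewrite !mxE val_eqE eq_sym (negPf ki) mulr0.
Qed.

(** By cyclicity it suffices to compare both sides on [e 0], their difference having degree less
    than [n]. Reaching [e i] costs [t ^+ (bet 0 - bet i)] and reaching the last row costs
    [t ^+ bet 0], whence the weight [t ^+ bet i]. *)
Lemma char_poly_hess :
  char_poly S = newton lam n - \sum_(i < n) (c i * t ^+ bet i) *: newton lam i.
Proof.
apply/eqP; rewrite -subr_eq0; apply/eqP; apply: hess_row_cyclic.
  rewrite (newton_expand_monic lam (char_poly_monic S) (size_char_poly S)).
  rewrite opprB addrCA addrAC subrr add0r -big_split /=.
  apply: (leq_trans (size_sum _ _ _)); apply/bigmax_leqP => i _.
  by rewrite -scalerDl (leq_trans (size_scale_leq _ _))// size_newton.
rewrite !rmorphB /= Cayley_Hamilton sub0r opprB mulmxBr newtonS horner_mxM_mx mulmxA hess_newton//.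
rewrite bet0 subn0 rmorphB /= horner_mx_X horner_mx_C -scalemxAl mulmxBr eSn mul_mx_scalar.
rewrite [_ + \row__ _]addrC addrK linear_sum /= mulmx_sumr -[X in _ - X]scale1r.
have -> : \row_j c j = \sum_(i < n) c i *: e i.
  apply/rowP => j; rewrite mxE summxE (bigD1 j)//= !mxE eqxx mulr1 big1 ?addr0// => i ij.
  by rewrite !mxE eq_sym val_eqE (negPf ij) mulr0.
rewrite scale1r scaler_sumr -sumrB big1// => i _.
have bi : (bet i <= bet 0)%N by apply: bet_le; rewrite ltn_ord.
rewrite linearZ /= -scalemxAr hess_newton; last by rewrite -ltnS.
by rewrite !scalerA -mulrA -exprD subnKC// mulrC subrr.
Qed.

End Cyclic.
End Hessenberg.

(** * Discs in the spectral ball *)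

Section MatrixCalculus.
Context {R : realType}.

Lemma cvg_mx_entries (T : Type) (F : set_system T) (FF : Filter F) m n
  (f : T -> 'M[Cx R]_(m, n)) (l : 'M[Cx R]_(m, n)) :
  (f @ F --> l) <-> forall i j, (fun t => f t i j) @ F --> l i j.
Proof.
split=> [fl i j|H].
  by apply: (@continuous_cvg _ _ _ F _ f (fun M : 'M[Cx R]_(m, n) => M i j) l) fl; exact: coord_continuous.
apply/cvg_ballP => e e0.
have H' (ij : 'I_m * 'I_n) : \forall t \near F, ball (l ij.1 ij.2) e (f t ij.1 ij.2).
  by have /cvg_ballP := H ij.1 ij.2; apply.
have := @filter_forall _ _ _ _ FF H'.
by apply: filterS => t Ht; split=> // i j; exact: (Ht (i, j)).
Qed.

Lemma derivable_mxCx m n (f : Cx R -> 'M[Cx R]_(m, n)) z :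
  derivable f z 1 <-> forall i j, derivable (fun x => f x i j) z 1.
Proof.
split=> [/cvg_ex[/= l fl] i j|H].
  apply/cvg_ex; exists (l i j).
  have : (fun h => (h^-1 *: (f (h *: 1 + z) - f z)) i j) @ 0^' --> (l i j : Cx R).
    exact: ((cvg_mx_entries _ _ _).1 fl i j).
  by under eq_fun do rewrite !mxE.
have /choice[l lP] : forall ij : 'I_m * 'I_n, exists l : Cx R,
    h^-1 *: (f (h *: 1 + z) ij.1 ij.2 - f z ij.1 ij.2) @[h --> 0^'] --> l.
  by move=> ij; have /cvg_ex[l Hl] := H ij.1 ij.2; exists l; exact: Hl.
apply/cvg_ex; exists (\matrix_(i, j) l (i, j)).
apply/cvg_mx_entries => i j; rewrite mxE.
under eq_fun do rewrite !mxE.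
exact: lP (i, j).
Qed.

Lemma derivable_mulmx m n p (f : Cx R -> 'M[Cx R]_(m, n)) (g : Cx R -> 'M[Cx R]_(n, p)) z :
  derivable f z 1 -> derivable g z 1 -> derivable (fun x => f x *m g x) z 1.
Proof.
move=> /derivable_mxCx fd /derivable_mxCx gd; apply/derivable_mxCx => i j.
under eq_fun do rewrite mxE.
by apply: derivable_bigsum => k _; apply: derivable_mul.
Qed.

Lemma derivable_det n (f : Cx R -> 'M[Cx R]_n) z :
  (forall i j, derivable (fun x => f x i j) z 1) -> derivable (fun x => \det (f x)) z 1.
Proof.
move=> fd; apply: derivable_bigsum => s _; apply: derivable_mul.
  exact: derivable_cst.
by apply: derivable_bigprod => i _; exact: fd.
Qed.

(** [invmx] is defined by cases; the adjugate formula agrees with it on invertible values and is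
    rational in the entries. *)
Lemma derivable_adj_inv n (f : Cx R -> 'M[Cx R]_n) z : derivable f z 1 ->
  f z \in unitmx -> derivable (fun x => (\det (f x))^-1 *: \adj (f x)) z 1.
Proof.
move=> /derivable_mxCx fd fz; apply/derivable_mxCx => i j.
under eq_fun do rewrite mxE.
apply: derivable_mul.
  by apply: derivable_inv; [rewrite -unitfE|exact: derivable_det].
under eq_fun do rewrite mxE; apply: derivable_mul; first exact: derivable_cst.
apply: derivable_det => k l; under eq_fun do rewrite !mxE; exact: fd.
Qed.

Lemma spectral_ballP n (A : 'M[Cx R]_n) : (0 < n)%N ->
  spectral_ball A <-> forall a, root (char_poly A) a -> modc a < 1.
Proof.
move=> n0; have [s sE] := closed_field_poly_normal (char_poly A).
have rs a : root (char_poly A) a = (a \in s).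
  rewrite sE (monicP (char_poly_monic A)) scale1r root_prod_XsubC//.
have ss : size s = n.
  apply/eqP; rewrite -eqSS -(size_char_poly A) sE (monicP (char_poly_monic A)) scale1r.
  by rewrite size_prod_XsubC.
have [m [ms mP]] : exists m, m \in s /\ forall a, a \in s -> modc a <= modc m.
  have s0 : s != [::] by rewrite -size_eq0 ss -lt0n.
  elim: s s0 {sE rs ss} => // x s IH _.
  have [->|/IH[m [ms mP]]] := eqVneq s [::].
    by exists x; rewrite mem_head; split => // a; rewrite inE => /eqP ->.
  have [xm|mx] := leP (modc x) (modc m).
    exists m; rewrite in_cons ms orbT; split => // a.
    by rewrite in_cons => /orP[/eqP -> //|/mP].
  exists x; rewrite mem_head; split => // a.
  by rewrite in_cons => /orP[/eqP -> //|/mP am]; apply: le_trans am (ltW mx).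
have setE : [set a : Cx R | eigenvalue A a] = [set a | a \in s].
  by apply/seteqP; split => a /=; rewrite eigenvalue_root_char rs.
rewrite /spectral_ball /= /spectral_radius setE.
have -> : sup [set modc a | a in [set a | a \in s]] = modc m.
  apply/le_anti/andP; split.
    apply: ge_sup; first by exists (modc m), m.
    by move=> _ [a /= /mP am <-].
  apply: ub_le_sup; last by exists m.
  by exists (modc m) => _ [a /= /mP am <-].
split=> [m1 a|H]; last by apply: H; rewrite rs.
by rewrite rs => /mP am; apply: le_lt_trans am m1.
Qed.

Lemma char_poly_similar n (A C X : 'M[Cx R]_n) :
  X \in unitmx -> X *m A = C *m X -> char_poly A = char_poly C.
Proof.
move=> Xu XA.
have XuP : map_mx polyC X \in unitmx by rewrite map_unitmx.
have E : map_mx polyC X *m char_poly_mx A = char_poly_mx C *m map_mx polyC X.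
  rewrite /char_poly_mx mulmxBr mulmxBl -!map_mxM XA.
  by rewrite mul_mx_scalar mul_scalar_mx.
have : \det (map_mx polyC X *m char_poly_mx A) = \det (char_poly_mx C *m map_mx polyC X) by rewrite E.
rewrite !det_mulmx mulrC; apply: mulIf.
by rewrite det_map_mx /= polyC_eq0 -unitfE.
Qed.

Lemma similar_bidiag n' (A : 'M[Cx R]_n'.+1) :
  exists P (lam : nat -> Cx R) (bet : nat -> nat),
  [/\ P \in unitmx, P *m A = bidiag_mx lam bet *m P, bet n' = 0%N,
    (forall i j, (i <= j < n'.+1)%N -> (bet j <= bet i)%N) &
    forall b, \prod_(i < n'.+1 | bet i == b.+1) ('X - (lam i)%:P) %|
      \prod_(i < n'.+1 | bet i == b) ('X - (lam i)%:P)].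
Proof.
have [|e [lam [bet]]] := @bidiagonal_basis _ _ A 1%:M; first exact: submx1.
rewrite mxrank1 => -[We eA [ble b0] bd _].
exists (\matrix_i e i), lam, bet; split => //; last exact: b0.
  rewrite -row_full_unit -sub1mx (submx_trans We)//; apply/sumsmx_subP => i _.
  by rewrite genmxE -(rowK (fun i : 'I_n'.+1 => e i)) row_sub.
apply/row_matrixP => i; rewrite row_mul rowK eA// row_mul.
rewrite mulmx_sum_row (eq_bigr (fun j : 'I_n'.+1 => (lam i *+ (i == j)) *: e j
    + ((j == i.+1 :> nat) && (bet i == bet j))%:R *: e j)); last first.
  by move=> j _; rewrite !mxE rowK scalerDl.
rewrite big_split /=; congr (_ + _).
  rewrite (bigD1 i)//= eqxx mulr1n big1 ?addr0// => j /negPf ji.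
  by rewrite eq_sym ji mulr0n scale0r.
have [iSn|iSn] /= := ltnP i.+1 n'.+1.
  rewrite (bigD1 (Ordinal iSn))//= eqxx /= big1 ?addr0 => [|j /negPf].
    by case: eqP; rewrite ?scale1r ?scale0r.
  by rewrite -val_eqE /= => ->; rewrite scale0r.
rewrite big1// => j _; have -> : (j == i.+1 :> nat) = false by have := ltn_ord j; lia.
by rewrite scale0r.
Qed.

(* Iterated square roots of [tau] converge to [1]. *)
Lemma root_pow2_near1 (tau : Cx R) (d : R) : tau != 0 -> 0 < d ->
  exists (w : Cx R) k, w ^+ (2 ^ k) = tau /\ modc (w - 1) < d.
Proof.
move=> t0 d0; have mt0 : 0 < modc tau by rewrite modc_gt0.
pose c := Num.min 1 (modc tau).
have c0 : 0 < c by rewrite lt_min ltr01.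
have c1 : c <= 1 by rewrite ge_min lexx.
(* If [x ^+ 2 = w] with nonnegative real part and [c <= modc x], then
   [1 + c ^+ 2 / 3 <= modc (x + 1)] because [c <= 1]. As [w - 1 = (x - 1) * (x + 1)], each root
   contracts the distance to [1] by the factor [q]. *)
pose q := (1 + c ^+ 2 / 3)^-1.
have cc0 : 0 < c ^+ 2 by rewrite exprn_gt0.
have cc1 : c ^+ 2 <= 1 by rewrite exprn_ile1// ltW.
have q0 : 0 < q by rewrite invr_gt0; lra.
have q1 : q < 1 by rewrite invf_lt1; lra.
have step k : exists w : Cx R, [/\ w ^+ (2 ^ k) = tau, c <= modc w &
    modc (w - 1) <= q ^+ k * modc (tau - 1)].
  elim: k => [|k [w [wk cw wq]]].
    by exists tau; rewrite expr1 expr0 mul1r ge_min lexx orbT.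
  have [x xw xR] : exists2 x : Cx R, x ^+ 2 = w & 0 <= complex.Re x.
    have [xR|/ltW xR] := leP 0 (complex.Re (sqrtc w)).
      by exists (sqrtc w) => //; exact: sqr_sqrtc.
    exists (- sqrtc w); first by rewrite sqrrN; exact: sqr_sqrtc.
    by case: (sqrtc w) xR => a b /=; rewrite oppr_ge0.
  have cx : c <= modc x.
    rewrite -(@ler_pXn2r _ 2) ?nnegrE ?modc_ge0 ?(ltW c0)// -modcX xw.
    apply: le_trans cw; rewrite expr2 -[leRHS]mulr1 ler_pM2l//.
  exists x; split => //; first by rewrite expnS exprM xw.
  have x1 : 1 + c ^+ 2 / 3 <= modc (x + 1).
    rewrite -(@ler_pXn2r _ 2) ?nnegrE ?modc_ge0//; last lra.
    have : c ^+ 2 <= modc x ^+ 2 by rewrite lerXn2r ?nnegrE ?modc_ge0 ?(ltW c0).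
    rewrite !modc_sqr; case: (x) xR => a b /= a0 cab; nra.
  have x10 : 0 < modc (x + 1) by apply: lt_le_trans x1; lra.
  have -> : modc (x - 1) = modc (w - 1) / modc (x + 1).
    have -> : w - 1 = (x - 1) * (x + 1) by rewrite -xw; ring.
    by rewrite modcM mulfK// gt_eqF.
  rewrite exprS mulrC -mulrA; apply: ler_pM; rewrite ?invr_ge0 ?modc_ge0//.
  by rewrite /q lef_pV2 ?posrE//; lra.
have [k Hk] : exists k, q ^+ k * modc (tau - 1) < d.
  have e0 : 0 < d / (modc (tau - 1) + 1).
    by rewrite divr_gt0//; have := modc_ge0 (tau - 1); lra.
  have : q ^+ n @[n --> \oo] --> 0 by apply: cvg_expr; rewrite ger0_norm// ltW.
  move=> /cvgr0_norm_lt /(_ _ e0) [n _ /(_ n (leqnn n))] /=.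
  have m0 := modc_ge0 (tau - 1).
  rewrite ger0_norm ?exprn_ge0 ?(ltW q0)// ltr_pdivlMr; last lra.
  by exists n; have := exprn_ge0 n (ltW q0); nra.
have [w [wk _ wq]] := step k.
by exists w, k; split => //; exact: le_lt_trans wq Hk.
Qed.

(** Stands in for [exp (z / alpha * log tau)]: a power of an affine function, whose zero leaves the
    disc once the root [w] of [tau] is within [modc alpha] of [1]. *)
Lemma nonvanishing_interpolation (tau alpha : Cx R) : tau != 0 -> alpha != 0 ->
  exists h : Cx R -> Cx R, [/\ forall z, derivable h z 1,
    (forall z, modc z < 1 -> h z != 0), h 0 = 1 & h alpha = tau].
Proof.
move=> t0 a0; have [|w [k [wk w1]]] := root_pow2_near1 t0 (_ : 0 < modc alpha).
  by rewrite modc_gt0.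
exists (fun z => (1 + (w - 1) / alpha * z) ^+ (2 ^ k)); split.
- move=> z; apply: derivable_exp; apply: derivable_add; first exact: derivable_cst.
  by apply: derivable_mul; [exact: derivable_cst|exact: derivable_id].
- move=> z z1; rewrite expf_eq0 negb_and; apply/orP; right.
  rewrite addr_eq0; apply/eqP => E.
  have : modc ((w - 1) / alpha * z) < 1.
    rewrite !modcM modcV -[ltRHS]mulr1; apply: ltr_pM; rewrite ?modc_ge0//.
      by rewrite mulr_ge0 ?invr_ge0 ?modc_ge0.
    by rewrite ltr_pdivrMr ?modc_gt0// mul1r.
  by rewrite -modcN -E modc1 ltxx.
- by rewrite mulr0 addr0 expr1n.
- by rewrite mulfVK// addrC subrK.
Qed.

(** In a triangular form of [M] only the diagonal decides invertibility: it is interpolated by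
    nonvanishing functions, the rest linearly. *)
Lemma unitmx_interpolation n' (M : 'M[Cx R]_n'.+1) (alpha : Cx R) :
  M \in unitmx -> alpha != 0 ->
  exists W : Cx R -> 'M[Cx R]_n'.+1, [/\ forall z, derivable W z 1,
    (forall z, modc z < 1 -> W z \in unitmx), W 0 = 1%:M & W alpha = M].
Proof.
move=> Mu a0; have [P [lam [bet [Pu PM _ _ _]]]] := similar_bidiag M.
set B0 := bidiag_mx lam bet in PM.
have B0E : B0 = P *m M *m invmx P by rewrite PM mulmxK.
have lam0 i : lam (i : 'I_n'.+1) != 0.
  have : B0 \in unitmx by rewrite B0E !unitmx_mul unitmx_inv Pu Mu.
  rewrite unitmxE -det_tr det_trig ?bidiag_mx_trig// unitfE prodf_seq_neq0.
  move=> /allP/(_ i (mem_index_enum _)) /=.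
  by rewrite !mxE eqxx mulr1n ltn_eqF// addr0.
have /choice[h hP] (i : 'I_n'.+1) := nonvanishing_interpolation (lam0 i) a0.
pose T z : 'M[Cx R]_n'.+1 := \matrix_(i, j) (h i z *+ (i == j) + (z / alpha * B0 i j) *+ (i != j)).
have Td z : derivable T z 1.
  apply/derivable_mxCx => i j.
  have -> : (fun x => T x i j) = if i == j then h i else (fun x => x / alpha * B0 i j).
    apply/funext => x; rewrite mxE; case: (i == j) => /=; first by rewrite addr0.
    by rewrite add0r.
  case: (i == j); first by have [hd _ _ _] := hP i; apply: hd.
  apply: derivable_mul; last exact: derivable_cst.
  by apply: derivable_mul; [exact: derivable_id|exact: derivable_cst].
exists (fun z => invmx P *m T z *m P); split.
- move=> z; apply: derivable_mulmx; last exact: derivable_cst.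
  by apply: derivable_mulmx; [exact: derivable_cst|exact: Td].
- move=> z z1; rewrite !unitmx_mul unitmx_inv Pu andbT /=.
  rewrite unitmxE -det_tr det_trig; last first.
    apply/is_trig_mxP => i j ij.
    have B0ji : B0 j i = 0.
      by have := is_trig_mxP (@bidiag_mx_trig _ n'.+1 lam bet) i j ij; rewrite mxE.
    by rewrite mxE mxE B0ji -val_eqE /= gtn_eqF// mulr0 mulr0n mul0rn addr0.
  rewrite unitfE prodf_seq_neq0; apply/allP => i _ /=.
  by rewrite !mxE eqxx mulr1n mulr0n addr0; have [_ + _ _] := hP i; apply.
- have -> : T 0 = 1%:M.
    apply/matrixP => i j; rewrite !mxE; have [_ _ -> _] := hP i.
    by rewrite !mul0r mul0rn addr0.
  by rewrite mulmx1 mulVmx.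
- have -> : T alpha = B0.
    apply/matrixP => i j; rewrite mxE; have [_ _ _ ->] := hP i.
    rewrite divff// mul1r; have [<-|ij] := eqVneq i j.
      by rewrite mulr1n mulr0n addr0 !mxE eqxx mulr1n ltn_eqF// addr0.
    by rewrite mulr0n mulr1n add0r.
  by rewrite B0E !mulmxA mulVmx// mul1mx mulmxKV.
Qed.

End MatrixCalculus.

Section Discs.
Context {R : realType} {n' : nat}.
Let n := n'.+1.
Implicit Types (A C : 'M[Cx R]_n) (alpha z : Cx R).

Definition spectral_disc A C alpha (f : Cx R -> 'M[Cx R]_n) :=
  [/\ holomorphic_on (@unit_disk R) f,
      (forall x, unit_disk x -> @spectral_ball R n (f x)), f 0 = A & f alpha = C].

Lemma spectral_ball_similar (A C X : 'M[Cx R]_n) :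
  X \in unitmx -> X *m A = C *m X -> spectral_ball C -> spectral_ball A.
Proof.
move=> Xu XA /spectral_ballP H; apply/spectral_ballP => // a.
by rewrite (char_poly_similar Xu XA); apply: H.
Qed.

(** Only the similarity classes at [0] and [alpha] matter: an invertible holomorphic [V] with
    [V 0 = X] and [V alpha = Y] corrects both values and preserves spectra. *)
Lemma conjugate_disc A C alpha (S : Cx R -> 'M[Cx R]_n) (X Y : 'M[Cx R]_n) :
  (forall z, modc z < 1 -> derivable S z 1) ->
  (forall z, modc z < 1 -> @spectral_ball R n (S z)) -> modc alpha < 1 -> alpha != 0 ->
  X \in unitmx -> S 0 *m X = X *m A -> Y \in unitmx -> S alpha *m Y = Y *m C ->
  exists f, spectral_disc A C alpha f.
Proof.
move=> Sd Sb a1 a0 Xu SX Yu SY.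
have [|W [Wd Wu W0 Wa]] := @unitmx_interpolation _ _ (invmx X *m Y) alpha _ a0.
  by rewrite unitmx_mul unitmx_inv Xu Yu.
pose V z := X *m W z.
have Vd z : derivable V z 1 by apply: derivable_mulmx (Wd z); exact: derivable_cst.
have Vu z : modc z < 1 -> V z \in unitmx by move=> z1; rewrite unitmx_mul Xu Wu.
have VE z : modc z < 1 -> (\det (V z))^-1 *: \adj (V z) = invmx (V z).
  by move=> z1; rewrite /invmx Vu.
have z01 : modc (0 : Cx R) < 1 by rewrite modc0.
have V0 : V 0 = X by rewrite /V W0 mulmx1.
have Va : V alpha = Y by rewrite /V Wa mulmxA mulmxV// mul1mx.
exists (fun z => (\det (V z))^-1 *: \adj (V z) *m S z *m V z); split.
- move=> z z1; apply: derivable_mulmx (Vd z); apply: derivable_mulmx (Sd z z1).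
  exact: derivable_adj_inv (Vd z) (Vu z z1).
- move=> z z1; rewrite VE//; apply: spectral_ball_similar (Vu z z1) _ (Sb z z1).
  by rewrite !mulmxA mulmxV ?Vu// mul1mx.
- by rewrite VE// V0 -mulmxA SX mulmxA mulVmx// mul1mx.
- by rewrite VE// Va -mulmxA SY mulmxA mulVmx// mul1mx.
Qed.

Lemma hessenberg_disc A C alpha (P : 'M[Cx R]_n) (lam : nat -> Cx R) (bet : nat -> nat)
    (G : nat -> Cx R -> Cx R) (v : 'rV[Cx R]_n) :
  P \in unitmx -> P *m C = bidiag_mx lam bet *m P -> bet n' = 0%N ->
  (forall i j, (i <= j < n)%N -> (bet j <= bet i)%N) ->
  row_cyclic A v -> modc alpha < 1 -> alpha != 0 ->
  (forall i z, modc z < 1 -> derivable (G i) z 1) ->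
  let p z := newton lam n - \sum_(i < n) ((z - alpha) ^+ (bet i).+1 * G i z) *: newton lam i in
  (forall z a, modc z < 1 -> root (p z) a -> modc a < 1) -> p 0 = char_poly A ->
  exists f, spectral_disc A C alpha f.
Proof.
move=> Pu PC b0 ble Av a1 a0 Gd p pr p0.
(* This factor makes the last row vanish at [alpha]; with the weight [t ^+ bet i] of
   [char_poly_hess] it accounts for the exponent [(bet i).+1]. *)
pose c z i := (z - alpha) * G i z.
pose S z : 'M[Cx R]_n := hess_mx lam bet (z - alpha) (c z).
have chS z : char_poly (S z) = p z.
  rewrite /p; have [zE|za] := eqVneq z alpha.
    have -> : S z = bidiag_mx lam bet.
      rewrite -(hess_mx0 lam ble) /S zE subrr; congr (hess_mx _ _ _ _).
      by apply/funext => i; rewrite /c subrr mul0r.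
    rewrite char_poly_bidiag zE subrr big1 ?subr0// => i _.
    by rewrite expr0n mul0r scale0r.
  rewrite char_poly_hess ?subr_eq0//; congr (_ - _); apply: eq_bigr => i _.
  by congr (_ *: _); rewrite /c exprS; set x := _ ^+ bet i; ring.
have Sd z : modc z < 1 -> derivable S z 1.
  move=> z1; apply/derivable_mxCx => i j.
  have td : derivable (fun x : Cx R => x - alpha) z 1.
    by apply: derivable_sub; [exact: derivable_id|exact: derivable_cst].
  have -> : (fun x => S x i j) = (fun x => (lam i *+ (i == j) +
      (x - alpha) ^+ (bet i - bet j) * (j == i.+1 :> nat)%:R) +
      ((x - alpha) * G j x) * (i == n' :> nat)%:R).
    by apply/funext => x; rewrite mxE !mulr_natr.
  apply: derivable_add.
    apply: derivable_add; first exact: derivable_cst.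
    by apply: derivable_mul; [exact: derivable_exp|exact: derivable_cst].
  apply: derivable_mul; last exact: derivable_cst.
  by apply: (derivable_mul td); exact: Gd.
have t0 : 0 - alpha != 0 by rewrite sub0r oppr_eq0.
have chA : char_poly A = char_poly (S 0) by rewrite chS p0.
have Scyc := @hess_row_cyclic _ _ lam bet ble b0 (0 - alpha) (c 0) t0.
have [X Xu SX] := row_cyclic_similar Av Scyc chA.
apply: (conjugate_disc (S := S) (X := X) (Y := P)) => //.
  move=> z z1; apply/spectral_ballP => // a; rewrite chS; exact: pr.
rewrite PC -(hess_mx0 lam ble); congr (_ *m _).
rewrite /S subrr; congr (hess_mx _ _ _ _).
by apply/funext => i; rewrite /c subrr mul0r.
Qed.

Lemma moebius_lt1 (a x : Cx R) : modc a < 1 -> modc x < 1 ->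
  1 + (a^*)%C * x != 0 /\ modc ((a + x) / (1 + (a^*)%C * x)) < 1.
Proof.
move=> a1 x1.
have K : modc (a + x) ^+ 2 < modc (1 + (a^*)%C * x) ^+ 2.
  have : 0 < (1 - modc a ^+ 2) * (1 - modc x ^+ 2).
    by rewrite mulr_gt0// subr_gt0 exprn_ilt1// modc_ge0.
  rewrite !modc_sqr; case: (a) => p q; case: (x) => r s /=; nra.
have d0 : 1 + (a^*)%C * x != 0.
  apply: contraTneq K => ->; rewrite modc0 expr0n /= -leNgt.
  by rewrite exprn_ge0// modc_ge0.
split => //; rewrite modcf ltr_pdivrMr ?modc_gt0// mul1r.
by rewrite -(@ltr_pXn2r _ 2) ?nnegrE ?modc_ge0.
Qed.

(** The bound [m] is the pseudohyperbolic distance from [a] to [c]; the interpolant is the disc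
    automorphism sending [0] to [a], composed with a multiplication by some [k] with
    [modc k <= 1]. *)
Lemma moebius_disc (a c : Cx R) : modc a < 1 -> modc c < 1 ->
  exists2 m : R, m < 1 & forall alpha, m <= modc alpha -> alpha != 0 ->
    exists h : Cx R -> Cx R, [/\ forall z, modc z < 1 -> derivable h z 1,
      forall z, modc z < 1 -> modc (h z) < 1, h 0 = a & h alpha = c].
Proof.
move=> a1 c1; have Na1 : modc (- a) < 1 by rewrite modcN.
have conjN : ((- a)^*)%C = - (a^*)%C :> Cx R by rewrite rmorphN.
have [d0 m1] := moebius_lt1 Na1 c1; rewrite conjN in d0 m1.
set mu := (- a + c) / (1 + - (a^*)%C * c) in m1.
exists (modc mu) => // alpha ma a0.
pose k := mu / alpha.
have k1 : modc k <= 1 by rewrite modcf ler_pdivrMr ?modc_gt0// mul1r.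
have kz z : modc z < 1 -> modc (k * z) < 1.
  by move=> z1; rewrite modcM; apply: le_lt_trans z1; rewrite ler_piMl ?modc_ge0.
exists (fun z => (a + k * z) / (1 + (a^*)%C * (k * z))); split.
- move=> z z1; have kd : derivable (fun x : Cx R => k * x) z 1.
    by apply: derivable_mul; [exact: derivable_cst|exact: derivable_id].
  apply: derivable_mul.
    by apply: (derivable_add _ kd); exact: derivable_cst.
  apply: derivable_inv; first by have [] := moebius_lt1 a1 (kz z z1).
  apply: derivable_add; first exact: derivable_cst.
  by apply: (derivable_mul _ kd); exact: derivable_cst.
- by move=> z z1; have [] := moebius_lt1 a1 (kz z z1).
- by rewrite !mulr0 !addr0 divr1.
- rewrite /k mulfVK// /mu.
  have m1' : modc mu < 1 := m1.
  have [dd _] := moebius_lt1 a1 m1'.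
  apply: (mulIf dd); rewrite mulfVK// /mu; field.
  exact: d0.
Qed.

(** Ensures that the infimum in [lempert] is over a nonempty set. Both matrices are triangularised;
    the eigenvalues are joined by Moebius maps at one common [alpha], large enough for all pairs,
    and the other entries linearly. *)
Lemma spectral_disc_exists A C : spectral_ball A -> spectral_ball C ->
  exists alpha f, [/\ alpha != 0, modc alpha < 1 & spectral_disc A C alpha f].
Proof.
move=> /spectral_ballP Ab /spectral_ballP Cb.
have [P [lam [bet [Pu PA _ _ _]]]] := similar_bidiag A.
have [Q [mu [bet' [Qu QC _ _ _]]]] := similar_bidiag C.
have lam1 (i : 'I_n) : modc (lam i) < 1.
  apply: Ab => //; rewrite (char_poly_similar Pu PA) char_poly_bidiag /root horner_prod.
  by rewrite (bigD1 i)//= hornerXsubC subrr mul0r.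
have mu1 (i : 'I_n) : modc (mu i) < 1.
  apply: Cb => //; rewrite (char_poly_similar Qu QC) char_poly_bidiag /root horner_prod.
  by rewrite (bigD1 i)//= hornerXsubC subrr mul0r.
have /choice[m mP] : forall i : 'I_n, exists m : R, m < 1 /\
    forall alpha, m <= modc alpha -> alpha != 0 ->
    exists h : Cx R -> Cx R, [/\ forall z, modc z < 1 -> derivable h z 1,
      forall z, modc z < 1 -> modc (h z) < 1, h 0 = lam i & h alpha = mu i].
  by move=> i; have [m m1 mP] := moebius_disc (lam1 i) (mu1 i); exists m.
pose r := \big[Num.max/2^-1]_(i < n) m i.
have r1 : r < 1.
  by apply: bigmax_lt => [|i _]; [rewrite invf_lt1; lra|have [] := mP i].
have r2 : 2^-1 <= r by exact: bigmax_ge_id.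
have r0 : 0 < r by apply: lt_le_trans r2; rewrite invr_gt0.
pose alpha := cplx r.
have ma : modc alpha = r by rewrite cplx_modc gtr0_norm.
have a0 : alpha != 0 by rewrite -modc_gt0 ma.
have /choice[h hP] : forall i : 'I_n, exists h : Cx R -> Cx R,
   [/\ forall z, modc z < 1 -> derivable h z 1,
      forall z, modc z < 1 -> modc (h z) < 1, h 0 = lam i & h alpha = mu i].
  by move=> i; have [_] := mP i; apply => //; rewrite ma; exact: le_bigmax.
pose T z : 'M[Cx R]_n := \matrix_(i, j) (if i == j then h i z else
  (1 - z / alpha) * bidiag_mx lam bet i j + z / alpha * bidiag_mx mu bet' i j).
exists alpha; suff [f fP] : exists f, spectral_disc A C alpha f.
  by exists f; split => //; rewrite ma.
apply: (conjugate_disc (S := T) (X := P) (Y := Q)) => //.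
- move=> z z1; apply/derivable_mxCx => i j.
  have -> : (fun x => T x i j) = if i == j then h i else
     (fun x => (1 - x / alpha) * bidiag_mx lam bet i j + x / alpha * bidiag_mx mu bet' i j).
    by apply/funext => x; rewrite mxE; case: (i == j).
  case: (i == j); first by have [hd _ _ _] := hP i; apply: hd.
  have zd : derivable (fun x : Cx R => x / alpha) z 1.
    by apply: derivable_mul; [exact: derivable_id|exact: derivable_cst].
  apply: derivable_add.
    apply: derivable_mul; last exact: derivable_cst.
    by apply: (derivable_sub _ zd); exact: derivable_cst.
  by apply: (derivable_mul zd); exact: derivable_cst.
- move=> z z1; apply/spectral_ballP => // a.
  have -> : char_poly (T z) = \prod_(i < n) ('X - (h i z)%:P).
    rewrite /char_poly -det_tr det_trig.
      by apply: eq_bigr => i _; rewrite !mxE eqxx.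
    apply/is_trig_mxP => i j ij.
    have tr lam' bet'' : bidiag_mx lam' bet'' j i = 0 :> Cx R.
      by have := is_trig_mxP (@bidiag_mx_trig _ n lam' bet'') i j ij; rewrite mxE.
    have Tji : T z j i = 0 by rewrite mxE -val_eqE /= gtn_eqF// !tr !mulr0 addr0.
    rewrite mxE [LHS]mxE [X in X + _]mxE [X in _ + X]mxE [X in - X]mxE Tji.
    by rewrite -val_eqE /= gtn_eqF// mulr0n polyC0 subr0.
  rewrite /root horner_prod prodf_seq_eq0 => /hasP[i _ /=].
  rewrite hornerXsubC subr_eq0 => /eqP ->; have [_ + _ _] := hP i; exact.
- by rewrite ma.
- rewrite PA; congr (_ *m _); apply/matrixP => i j; rewrite mxE mul0r subr0 mul1r mul0r addr0.
  by case: eqP => // <-; have [_ _ -> _] := hP i; rewrite mxE eqxx ltn_eqF// addr0.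
- rewrite QC; congr (_ *m _); apply/matrixP => i j.
  rewrite mxE divff// subrr mul0r add0r mul1r.
  by case: eqP => // <-; have [_ _ _ ->] := hP i; rewrite mxE eqxx ltn_eqF// addr0.
Qed.

End Discs.

(** * Roots in families of polynomials *)

Section CharPolyFamilies.
Context {R : realType}.
Implicit Types (P Q : Cx R -> {poly Cx R}) (z w : Cx R).

Definition coef_derivable P z := forall k, derivable (fun x => (P x)`_k) z 1.

Lemma coef_derivable_cst (p : {poly Cx R}) z : coef_derivable (fun=> p) z.
Proof. by move=> k; exact: derivable_cst. Qed.

Lemma coef_derivableM P Q z : coef_derivable P z -> coef_derivable Q z ->
  coef_derivable (fun x => P x * Q x) z.
Proof.
move=> Pd Qd k; under eq_fun do rewrite coefM.
by apply: derivable_bigsum => j _; apply: derivable_mul.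
Qed.

Lemma coef_derivable_sum I (s : seq I) (P : I -> Cx R -> {poly Cx R}) z :
  (forall i, coef_derivable (P i) z) -> coef_derivable (fun x => \sum_(i <- s) P i x) z.
Proof.
move=> Pd k; under eq_fun do rewrite coef_sum.
by apply: derivable_bigsum => i _; exact: Pd.
Qed.

Lemma coef_derivable_prod I (s : seq I) (P : I -> Cx R -> {poly Cx R}) z :
  (forall i, coef_derivable (P i) z) -> coef_derivable (fun x => \prod_(i <- s) P i x) z.
Proof.
move=> Pd; elim: s => [|i s IH].
  have -> : (fun x => \prod_(i <- [::]) P i x) = (fun=> 1) by apply/funext => x; rewrite big_nil.
  exact: coef_derivable_cst.
have -> : (fun x => \prod_(j <- i :: s) P j x) = (fun x => P i x * \prod_(j <- s) P j x).
  by apply/funext => x; rewrite big_cons.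
exact: (coef_derivableM (Pd i) IH).
Qed.

Lemma coef_derivable_char_poly n (f : Cx R -> 'M[Cx R]_n) z : derivable f z 1 ->
  coef_derivable (fun x => char_poly (f x)) z.
Proof.
move=> /derivable_mxCx fd; apply: coef_derivable_sum => s.
apply: coef_derivableM; first exact: coef_derivable_cst.
apply: coef_derivable_prod => i k.
have -> : (fun x => (char_poly_mx (f x) i (s i))`_k) =
  (fun x => ('X *+ (i == s i) : {poly Cx R})`_k - f x i (s i) * (k == 0%N)%:R).
  apply/funext => x; rewrite !mxE coefB coefC; congr (_ - _).
  by case: eqP => _; rewrite ?mulr1 ?mulr0.
apply: derivable_sub; first exact: derivable_cst.
by apply: (derivable_mul (fd _ _)); exact: derivable_cst.
Qed.

Lemma derivable_ncoef (lam : nat -> Cx R) i N P z : (forall x, (size (P x) <= N)%N) ->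
  coef_derivable P z -> derivable (fun x => ncoef lam i (P x)) z 1.
Proof.
move=> sP Pd; have -> : (fun x => ncoef lam i (P x)) =
    (fun x => \sum_(k < N) (P x)`_k * ncoef lam i 'X^k).
  by apply/funext => x; exact: ncoef_coef.
apply: derivable_bigsum => k _.
by apply: (derivable_mul (Pd k)); exact: derivable_cst.
Qed.

Lemma deriv_prod_XsubC (s : seq (Cx R)) w : (forall x, x \in s -> w != x) ->
  (\prod_(x <- s) ('X - x%:P))^`().[w] =
  (\prod_(x <- s) ('X - x%:P)).[w] * \sum_(x <- s) (w - x)^-1.
Proof.
elim: s => [|x s IH] ws; first by rewrite !big_nil derivC horner0 mulr0.
have wx : w - x != 0 by rewrite subr_eq0 ws// mem_head.
rewrite !big_cons derivM derivXsubC mul1r hornerD !hornerM IH; last first.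
  by move=> y ys; rewrite ws// in_cons ys orbT.
by rewrite hornerXsubC; field.
Qed.

(* For [w] on the unit circle, [x |-> w / (w - x)] maps the unit disc to [Re > 1 / 2]. *)
Lemma Re_half_plane w x : modc w = 1 -> w != x ->
  complex.Re (w / (w - x) - 1 / 2) = (1 - modc x ^+ 2) / (2 * modc (w - x) ^+ 2).
Proof.
move=> w1 wx; have wx0 : w - x != 0 by rewrite subr_eq0.
have wc0 : ((w - x)^*)%C != 0 :> Cx R by rewrite fmorph_eq0.
have d0 : modc (w - x) ^+ 2 != 0 by rewrite expf_eq0 /= modc_eq0.
have -> : w / (w - x) = cplx (modc (w - x) ^+ 2)^-1 * (w * ((w - x)^*)%C).
  by rewrite fmorphV /= -mul_conjc invfM mulrACA mulVf// mulr1 mulrC.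
move: w1 d0 {wx wx0 wc0}; case: w => a b; case: x => c d; rewrite !modc_sqr /=.
move=> w1; have {w1} : a ^+ 2 + b ^+ 2 = 1.
  by have := modc_sqr (a +i* b)%C; rewrite w1 expr1n.
move=> ab D0.
have -> : 1 - (c ^+ 2 + d ^+ 2) =
    2 * (a * (a - c) - b * - (b - d)) - ((a - c) ^+ 2 + (b - d) ^+ 2) by lra.
by field.
Qed.

Lemma Re_sum I (s : seq I) (F : I -> Cx R) :
  complex.Re (\sum_(i <- s) F i) = \sum_(i <- s) complex.Re (F i).
Proof.
elim: s => [|i s IH]; first by rewrite !big_nil.
by rewrite !big_cons -IH; case: (F i) => a b; case: (\sum_(_ <- s) _).
Qed.

(** For [w] on the unit circle, the half-plane terms summed over the roots form a holomorphic
    function of nonnegative real part, at most [n%:R / (1 - rho)] at [0]. Harnack bounds it at [z],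
    where for [w = a / cplx (modc a)] the term of the root [a] alone is at least
    [1 / (2 * (1 - modc a))]. The resulting [tau] is common to all families [P]. *)
Lemma root_modulus_bound n (rho s : R) : (0 < n)%N -> rho < 1 -> 0 <= s < 1 ->
  exists2 tau, tau < 1 & forall P : Cx R -> {poly Cx R},
    (forall z, P z \is monic) -> (forall z, size (P z) = n.+1) ->
    (forall z, modc z < 1 -> coef_derivable P z) ->
    (forall z a, modc z < 1 -> root (P z) a -> modc a < 1) ->
    (forall a, root (P 0) a -> modc a <= rho) ->
    forall z a, modc z <= s -> root (P z) a -> modc a <= tau.
Proof.
move=> n0 rho1 /andP[s0 s1].
pose r := (1 + s) / 2; pose K := (r + s) / (r - s) * (n%:R / (1 - rho)).
have rs : s < r by rewrite /r; lra.
have r1 : r < 1 by rewrite /r; lra.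
have K0 : 0 < K by rewrite !mulr_gt0 ?invr_gt0 ?ltr0n//; lra.
exists (Num.max 0 (1 - (2 * K)^-1)).
  by rewrite gt_max ltr01 /= ltrBlDr ltrDl invr_gt0 mulr_gt0.
move=> P Pm Ps Pd Pr P0 z a zs Pza.
rewrite le_max; have [->|a0] := eqVneq a 0; first by rewrite modc0 lexx.
apply/orP; right.
have z1 : modc z < 1 by exact: le_lt_trans zs s1.
have ma0 : 0 < modc a by rewrite modc_gt0.
pose w := a / cplx (modc a).
have ca0 : cplx (modc a) != 0 by rewrite -modc_gt0 cplx_modc normr_gt0 gt_eqF.
have w1 : modc w = 1 by rewrite modcf cplx_modc gtr0_norm// divff// gt_eqF.
(* Written through the logarithmic derivative, the sum is rational in the coefficients, hence
   derivable without following individual roots. *)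
pose g x := w * (P x)^`().[w] / (P x).[w] - n%:R / 2.
have rootsP x : exists2 l, size l = n & P x = \prod_(y <- l) ('X - y%:P).
  have [l lE] := closed_field_poly_normal (P x).
  rewrite (monicP (Pm x)) scale1r in lE; exists l => //.
  by apply/eqP; rewrite -eqSS -(Ps x) lE size_prod_XsubC.
have wroot x y : modc x < 1 -> root (P x) y -> w != y.
  by move=> x1 /(Pr _ _ x1); apply: contraTneq => <-; rewrite w1 ltxx.
have gE x l : modc x < 1 -> size l = n -> P x = \prod_(y <- l) ('X - y%:P) ->
    g x = \sum_(y <- l) (w / (w - y) - 1 / 2).
  move=> x1 ln lE.
  have wl y : y \in l -> w != y.
    by move=> yl; apply: (wroot x) => //; rewrite lE root_prod_XsubC.
  have Pw0 : (P x).[w] != 0.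
    by rewrite lE; apply/negP; rewrite -/(root _ w) root_prod_XsubC => /wl; rewrite eqxx.
  rewrite /g [in (_)^`()]lE deriv_prod_XsubC// -lE mulrCA mulrAC divff// mul1r sumrB.
  rewrite mulr_sumr; congr (_ - _).
  - by rewrite mul1r.
  - by rewrite -ln -sum1_size natr_sum mulr_suml; apply: eq_bigr => y _; rewrite mul1r.
have gRe x l : modc x < 1 -> size l = n -> P x = \prod_(y <- l) ('X - y%:P) ->
    complex.Re (g x) = \sum_(y <- l) (1 - modc y ^+ 2) / (2 * modc (w - y) ^+ 2).
  move=> x1 ln lE; rewrite (gE x l)// Re_sum !big_seq; apply: eq_bigr => y yl.
  by apply: Re_half_plane => //; apply: (wroot x) => //; rewrite lE root_prod_XsubC.
have term_ge0 x l y : modc x < 1 -> P x = \prod_(y <- l) ('X - y%:P) -> y \in l ->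
    0 <= (1 - modc y ^+ 2) / (2 * modc (w - y) ^+ 2).
  move=> x1 lE yl; apply: divr_ge0; last by rewrite mulr_ge0// exprn_ge0// modc_ge0.
  have y1 : modc y < 1 by apply: (Pr x) => //; rewrite lE root_prod_XsubC.
  by rewrite subr_ge0 exprn_ile1 ?modc_ge0 ?(ltW y1).
have gge0 x : modc x < 1 -> 0 <= complex.Re (g x).
  move=> x1; have [l ln lE] := rootsP x; rewrite (gRe x l)// big_seq.
  by apply: sumr_ge0 => y yl; exact: term_ge0 lE yl.
have gd x : modc x < 1 -> derivable g x 1.
  move=> x1.
  have Pwd : derivable (fun x => (P x).[w]) x 1.
    have -> : (fun x => (P x).[w]) = (fun x => \sum_(k < n.+1) (P x)`_k * w ^+ k).
      by apply/funext => y; rewrite horner_coef Ps.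
    by apply: derivable_bigsum => k _; apply: (derivable_mul (Pd x x1 k)); exact: derivable_cst.
  have Pdwd : derivable (fun x => (P x)^`().[w]) x 1.
    have -> : (fun x => (P x)^`().[w]) =
        (fun x => \sum_(k < n.+1) (P x)`_k.+1 * (k.+1%:R * w ^+ k)).
      apply/funext => y; rewrite (@horner_coef_wide _ n.+1).
        by apply: eq_bigr => k _; rewrite coef_deriv mulrA mulr_natr.
      by rewrite ltnW// -(Ps y) lt_size_deriv// monic_neq0.
    by apply: derivable_bigsum => k _; apply: (derivable_mul (Pd x x1 k.+1)); exact: derivable_cst.
  apply: derivable_sub; last exact: derivable_cst.
  apply: derivable_mul.
    by apply: (derivable_mul _ Pdwd); exact: derivable_cst.
  apply: (derivable_inv _ Pwd).
  by apply/negP => Pw0; have := wroot x w x1 Pw0; rewrite eqxx.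
have zr : modc z < r by exact: le_lt_trans zs rs.
have H := harnack gd gge0 r1 zr.
have g0 : complex.Re (g 0) <= n%:R / (1 - rho).
  have [l ln lE] := rootsP 0; rewrite (gRe 0 l)//; last by rewrite modc0.
  rewrite -ln -sum1_size natr_sum mulr_suml !big_seq; apply: ler_sum => y yl.
  have yr : modc y <= rho by apply: P0; rewrite lE root_prod_XsubC.
  have wy : 1 - modc y <= modc (w - y) by rewrite -w1; exact: modcDB.
  have y0 := modc_ge0 y.
  have wy0 : 0 < modc (w - y) by apply: lt_le_trans wy; lra.
  rewrite mul1r ler_pdivrMr; last by rewrite mulr_gt0// exprn_gt0.
  have : (1 - modc y) ^+ 2 <= modc (w - y) ^+ 2 by rewrite lerXn2r ?nnegrE; lra.
  move=> h; apply: (@le_trans _ _ ((1 - rho)^-1 * (2 * (1 - modc y) ^+ 2))); last first.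
    by rewrite ler_wpM2l ?invr_ge0; lra.
  rewrite mulrC ler_pdivlMr; last lra.
  have h1 : 0 <= (1 - modc y ^+ 2) * (rho - modc y).
    by rewrite mulr_ge0 ?subr_ge0// exprn_ile1//; lra.
  have h2 : 0 <= (1 - modc y) ^+ 2 * (1 - modc y) by rewrite mulr_ge0 ?exprn_ge0//; lra.
  lra.
have [l ln lE] := rootsP z.
have al : a \in l by rewrite -root_prod_XsubC -lE.
have a1 : modc a < 1 by exact: Pr Pza.
have ga : (1 - modc a ^+ 2) / (2 * modc (w - a) ^+ 2) <= complex.Re (g z).
  rewrite (gRe z l)// (big_rem a)//= lerDl big_seq; apply: sumr_ge0 => y yl.
  by apply: (term_ge0 z l) => //; exact: mem_rem yl.
have wa : modc (w - a) = 1 - modc a.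
  have -> : w - a = w * cplx (1 - modc a).
    by rewrite rmorphB rmorph1 mulrBr mulr1 /w mulfVK.
  by rewrite modcM w1 mul1r cplx_modc ger0_norm//; lra.
have gK : complex.Re (g z) <= K.
  apply: le_trans H _; rewrite /K; apply: ler_pM.
  - by apply: divr_ge0; have := modc_ge0 z; lra.
  - by apply: gge0; rewrite modc0.
  - have D1 : 0 < r - modc z by lra.
    have D2 : 0 < r - s by lra.
    have z0 := modc_ge0 z.
    by apply: ler_pM; rewrite ?invr_ge0 ?lef_pV2 ?posrE//; lra.
  - exact: g0.
have : (2 * (1 - modc a))^-1 <= K.
  apply: le_trans (le_trans ga gK); rewrite wa.
  have A0 : 0 < 1 - modc a by lra.
  have -> : (1 - modc a ^+ 2) / (2 * (1 - modc a) ^+ 2) = (1 + modc a) * (2 * (1 - modc a))^-1.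
    by field; rewrite gt_eqF.
  by rewrite ler_peMl ?invr_ge0//; lra.
have A0 : 0 < 1 - modc a by lra.
have B0 : 0 < 2 * (1 - modc a) by lra.
move=> h; have : K^-1 <= 2 * (1 - modc a).
  rewrite -[K^-1]mul1r ler_pdivrMr// mulrC -ler_pdivrMr// mul1r; exact: h.
by rewrite (@invfM _ 2 K); set k := K^-1 => hk; lra.
Qed.

End CharPolyFamilies.

(** * Divisibility of the Newton coefficients along a disc *)

Section DiscCoefficients.
Context {R : realType}.
Implicit Types (F : Cx R -> Cx R) (alpha z : Cx R).

(** Continuity gives [F alpha = 0], and division by [z - alpha] lowers the exponent in the bound by
    one. Excluding [z = alpha] lets the bound survive the division. *)
Lemma power_series_divide_exp a (K : R) F alpha d (C delta : R) :
  power_series a K F -> modc alpha < 1 -> 0 < delta ->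
  (forall z, modc z < 1 -> z != alpha -> modc (z - alpha) < delta ->
    modc (F z) <= C * modc (z - alpha) ^+ d) ->
  exists b G, power_series b (K / (1 - modc alpha) ^+ d) G /\
    forall z, modc z < 1 -> F z = (z - alpha) ^+ d * G z.
Proof.
move=> + al1 delta0; elim: d a K F => [|d IH] a K F aF FC.
  by exists a, F; rewrite expr0 divr1; split=> // z _; rewrite mul1r.
have Fal : F alpha = 0.
  apply/eqP; rewrite -modc_eq0 eq_le modc_ge0 andbT; apply/ler_addgt0Pl => e e0.
  rewrite addr0.
  have e2 : 0 < e / 2 by lra.
  have [d2 d20 H2] := (nbhsCxP _ _).1 ((cvgCxP _ _ _).1 (power_series_continuous aF al1) _ e2).
  pose m := Num.min (Num.min (Num.min delta (1 - modc alpha)) d2) (Num.min 1 (e / 2 / (`|C| + 1))).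
  have C1 : 0 < `|C| + 1 by rewrite ltr_wpDl.
  have m0 : 0 < m by rewrite !lt_min delta0 d20 ltr01 !divr_gt0// andbT/=; lra.
  pose h := m / 2.
  have h0 : 0 < h by rewrite divr_gt0.
  have : h < m by rewrite /h; lra.
  rewrite !lt_min => /andP[/andP[/andP[hd hal] hd2] /andP[h1 he]].
  have xh : modc (alpha + cplx h - alpha) = h by rewrite addrAC subrr add0r cplx_modc gtr0_norm.
  have x1 : modc (alpha + cplx h) < 1.
    by have := modcD alpha (cplx h); rewrite cplx_modc gtr0_norm//; lra.
  have /(FC _ x1) : alpha + cplx h != alpha.
    by rewrite -subr_eq0 -modc_eq0 xh gt_eqF.
  rewrite xh => /(_ hd) Fx.
  have Fy := H2 (alpha + cplx h) (etrans (congr1 (fun x => x < d2) xh) hd2).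
  have : C * h ^+ d.+1 <= e / 2.
    apply: (@le_trans _ _ (`|C| * h)).
      apply: (@le_trans _ _ (`|C| * h ^+ d.+1)).
        by rewrite ler_wpM2r ?ler_norm// exprn_ge0// ltW.
      by rewrite ler_wpM2l// exprS ger_pMr// exprn_ile1// ltW.
    move: he; rewrite ltr_pdivlMr// => he.
    apply: le_trans (ltW he); rewrite mulrC ler_wpM2l ?(ltW h0)//; lra.
  have := modcDB (F alpha) (F (alpha + cplx h)).
  by rewrite modcB; lra.
have [b [G [bG FG]]] := power_series_divide aF al1.
have GC z : modc z < 1 -> z != alpha -> modc (z - alpha) < delta ->
    modc (G z) <= C * modc (z - alpha) ^+ d.
  move=> z1 zal zd.
  have zp : 0 < modc (z - alpha) by rewrite modc_gt0 subr_eq0.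
  by have := FC z z1 zal zd; rewrite (FG z z1) Fal add0r modcM exprS mulrCA ler_pM2l.
have [b' [G' [bG' GG']]] := IH b _ G bG GC.
exists b', G'; split; first by rewrite exprS invfM mulrA.
by move=> z z1; rewrite FG// Fal add0r GG'// exprS mulrA.
Qed.

Lemma derivable_lipschitz_near F z : derivable F z 1 ->
  exists2 L : R, 0 <= L & \forall x \near z, modc (F x - F z) <= L * modc (x - z).
Proof.
move=> /derivableCxP[D /(_ 1 ltr01)[d d0 H]].
exists (1 + modc D); first by have := modc_ge0 D; lra.
apply/nbhsCxP; exists d => // x xd; have := H x xd; have := modcDB (F x - F z) (D * (x - z)).
by rewrite modcM; lra.
Qed.

Lemma derivable_mx_lipschitz_near m n (f : Cx R -> 'M[Cx R]_(m, n)) z : derivable f z 1 ->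
  exists2 L : R, 0 <= L &
    \forall x \near z, forall i j, modc (f x i j - f z i j) <= L * modc (x - z).
Proof.
move=> /derivable_mxCx fd.
have /choice[L LP] : forall ij : 'I_m * 'I_n, exists L : R, 0 <= L /\
    \forall x \near z, modc (f x ij.1 ij.2 - f z ij.1 ij.2) <= L * modc (x - z).
  by move=> [i j]; have [L L0 H] := derivable_lipschitz_near (fd i j); exists L.
exists (\sum_ij L ij); first by apply: sumr_ge0 => ij _; case: (LP ij).
have H : \forall x \near z, forall ij : 'I_m * 'I_n,
    modc (f x ij.1 ij.2 - f z ij.1 ij.2) <= L ij * modc (x - z).
  by apply: (filter_forall (nbhs_filter z)) => ij; case: (LP ij).
move: H; apply: filterS => x H i j; apply: le_trans (H (i, j)) _.
rewrite ler_wpM2r ?modc_ge0// (bigD1 (i, j))//= lerDl.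
by apply: sumr_ge0 => ij _; case: (LP ij).
Qed.

Variables (n' : nat).
Let n := n'.+1.

(* The vanishing of the Newton coefficients at [alpha] is the necessary condition, the one
   [hessenberg_disc] shows to be sufficient. *)
Lemma spectral_disc_ncoef (C P : 'M[Cx R]_n) (lam : nat -> Cx R) (bet : nat -> nat) (i : 'I_n) :
  P \in unitmx -> P *m C = bidiag_mx lam bet *m P ->
  (forall i j, (i <= j < n)%N -> (bet j <= bet i)%N) ->
  (forall b, \prod_(i < n | bet i == b.+1) ('X - (lam i)%:P) %|
      \prod_(i < n | bet i == b) ('X - (lam i)%:P)) ->
  exists M : R, forall A alpha f, modc alpha < 1 -> spectral_disc A C alpha f ->
    exists b G, power_series b (M / (1 - modc alpha) ^+ (bet i).+1) G /\
      forall z, modc z < 1 ->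
        ncoef lam i (char_poly (f z)) = (z - alpha) ^+ (bet i).+1 * G z.
Proof.
move=> Pu PC bet_le bdvd.
have [K K0 KP] := ncoef_le_pnorm lam i n.+1.
have [K1 K10 K1P] := ncoef_char_poly_near bet_le bdvd i.
(* A monic polynomial of degree [n] with roots in the unit disc has [pnorm] at most [2 ^+ n], so the
   bound depends neither on [A] nor on the disc. *)
exists (K * 2 ^+ n) => A alpha f al1 [fh fb _ fal].
have FM z : modc z < 1 -> modc (ncoef lam i (char_poly (f z))) <= K * 2 ^+ n.
  move=> z1; apply: le_trans (KP _ _) _; first by rewrite size_char_poly.
  rewrite ler_wpM2l//; have /(spectral_ballP _ (ltn0Sn n')) fz := fb z z1.
  have [s sE] := closed_field_poly_normal (char_poly (f z)).
  rewrite (monicP (char_poly_monic _)) scale1r in sE.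
  have <- : size s = n.
    by apply/eqP; rewrite -eqSS -(size_char_poly (f z)) sE size_prod_XsubC.
  rewrite sE; apply: pnorm_prod_XsubC_le => y ys; apply/ltW/fz.
  by rewrite sE root_prod_XsubC.
have Fd z : modc z < 1 -> derivable (fun z => ncoef lam i (char_poly (f z))) z 1.
  move=> z1; apply: (@derivable_ncoef _ lam i n.+1 (fun x => char_poly (f x)) z).
    by move=> x; rewrite size_char_poly.
  exact/coef_derivable_char_poly/fh.
have [a aF] := power_series_expand Fd FM.
pose D z := P *m (f z - C) *m invmx P.
have Dd : derivable D alpha 1.
  apply: derivable_mulmx; last exact: derivable_cst.
  apply: derivable_mulmx; first exact: derivable_cst.
  by apply: derivableB; [exact: fh|exact: derivable_cst].
have charD z : char_poly (f z) = char_poly (bidiag_mx lam bet + D z).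
  apply: (char_poly_similar Pu).
  by rewrite mulmxDl /D mulmxKV// mulmxBr -PC addrC subrK.
have [L L0 /nbhsCxP[d d0 LD]] := derivable_mx_lipschitz_near Dd.
have D0 j k : D alpha j k = 0 by rewrite /D fal subrr mulmx0 mul0mx mxE.
(* Ensures [L * modc (z - alpha) <= 1], the range of perturbations in [ncoef_char_poly_near]. *)
pose delta := Num.min d (L + 1)^-1.
have L1 : 0 < L + 1 by lra.
have delta0 : 0 < delta by rewrite lt_min d0 invr_gt0.
apply: (power_series_divide_exp (C := K1 * L ^+ (bet i).+1) aF al1 delta0) => z z1 zal.
rewrite lt_min => /andP[zd zL]; rewrite charD -mulrA -exprMn.
have z0 := modc_ge0 (z - alpha).
apply: K1P => [|j k]; last by have := LD z zd j k; rewrite D0 subr0.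
rewrite mulr_ge0//=; move: zL; rewrite -[X in _ < X]mul1r ltr_pdivlMr//; lra.
Qed.

End DiscCoefficients.

(** * Semicontinuity *)

Section CharPolyLimits.
Context {R : realType}.

Lemma cvg_bigprodCx T (F : set_system T) (FF : Filter F) I (s : seq I) (u : I -> T -> Cx R)
    (l : I -> Cx R) : (forall i, u i @ F --> l i) ->
  (fun t => \prod_(i <- s) u i t) @ F --> \prod_(i <- s) l i.
Proof.
move=> ul; elim: s => [|i s IH].
  by under eq_fun do rewrite big_nil; rewrite big_nil; exact: cvg_cst.
under eq_fun do rewrite big_cons; rewrite big_cons; exact: cvgM (ul i) IH.
Qed.

Lemma cvg_det T (F : set_system T) (FF : Filter F) n (M : T -> 'M[Cx R]_n) (L : 'M[Cx R]_n) :
  (forall i j, (fun t => M t i j) @ F --> L i j) -> (fun t => \det (M t)) @ F --> \det L.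
Proof.
move=> ML; apply: cvg_bigsumCx => s; apply: cvgM; first exact: cvg_cst.
by apply: cvg_bigprodCx => i; exact: ML.
Qed.

Lemma horner_char_poly n (M : 'M[Cx R]_n) x : (char_poly M).[x] = \det (x%:M - M).
Proof.
rewrite -horner_evalE -det_map_mx; congr (\det _); apply/matrixP => i j.
by rewrite !mxE /= ?horner_evalE hornerD hornerN hornerC hornerMn hornerX.
Qed.

Lemma char_poly_tr n (M : 'M[Cx R]_n) : char_poly M^T = char_poly M.
Proof.
rewrite /char_poly -det_tr; congr (\det _); apply/matrixP => i j.
by rewrite !mxE eq_sym.
Qed.

Lemma det_root n (M : 'M[Cx R]_n) x : x != 0 ->
  \det (1%:M - x *: M) = 0 <-> root (char_poly M) x^-1.
Proof.
move=> x0; rewrite /root horner_char_poly.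
have -> : 1%:M - x *: M = x *: ((x^-1)%:M - M).
  by rewrite scalerBr scale_scalar_mx divff.
by rewrite detZ; split=> [/eqP|/eqP ->]; rewrite ?mulr0// mulf_eq0 expf_eq0 (negPf x0) andbF.
Qed.

(** The roots are followed through their inverses, bounded by [rho^-1]. By [det_root] these are
    zeros of a determinant, and their limit is nonzero because [\det 1%:M] is [1]. *)
Lemma root_char_poly_ultra T (U : set_system T) (UU : UltraFilter U) n
    (M : T -> 'M[Cx R]_n) (L : 'M[Cx R]_n) (a : T -> Cx R) (rho : R) : 0 < rho ->
  (forall i j, (fun t => M t i j) @ U --> L i j) ->
  (\forall t \near U, root (char_poly (M t)) (a t)) -> (\forall t \near U, rho <= modc (a t)) ->
  exists2 x, root (char_poly L) x & rho <= modc x.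
Proof.
move=> rho0 ML Ma arho.
have xb : \forall t \near U, modc (a t)^-1 <= rho^-1.
  move: arho; apply: filterS => t h; rewrite modcV lef_pV2 ?posrE//; exact: lt_le_trans h.
have [x xl] := @ultra_cvg _ _ U UU _ _ xb.
have xrho : modc x <= rho^-1 by exact: cvg_modc_le_cst xl xb.
have dl : (fun t => \det (1%:M - (a t)^-1 *: M t)) @ U --> \det (1%:M - x *: L).
  apply: cvg_det => i j; under eq_fun do rewrite !mxE; rewrite !mxE.
  exact: cvgB (cvg_cst _) (cvgM xl (ML i j)).
have d0 : \forall t \near U, modc (\det (1%:M - (a t)^-1 *: M t)) <= 0.
  move: Ma arho; apply: filterS2 => t rt ht.
  have a0 : a t != 0 by rewrite -modc_gt0; exact: lt_le_trans ht.
  by rewrite (det_root _ _).2 ?modc0 ?invr_eq0 ?invrK.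
have : \det (1%:M - x *: L) = 0.
  by apply/eqP; rewrite -modc_eq0 eq_le modc_ge0 andbT; exact: cvg_modc_le_cst dl d0.
have [->|x0] := eqVneq x 0; first by rewrite scale0r subr0 det1 => /eqP; rewrite oner_eq0.
move=> /(det_root _ x0) Lx; exists x^-1 => //.
by rewrite modcV -[rho]invrK lef_pV2 ?posrE ?invr_gt0 ?modc_gt0.
Qed.

End CharPolyLimits.

Section LempertDiscs.
Context {R : realType} (n' : nat).
Let n := n'.+1.
Implicit Types (A B : 'M[Cx R]_n).

Lemma lempert_le A B alpha f : modc alpha < 1 -> spectral_disc A B alpha f ->
  lempert (@spectral_ball R n) A B <= modc alpha.
Proof.
move=> al1 fd; apply: ge_inf.
  by exists 0 => _ [a _ <-]; exact: modc_ge0.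
by exists alpha => //; split=> //; exists f.
Qed.

Lemma lempert_lt A B c : spectral_ball A -> spectral_ball B ->
  lempert (@spectral_ball R n) A B < c ->
  exists alpha f, [/\ modc alpha < 1, modc alpha < c & spectral_disc A B alpha f].
Proof.
move=> sA sB /(inf_lt _)[|_ [a [a1 [f fd]] <-] ac]; last by exists a, f.
have [a [f [_ a1 fd]]] := spectral_disc_exists sA sB.
by exists (modc a); exists a => //; split=> //; exists f.
Qed.

(** When [alpha = 0] the endpoints coincide, and a constant disc reaches [B] at any small positive
    point. *)
Lemma lempert_lt_neq0 A B c : spectral_ball A -> spectral_ball B ->
  lempert (@spectral_ball R n) A B < c ->
  exists alpha f, [/\ modc alpha < 1, modc alpha < c, alpha != 0 & spectral_disc A B alpha f].
Proof.
move=> sA sB lc; have [alpha [f [al1 ac fd]]] := lempert_lt sA sB lc.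
have [a0|] := eqVneq alpha 0; last by exists alpha, f.
have c0 : 0 < c by apply: le_lt_trans ac; exact: modc_ge0.
have m0 : 0 < Num.min 1 c by rewrite lt_min ltr01.
have hm : Num.min 1 c / 2 < Num.min 1 c by lra.
have h0 : 0 < Num.min 1 c / 2 by lra.
have mh : modc (cplx (Num.min 1 c / 2)) = Num.min 1 c / 2 by rewrite cplx_modc gtr0_norm.
move: hm; rewrite lt_min => /andP[m1 mc].
case: fd => _ _ f0 fB; rewrite a0 f0 in fB.
exists (cplx (Num.min 1 c / 2)), (fun=> A); rewrite mh; split; [exact: m1|exact: mc| |].
  by rewrite -modc_gt0 mh.
split; [|move=> x _; exact: sA|reflexivity|exact: fB].
by move=> z _; exact: derivable_cst.
Qed.

Lemma spectral_disc_tr A B alpha f : spectral_disc A B alpha f ->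
  spectral_disc A^T B^T alpha (fun z => (f z)^T).
Proof.
case=> fh fb f0 fa; split; [| |by rewrite f0|by rewrite fa].
  move=> z z1; apply/derivable_mxCx => i j; under eq_fun do rewrite mxE.
  by have /derivable_mxCx := fh z z1; exact.
move=> z z1; apply/(spectral_ballP _ (ltn0Sn n')) => a.
by rewrite char_poly_tr; move: a; apply/(spectral_ballP _ (ltn0Sn n'))/fb.
Qed.

Lemma derivable_mx_continuous m p (f : Cx R -> 'M[Cx R]_(m, p)) z i j : derivable f z 1 ->
  f x i j @[x --> z] --> f z i j.
Proof.
by move=> /derivable_mxCx/(_ i j) fd; apply/differentiable_continuous/derivable1_diffP.
Qed.

Lemma derivable_dilation (F : Cx R -> Cx R) c z : derivable F (c * z) 1 ->
  derivable (fun x => F (c * x)) z 1.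
Proof.
move=> /derivableCxP[D H]; apply/derivableCxP; exists (D * c) => e e0.
have c0 : 0 < modc c + 1 by have := modc_ge0 c; lra.
have [d d0 {}H] := H (e / (modc c + 1)) (divr_gt0 e0 c0).
exists (d / (modc c + 1)); first exact: divr_gt0.
move=> x; rewrite ltr_pdivlMr// => xd.
have xz0 := modc_ge0 (x - z).
have cx : modc (c * x - c * z) <= modc (x - z) * (modc c + 1).
  by rewrite -mulrBr modcM mulrC ler_wpM2l//; lra.
have := H (c * x) (le_lt_trans cx xd).
rewrite -mulrBr mulrA => /le_trans; apply; rewrite mulrBr.
rewrite mulrAC. rewrite ler_pdivrMr// -mulrA ler_wpM2l// ?(ltW e0)//.
Qed.

Section Continuity.
Variables (A B : 'M[Cx R]_n) (U : set_system 'M[Cx R]_n).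
Hypotheses (UU : UltraFilter U) (UA : nbhs A `<=` U).
Hypotheses (sA : spectral_ball A) (sB : spectral_ball B).

Lemma cvg_entry i j : (fun Z : 'M[Cx R]_n => Z i j) @ U --> A i j.
Proof. by apply: (cvg_trans _ (@coord_continuous _ _ _ i j A)) => V /UA. Qed.

Lemma lempert_usc e : 0 < e ->
  U [set Z | lempert (@spectral_ball R n) Z B < lempert (@spectral_ball R n) A B + e].
Proof.
move=> e0; set l := lempert _ A B; have le : l < l + e by rewrite ltrDl.
have [alpha [f [al1 alc al0 [fh fb f0 fa]]]] := lempert_lt_neq0 sA sB le.
pose c := Num.min 1 (l + e); have ac : modc alpha < c by rewrite lt_min al1.
have a0 : 0 < modc alpha by rewrite modc_gt0.
have c0 : 0 < c by exact: lt_trans ac.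
(* Midway between [modc alpha / c] and [1]: the dilated disc extends past the unit circle, while
   [alpha / cplx r] still has modulus below [c]. *)
pose r := (modc alpha / c + 1) / 2.
have q1 : modc alpha / c < 1 by rewrite ltr_pdivrMr// mul1r.
have q0 : 0 < modc alpha / c by rewrite divr_gt0.
have r1 : r < 1 by rewrite /r; lra.
have r0 : 0 < r by rewrite /r; lra.
have rc : modc alpha / r < c.
  by rewrite ltr_pdivrMr// mulrC -ltr_pdivrMr// /r; lra.
have cr0 : cplx r != 0 by rewrite -modc_gt0 cplx_modc gtr0_norm.
pose g Z z := f (cplx r * z) + (1 - z * cplx r / alpha) *: (Z - A).
have rz z : modc z <= 1 -> modc (cplx r * z) < 1.
  move=> z1; rewrite modcM cplx_modc gtr0_norm//; apply: le_lt_trans r1.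
  by rewrite ger_pMr.
have gd Z z : modc z < 1 -> derivable (g Z) z 1.
  move=> z1; apply/derivable_mxCx => i j.
  have -> : (fun x => g Z x i j) =
      (fun x => f (cplx r * x) i j + (1 - x * (cplx r / alpha)) * (Z i j - A i j)).
    by apply/funext => x; rewrite !mxE mulrA.
  apply: derivable_add.
    apply: (@derivable_dilation (fun x => f x i j)).
    by have /derivable_mxCx := fh _ (rz _ (ltW z1)); exact.
  apply: derivable_mul; last exact: derivable_cst.
  apply: derivable_sub; first exact: derivable_cst.
  by apply: derivable_mul; [exact: derivable_id|exact: derivable_cst].
suff gb : \forall Z \near U, forall z, modc z < 1 -> spectral_ball (g Z z).
  have : U [set Z | forall z, modc z < 1 -> spectral_ball (g Z z)] by exact: gb.
  apply: filterS => Z gZ /=; apply: le_lt_trans (_ : modc (alpha / cplx r) < _).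
    apply: (@lempert_le _ _ _ (g Z)).
      by rewrite modcf cplx_modc gtr0_norm//; apply: lt_le_trans rc _; rewrite ge_min lexx.
    split; [exact: gd|exact: gZ| |].
    - by rewrite /g mulr0 !mul0r f0 subr0 scale1r addrC subrK.
    - by rewrite /g mulrCA divff// mulr1 mulfVK// divff// subrr scale0r addr0.
  by rewrite modcf cplx_modc gtr0_norm//; apply: lt_le_trans rc _; rewrite ge_min lexx orbT.
apply: contrapT => NU.
have [|UN] := in_ultra_setVsetC [set Z | forall z, modc z < 1 -> spectral_ball (g Z z)] UU.
  exact: NU.
(* Otherwise, along [U], some [g Z z] has an eigenvalue of modulus at least [1]. The points [z] have
   a limit [w] in the closed disc, which [cplx r] maps into the open one, and [f (cplx r * w)]
   inherits such an eigenvalue. *)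
have /choice[za zaP] : forall Z, exists za : Cx R * Cx R,
    ~ (forall z, modc z < 1 -> spectral_ball (g Z z)) ->
    [/\ modc za.1 < 1, root (char_poly (g Z za.1)) za.2 & 1 <= modc za.2].
  move=> Z; have [h|h] := pselect (forall z, modc z < 1 -> spectral_ball (g Z z)).
    by exists (0, 0).
  move: h => /existsNP[z /not_implyP[z1]].
  move=> /(spectral_ballP _ (ltn0Sn n')) /existsNP[a /not_implyP[ra /negP]].
  rewrite -leNgt => a1; exists (z, a) => _.
  by split; [exact: z1|exact: ra|exact: a1].
have zb : \forall Z \near U, modc (za Z).1 <= 1.
  by move: UN; apply: filterS => Z /zaP[/ltW].
have [w wl] := @ultra_cvg _ _ U UU _ _ zb.
have w1 : modc w <= 1 by exact: cvg_modc_le_cst wl zb.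
have [|||x rx x1] := @root_char_poly_ultra _ _ U UU n (fun Z => g Z (za Z).1) (f (cplx r * w))
  (fun Z => (za Z).2) 1 ltr01.
- move=> i j; have -> : (fun Z => g Z (za Z).1 i j) =
    (fun Z => f (cplx r * (za Z).1) i j + (1 - (za Z).1 * cplx r / alpha) * (Z i j - A i j)).
    by apply/funext => Z; rewrite !mxE.
  rewrite -[X in _ --> X]addr0 -[X in _ --> _ + X](mulr0 (1 - w * cplx r / alpha)).
  have h1 : (fun Z => f (cplx r * (za Z).1) i j) @ U --> f (cplx r * w) i j.
    have h0 : (fun Z => cplx r * (za Z).1) @ U --> cplx r * w by exact: cvgM (cvg_cst _) wl.
    exact: cvg_comp h0 (derivable_mx_continuous (fh _ (rz _ w1))).
  have h2 : (fun Z => 1 - (za Z).1 * cplx r / alpha) @ U --> 1 - w * cplx r / alpha.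
    exact: cvgB (cvg_cst _) (cvgM (cvgM wl (cvg_cst _)) (cvg_cst _)).
  have h3 : (fun Z : 'M[Cx R]_n => Z i j - A i j) @ U --> (0 : Cx R).
    rewrite -[X in _ --> X](subrr (A i j)); exact: cvgB (@cvg_entry i j) (cvg_cst _).
  exact: cvgD h1 (cvgM h2 h3).
- by move: UN; apply: filterS => Z /zaP[].
- by move: UN; apply: filterS => Z /zaP[].
have := fb _ (rz _ w1).
move=> /(spectral_ballP _ (ltn0Sn n'))/(_ _ rx); lra.
Qed.

(** Upper semicontinuity of the spectral radius; it provides the common bound at [0] that
    [root_modulus_bound] asks for. *)
Lemma root_char_poly_near : exists2 rho : R, rho < 1 &
  \forall Z \near U, forall a, root (char_poly Z) a -> modc a <= rho.
Proof.
have [s sE] := closed_field_poly_normal (char_poly A).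
rewrite (monicP (char_poly_monic _)) scale1r in sE.
have /(spectral_ballP _ (ltn0Sn n')) sA' := sA.
have [r0 r01 r0P] : exists2 r : R, 0 <= r < 1 & forall y, y \in s -> modc y <= r.
  have : forall y, y \in s -> modc y < 1 by move=> y ys; apply: sA'; rewrite sE root_prod_XsubC.
  elim: s {sE} => [|y s IH] s1; first by exists 0; rewrite ?lexx ?ltr01.
  have [x ys|r /andP[r0 r1] rP] := IH; first by rewrite s1// in_cons ys orbT.
  have y1 := s1 y (mem_head _ _).
  exists (Num.max r (modc y)); first by rewrite le_max gt_max r1 y1 r0.
  move=> x; rewrite in_cons le_max => /orP[/eqP ->|/rP ->//]; by rewrite lexx orbT.
exists ((1 + r0) / 2); first lra.
apply: contrapT => NU.
have [|UN] := in_ultra_setVsetC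
  [set Z : 'M[Cx R]_n | forall a, root (char_poly Z) a -> modc a <= (1 + r0) / 2] UU.
  exact: NU.
have /choice[a aP] : forall Z : 'M[Cx R]_n, exists a : Cx R,
    ~ (forall a, root (char_poly Z) a -> modc a <= (1 + r0) / 2) ->
    root (char_poly Z) a /\ (1 + r0) / 2 <= modc a.
  move=> Z; have [h|] := pselect (forall a, root (char_poly Z) a -> modc a <= (1 + r0) / 2).
    by exists 0.
  move=> /existsNP[a /not_implyP[ra /negP]]; rewrite -ltNge => /ltW a1; exists a => _.
  by split; [exact: ra|exact: a1].
have h0 : 0 < (1 + r0) / 2 by lra.
have [||x] := @root_char_poly_ultra _ _ U UU n id A a _ h0 cvg_entry.
- by move: UN; apply: filterS => Z /aP[].
- by move: UN; apply: filterS => Z /aP[].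
rewrite sE root_prod_XsubC => /r0P; lra.
Qed.

End Continuity.

End LempertDiscs.

Lemma eq_poly_horner (R : realType) (p q : {poly Cx R}) : (forall x, p.[x] = q.[x]) -> p = q.
Proof.
move=> pq; apply/eqP; rewrite -subr_eq0; apply: contraT => /closed_nonrootP[x].
by rewrite /root hornerD hornerN pq subrr eqxx.
Qed.

(** Being an estimate of values, it passes to pointwise limits of polynomials, with no convergence
    of roots to establish. *)
Lemma horner_monic_ge (R : realType) (P : {poly Cx R}) m (tau : R) x :
  P \is monic -> size P = m.+1 ->
  (forall y, root P y -> modc y <= tau) -> tau <= modc x ->
  (modc x - tau) ^+ m <= modc P.[x].
Proof.
move=> Pm Ps Pr xt; have [s sE] := closed_field_poly_normal P.
rewrite (monicP Pm) scale1r in sE.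
have sm : size s = m by apply/eqP; rewrite -eqSS -Ps sE size_prod_XsubC.
have {Pr} sP y : y \in s -> modc y <= tau by move=> ys; apply: Pr; rewrite sE root_prod_XsubC.
rewrite sE -sm; elim: s {sE sm} sP => [|y s IH] sP; first by rewrite big_nil hornerC modc1.
rewrite big_cons hornerM modcM hornerXsubC exprS; apply: ler_pM.
- by rewrite subr_ge0.
- by rewrite exprn_ge0// subr_ge0.
- by apply: le_trans (modcDB x y); rewrite lerB// sP// mem_head.
- by apply: IH => z zs; apply: sP; rewrite in_cons zs orbT.
Qed.

Section LowerSemicontinuity.
Context {R : realType} (n' : nat).
Let n := n'.+1.
Variables (A B : 'M[Cx R]_n) (U : set_system 'M[Cx R]_n) (v : 'rV[Cx R]_n).
Hypotheses (UU : UltraFilter U) (UA : nbhs A `<=` U) (US : U (@spectral_ball R n)).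
Hypotheses (sA : spectral_ball A) (sB : spectral_ball B) (Av : row_cyclic A^T v).

Lemma lempert_lsc e : 0 < e ->
  U [set Z | lempert (@spectral_ball R n) A B - e < lempert (@spectral_ball R n) Z B].
Proof.
move=> e0; set l := lempert _ A B; apply: contrapT => NU.
have [//|UN] := in_ultra_setVsetC [set Z | l - e < lempert (@spectral_ball R n) Z B] UU.
(* Strictly between [l - e] and [l]: the discs for [Z] can be taken with [modc alpha < c], their
   limit point stays below [l], and [c < 1] makes the constants [M i / (1 - c) ^+ (bet i).+1] common
   to all of them. *)
pose c := l - e / 2.
have c1 : c < 1.
  rewrite /c; have /andP[_] := lempert_itv (@spectral_ball R n) A B; rewrite -/l; lra.
(* Transposes appear because the normal forms act on rows while the cyclic vector of [A] is a
   column. *)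
have [P [lam [bet [Pu PB bet0 bet_le bdvd]]]] := similar_bidiag B^T.
have /choice[M MP] := fun i => spectral_disc_ncoef i Pu PB bet_le bdvd.
have /choice[D DP] : forall Z : 'M[Cx R]_n, exists D : Cx R * (Cx R -> 'M[Cx R]_n),
    spectral_ball Z -> ~ (l - e < lempert (@spectral_ball R n) Z B) ->
    [/\ modc D.1 < 1, modc D.1 < c & spectral_disc Z^T B^T D.1 D.2].
  move=> Z; have [sZ|] := pselect (spectral_ball Z); last by exists (0, fun=> 0).
  have [lZ|] := boolP (l - e < lempert (@spectral_ball R n) Z B).
    by exists (0, fun=> 0) => _ /(_ isT).
  rewrite -leNgt => lZ.
  have [|al [f [al1 ac fd]]] := @lempert_lt _ _ Z B c sZ sB; first by rewrite /c; lra.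
  exists (al, fun z => (f z)^T) => _ _.
  by split; [exact: al1|exact: ac|exact: spectral_disc_tr].
have {}DP : \forall Z \near U, [/\ modc (D Z).1 < 1, modc (D Z).1 < c &
    spectral_disc Z^T B^T (D Z).1 (D Z).2].
  by move: US UN; apply: filterS2 => Z; exact: DP.
have Dc : \forall Z \near U, modc (D Z).1 <= c by move: DP; apply: filterS => Z [_ /ltW].
have [al all] := @ultra_cvg _ _ U UU _ _ Dc.
have alc : modc al <= c by exact: cvg_modc_le_cst all Dc.
have al1 : modc al < 1 by exact: le_lt_trans c1.
have /choice[G GP] : forall i : 'I_n, exists G : Cx R -> Cx R,
    (forall z, modc z < 1 -> derivable G z 1) /\ forall z, modc z < 1 ->
    (fun Z => ncoef lam i (char_poly ((D Z).2 z))) @ U --> (z - al) ^+ (bet i).+1 * G z.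
  move=> i.
  have /choice[bG bGP] : forall Z : 'M[Cx R]_n, exists bG : (nat -> Cx R) * (Cx R -> Cx R),
      [/\ modc (D Z).1 < 1, modc (D Z).1 < c & spectral_disc Z^T B^T (D Z).1 (D Z).2] ->
      power_series bG.1 (M i / (1 - c) ^+ (bet i).+1) bG.2 /\
      forall z, modc z < 1 ->
        ncoef lam i (char_poly ((D Z).2 z)) = (z - (D Z).1) ^+ (bet i).+1 * bG.2 z.
    move=> Z.
    have [[d1 dc dd]|] := pselect [/\ modc (D Z).1 < 1, modc (D Z).1 < c &
      spectral_disc Z^T B^T (D Z).1 (D Z).2]; last by exists (fun=> 0, fun=> 0).
    have [b [G [bG GE]]] := MP i _ _ _ d1 dd.
    exists (b, G) => _; split; last exact: GE.
    apply: (power_series_weaken _ bG).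
    have d0 : 0 < 1 - modc (D Z).1 by lra.
    have M0 : 0 <= M i.
      by have := power_series_ge0 bG; rewrite pmulr_lge0// invr_gt0 exprn_gt0.
    rewrite ler_wpM2l// lef_pV2 ?posrE ?exprn_gt0//; last lra.
    by rewrite lerXn2r ?nnegrE; lra.
  have [|b [G [bGs GG]]] :=
    @power_series_limit _ _ U (fun Z => (bG Z).1) (M i / (1 - c) ^+ (bet i).+1)
      (fun Z => (bG Z).2) UU.
    by move: DP; apply: filterS => Z /bGP[].
  exists G; split=> z z1; first exact: power_series_derivable bGs z1.
  apply: (@cvg_trans _ ((fun Z => (z - (D Z).1) ^+ (bet i).+1 * (bG Z).2 z) @ U)).
    apply: near_eq_cvg; move: DP; apply: filterS => Z /bGP[_ h].
    by rewrite h.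
  have h1 : (fun Z => z - (D Z).1) @ U --> z - al by exact: cvgB (cvg_cst _) all.
  have h2 : (fun Z => (z - (D Z).1) ^+ (bet i).+1) @ U --> (z - al) ^+ (bet i).+1.
    exact: cvg_expn h1.
  exact: cvgM h2 (GG z z1).
(* [hessenberg_disc] subtracts the Newton terms and indexes them by [nat], hence the sign and the
   default value [0]. *)
pose G' k z := - (if insub k is Some i then G i z else 0).
have G'd k z : modc z < 1 -> derivable (G' k) z 1.
  move=> z1; apply: derivableN; rewrite /G'; case: insub => [i|]; last exact: derivable_cst.
  by have [Gd _] := GP i; exact: Gd.
pose p z := newton lam n - \sum_(i < n) ((z - al) ^+ (bet i).+1 * G' i z) *: newton lam i.
have pl z x : modc z < 1 -> (fun Z => (char_poly ((D Z).2 z)).[x]) @ U --> (p z).[x].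
  move=> z1.
  have -> : (fun Z => (char_poly ((D Z).2 z)).[x]) = (fun Z => (newton lam n).[x] +
      \sum_(i < n) ncoef lam i (char_poly ((D Z).2 z)) * (newton lam i).[x]).
    apply/funext => Z.
    rewrite {1}(newton_expand_monic lam (char_poly_monic _) (size_char_poly _)).
    by rewrite (hornerD (newton lam n)) horner_sum; congr (_ + _); apply: eq_bigr => i _; rewrite hornerZ.
  have -> : (p z).[x] = (newton lam n).[x] +
      \sum_(i < n) ((z - al) ^+ (bet i).+1 * G i z) * (newton lam i).[x].
    rewrite /p (hornerD (newton lam n)) hornerN horner_sum -sumrN; congr (_ + _); apply: eq_bigr => i _.
    by rewrite hornerZ /G' valK mulrN mulNr opprK.
  apply: (cvgD (cvg_cst _)); apply: cvg_bigsumCx => i.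
  by have [_ Gl] := GP i; exact: cvgM (Gl z z1) (cvg_cst _).
have p0 : p 0 = char_poly A^T.
  apply: eq_poly_horner => x.
  have m0 : modc (0 : Cx R) < 1 by rewrite modc0.
  have h0 := pl 0 x m0.
  have h1 : (fun Z => (char_poly ((D Z).2 0)).[x]) @ U --> (char_poly A^T).[x].
    apply: (@cvg_trans _ ((fun Z : 'M[Cx R]_n => \det (x%:M - Z)) @ U)).
      apply: near_eq_cvg; move: DP; apply: filterS => Z [_ _ [_ _ -> _]].
      by rewrite char_poly_tr horner_char_poly.
    rewrite char_poly_tr horner_char_poly; apply: cvg_det => i j.
    under eq_fun do rewrite mxE [in X in _ + X]mxE; rewrite mxE [in X in _ + X]mxE.
    apply: (cvgB (cvg_cst _)); exact: cvg_entry.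
  exact: cvg_unique h0 h1.
have [rho rho1 rhoP] := root_char_poly_near UU UA sA.
have proot z x : modc z < 1 -> root (p z) x -> modc x < 1.
  move=> z1 px; have zs : 0 <= modc z < 1 by rewrite modc_ge0.
  have [tau tau1 tauP] := root_modulus_bound (ltn0Sn n') rho1 zs.
  rewrite ltNge; apply/negP => x1.
  have tx : 0 < modc x - tau by lra.
  (* Along [U] the roots stay within [tau < 1], so the values at [x], where [1 <= modc x], are
     bounded away from [0]; the limit [(p z).[x]] cannot vanish. *)
  have lb : \forall Z \near U, (modc x - tau) ^+ n <= modc (char_poly ((D Z).2 z)).[x].
    move: DP rhoP; apply: filterS2 => Z [_ _ [fh fb f0 _]] Zrho.
    apply: horner_monic_ge; [exact: char_poly_monic|exact: size_char_poly| |lra].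
    move=> y; apply: (tauP (fun w => char_poly ((D Z).2 w)) _ _ _ _ _ z y (lexx _)).
    - by move=> w; exact: char_poly_monic.
    - by move=> w; exact: size_char_poly.
    - by move=> w w1; exact/coef_derivable_char_poly/fh.
    - by move=> w a w1; move: a; apply/(spectral_ballP _ (ltn0Sn n'))/fb.
    - by move=> a; rewrite f0 char_poly_tr; exact: Zrho.
  have px0 : (p z).[x] = 0 by exact/eqP.
  have near0 : \forall Z \near U,
      modc ((char_poly ((D Z).2 z)).[x] - (p z).[x]) < (modc x - tau) ^+ n.
    by apply: ((cvgCxP _ _ _).1 (pl z x z1)); rewrite exprn_gt0.
  have [Z [/= h1 h2]] := filter_ex (filterI lb near0).
  by move: h2; rewrite px0 subr0 ltNge h1.
suff [al' [f [al'1 al'c fd]]] : exists al' f,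
    [/\ modc al' < 1, modc al' < l & spectral_disc A^T B^T al' f].
  have fd' : spectral_disc A B al' (fun z => (f z)^T).
    by have := spectral_disc_tr fd; rewrite (trmxK A) (trmxK B); exact.
  have h : l <= modc al' by exact: lempert_le al'1 fd'.
  by move: al'c; rewrite ltNge h.
have cl : c < l by rewrite /c; lra.
(* If [al = 0], all Newton terms vanish at [0], so [char_poly A^T] is [newton lam n], the
   characteristic polynomial of [B^T]. The constant family then works at any nonzero point of the
   disc, such as [l / 2], positive since [0 <= c < l]. *)
have [al0|al0] := eqVneq al 0; last first.
  have [f fd] := hessenberg_disc Pu PB bet0 bet_le Av al1 al0 G'd proot p0.
  by exists al, f; split; [exact: al1|exact: le_lt_trans cl|exact: fd].
have c0 : 0 <= c by apply: le_trans alc; exact: modc_ge0.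
have l1 : l < 1 by have /andP[_] := lempert_itv (@spectral_ball R n) A B.
have mh : modc (cplx (l / 2)) = l / 2 by rewrite cplx_modc ger0_norm//; lra.
have newtonA : newton lam n = char_poly A^T.
  rewrite -p0 /p al0 big1 ?subr0// => i _.
  by rewrite expr0n mul0r scale0r.
have [|||||f fd] := @hessenberg_disc R n' A^T B^T (cplx (l / 2)) P lam bet (fun _ _ => 0) v
    Pu PB bet0 bet_le Av.
- by rewrite mh; lra.
- by rewrite -modc_gt0 mh; lra.
- by move=> i z _; exact: derivable_cst.
- move=> z a _; rewrite big1 ?subr0; last by move=> i _; rewrite mulr0 scale0r.
  by rewrite newtonA char_poly_tr => ra; have /(spectral_ballP _ (ltn0Sn n')) := sA; exact.
- by rewrite big1 ?subr0// => i _; rewrite mulr0 scale0r.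
by exists (cplx (l / 2)), f; rewrite mh; split; [lra|lra|exact: fd].
Qed.


End LowerSemicontinuity.

(** A spanning family of [n] vectors in dimension [n] is free, which is the statement about
    polynomials after transposition. *)
Lemma cyclic_mx_row_cyclic (R : realType) n' (A : 'M[Cx R]_n'.+1) :
  cyclic_mx A -> exists v, row_cyclic A^T v.
Proof.
case=> v spanv; exists v^T => p sp pv.
set n := n'.+1 in A v spanv p sp pv *.
have ss : size [seq A ^+ k *m v | k <- iota 0 n] == n by rewrite size_map size_iota.
have fs : free (Tuple ss) by rewrite /free size_tuple spanv dimvf /dim /= muln1.
have trX k : A^T ^+ k = (A ^+ k)^T.
  by elim: k => [|k IH]; rewrite ?expr0 ?trmx1// exprS IH exprSr trmx_mul.
have nthE (k : 'I_n) : (Tuple ss)`_k = A ^+ k *m v.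
  by rewrite [LHS](nth_map 0%N) ?size_iota// nth_iota.
have pE : v^T *m horner_mx A^T p = (\sum_(k < n) p`_k *: (Tuple ss)`_k)^T.
  rewrite -{1}(take_poly_id sp) /take_poly poly_def linear_sum /= mulmx_sumr linear_sum /=.
  apply: eq_bigr => k _; rewrite linearZ /= rmorphXn /= horner_mx_X trX -scalemxAr -trmx_mul.
  by rewrite nthE linearZ.
have psum : \sum_(k < n) p`_k *: (Tuple ss)`_k = 0.
  by apply: trmx_inj; rewrite -pE pv trmx0.
apply/polyP => k; rewrite coef0.
have [kn|nk] := ltnP k n; last by rewrite nth_default// (leq_trans sp).
by have /freeP/(_ _ psum (Ordinal kn)) := fs.
Qed.

Theorem proposition1p4 (R : realType) (n : nat) (A B : 'M[Cx R]_n) :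
  (0 < n)%N ->
  spectral_ball A ->
  spectral_ball B ->
  cyclic_mx A ->
  ((exists! a : Cx R, eigenvalue B a) \/ (n <= 3)%N) ->
  lempert (@spectral_ball R n) Z B
    @[Z --> within (@spectral_ball R n) (nbhs A)]
    --> lempert (@spectral_ball R n) A B.
Proof.
case: n A B => [//|n'] A B _ sA sB /cyclic_mx_row_cyclic[v Av] _.
apply/cvgrPdist_lt => e e0.
have FF : ProperFilter (within (@spectral_ball R n'.+1) (nbhs A)).
  apply: Build_ProperFilter_ex => V /nbhs_singleton AV; exists A; exact: AV.
(* Convergence may be tested along the finer ultrafilters, on which bounded families have limits. *)
apply: ultra_filter_le => U UU sU.
have UA : nbhs A `<=` U.
  by move=> V AV; apply: sU; move: AV; apply: filterS => Z VZ _.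
have US : U (@spectral_ball R n'.+1).
  by apply: sU; apply: nearW => Z.
move: (lempert_usc UU UA sA sB e0) (lempert_lsc UU UA US sA sB Av e0).
apply: filterS2 => Z /= h1 h2; rewrite ltr_distl; apply/andP; split; lra.
Qed.
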